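(* Let $\beta\in(0,1)$, $d\in\mathbb{N}$ with $d>2/\beta$, let $\mu$ be a $\sigma$-finite measure on $\mathbb{R}^d$, and let $\xi$ be a $(2,\beta)$-superprocess in $\mathbb{R}^d$ that is locally finite under $P_\mu$. Let $c_{\beta,d}>0$ be the constant specified in the context. Then for any fixed $t>0$ and $x\in\mathbb{R}^d$, as $\varepsilon\to0$, $$\varepsilon^{2/\beta-d}\,P_\mu\{\xi_tB_x^\varepsilon>0\}\to c_{\beta,d}\,(\mu*p_t)(x).$$ The convergence is uniform for bounded $\|\mu\|$, bounded $t^{-1}$, and $x\in\mathbb{R}^d$ (i.e. for any $M,a>0$, uniform over all finite $\mu$ with $\|\mu\|\le M$, all $t\ge a$, and all $x\in\mathbb{R}^d$). Similarly, for the clusters $\eta_t$, $$\varepsilon^{2/\beta-d}\,P_\mu\{\eta_tB_x^\varepsilon>0\}\to c_{\beta,d}\,(\beta t)^{1/\beta}(\mu*p_t)(x),$$ for fixed $t>0$ and $x\in\mathbb{R}^d$, and uniformly in the same sense.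
   Context: Notation: $\mu f=\int f\,d\mu$, $\|\mu\|=\mu(\mathbb{R}^d)$, $B_x^r$ is the open ball of radius $r$ around $x$, $p_t(x)=p(t,x)=(2\pi t)^{-d/2}e^{-|x|^2/(2t)}$, and $(\mu*p_t)(x)=\int p_t(x-y)\,\mu(dy)$. For $\beta\in(0,1]$, a $(2,\beta)$-superprocess $\xi=(\xi_t)_{t\ge0}$ in $\mathbb{R}^d$ is a vaguely rcll measure-valued strong Markov process with $E_\mu e^{-\xi_t f}=e^{-\mu v_t}$ for suitable (e.g. bounded measurable) $f\ge0$, where $v$ is the unique (mild) solution of $\dot v=\frac12\Delta v-v^{1+\beta}$, $v_0=f$. For $\sigma$-finite $\mu$, the process is constructed by additivity, as a sum of countably many independent copies with finite initial measures summing to $\mu$. $P_\mu$ refers to initial measure $\mu$. The process is locally finite under $P_\mu$ if for every $t>0$, $P_\mu$-a.s., $\xi_tB<\infty$ for all bounded Borel $B$. Clusters: for fixed $t>0$, under $P_\mu$ the random measure $\xi_t$ is distributed as a sum of conditionally independent clusters rooted at the points of a Poisson process with intensity $(\beta t)^{-1/\beta}\mu$. $P_x\{\eta_t\in\cdot\}$ is the law of a cluster rooted at $x$; equivalently, the probability law on nonzero measures with $E_{\delta_x}e^{-\xi_tf}=\exp\{-(\beta t)^{-1/\beta}E_x(1-e^{-\eta_tf})\}$ for all $f\geq0$. Also $P_\mu\{\eta_t\in\cdot\}=\int\mu(dx)P_x\{\eta_t\in\cdot\}$ (a measure of total mass $\|\mu\|$). The constant: fix a continuous $f$ on $\mathbb{R}^d$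 with $0<f\le1$ on $B_0^1$ and $f=0$ off $B_0^1$; let $v_\lambda$ solve $\dot v=\frac12\Delta v-v^{1+\beta}$ with $v(0)=\lambda f$, and $v_\infty=\lim_{\lambda\to\infty}v_\lambda$ (increasing limit). Then $c_{\beta,d}>0$ is the constant, depending only on $\beta$ and $d$, with $\lim_{\varepsilon\to0}\varepsilon^{-d}v_\infty(\varepsilon^{-2}t,\varepsilon^{-1}x)=c_{\beta,d}\,p(t,x)$ for all $t>0$, $x\in\mathbb{R}^d$. *)

(* Defs.v *)
From HB Require Import structures.
From mathcomp Require Import all_boot all_order all_algebra.
From mathcomp Require Import all_classical all_reals all_analysis.
From mathcomp Require Import measurable_realfun.

Set Implicit Arguments.
Unset Strict Implicit.
Unset Printing Implicit Defensive.

Import Order.TTheory GRing.Theory Num.Theory.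
Import numFieldNormedType.Exports.

Local Open Scope classical_set_scope.
Local Open Scope ring_scope.

Definition borel_rV_display : measure_display.
Proof. exact: default_measure_display. Qed.

Section borel_rV.
Context (R : realType) (n : nat).

Definition borel_rV : set (set 'rV[R]_n) := <<s [set A | open A] >>.

Let borel_rV0 : borel_rV set0.
Proof. exact: sigma_algebra0. Qed.

Let borel_rVC A : borel_rV A -> borel_rV (~` A).
Proof. exact: sigma_algebraC. Qed.

Let borel_rV_bigcup (F : (set 'rV[R]_n)^nat) :
  (forall i, borel_rV (F i)) -> borel_rV (\bigcup_i F i).
Proof. exact: sigma_algebra_bigcup. Qed.

HB.instance Definition _ := @isMeasurable.Build borel_rV_display 'rV[R]_n
  borel_rV borel_rV0 borel_rVC borel_rV_bigcup.

End borel_rV.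

Section borel_rV_theory.
Context (R : realType) (n : nat).

Lemma open_measurable_rV (A : set 'rV[R]_n) : open A -> measurable A.
Proof. by move=> oA; exact: sub_sigma_algebra. Qed.

Lemma measurable_coord_rV (i : 'I_n) :
  measurable_fun [set: 'rV[R]_n] (fun x : 'rV[R]_n => x 0 i).
Proof.
apply: (measurability _ (RGenOpens.measurableE R)).
move=> _ [_ [a [b ->] <-]]; rewrite setTI.
apply: open_measurable_rV.
apply: open_comp; last exact: interval_open.
by move=> x _; exact: coord_continuous.
Qed.

Lemma measurable_fun_rV d (T : measurableType d) (f : T -> 'rV[R]_n) :
  (forall i, measurable_fun [set: T] (fun x => f x 0 i)) ->
  measurable_fun [set: T] f.
Proof.
move=> mf; apply: (@measurability _ _ T _ setT f [set A | open A]) => //.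
move=> _ [A oA <-]; rewrite setTI.
pose q (c : 'rV[rat]_n) : 'rV[R]_n := map_mx ratr c.
pose I := [set u : 'rV[rat]_n * nat | ball (q u.1) (u.2.+1%:R^-1 : R) `<=` A].
have mB u : measurable (f @^-1` (ball (q u.1) (u.2.+1%:R^-1 : R))).
  rewrite (_ : _ @^-1` _ = \bigcap_(i in [set: 'I_n])
     ((fun x => f x 0 i) @^-1` ball (q u.1 0 i) (u.2.+1%:R^-1 : R))).
    apply: fin_bigcap_measurable => // i _.
    rewrite -[X in measurable X]setTI; apply: mf => //.
    exact: measurable_ball.
  apply/seteqP; split => [x [_ /= h] i _|x h]; first exact: h.
  split; first by rewrite invr_gt0.
  by move=> i j; rewrite ord1; exact: h.
have -> : f @^-1` A = \bigcup_(u in I)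
    (f @^-1` ball (q u.1) (u.2.+1%:R^-1 : R)).
  apply/seteqP; split => [x Ax|x [u Iu]]; last exact: Iu.
  have := oA; rewrite openE => /(_ _ Ax) /nbhs_ballP [e /= e0 eA].
  have e20 : 0 < e / 2 by rewrite divr_gt0.
  have [k _ ke] : exists2 k, True & (k.+1%:R^-1 : R) < e / 2.
    have := near_infty_natSinv_lt (PosNum e20).
    by move=> [k _ /(_ k (leqnn k))]; exists k.
  have k0 : 0 < (k.+1%:R^-1 : R) by rewrite invr_gt0.
  have hr i : exists r : rat,
      ratr r \in `](f x 0 i - k.+1%:R^-1), (f x 0 i + k.+1%:R^-1)[.
    by apply: rat_in_itvoo; rewrite ltrD2l gtrN.
  pose c : 'rV[rat]_n := \row_i projT1 (cid (hr i)).
  have cB : ball (q c) (k.+1%:R^-1 : R) (f x).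
    split => // i j; rewrite ord1 !mxE; case: cid => r /=.
    rewrite in_itv /= => /andP[h1 h2].
    by rewrite /ball /= ltr_distl h1 h2.
  exists (c, k) => //= y cy; apply: eA.
  apply: (@le_ball _ _ _ (k.+1%:R^-1 + k.+1%:R^-1)).
    by rewrite [leRHS]splitr lerD// ltW.
  exact: ball_triangle (ball_sym cB) cy.
rewrite bigcup_mkcond; apply: countable_bigcupT_measurable => [|u].
  exact: countableP.
by case: ifPn.
Qed.

End borel_rV_theory.

Section lebesgue_rV.
Context {R : realType}.

(* Lebesgue measure on 'rV[R]_n is the n-fold product of lebesgue_measure,
   transported along the insertion of a first coordinate; see
   lebesgue_rV_box. *)
Definition cons_rV n (u : R * 'rV[R]_n) : 'rV[R]_n.+1 :=
  \row_i oapp (u.2 0) u.1 (unlift ord0 i).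

Lemma measurable_cons_rV n :
  measurable_fun [set: R * 'rV[R]_n] (@cons_rV n).
Proof.
apply: measurable_fun_rV => i.
have [j ij|i0] := unliftP ord0 i.
  apply: (eq_measurable_fun (fun u : R * 'rV[R]_n => u.2 0 j)) => [u _|].
    by rewrite mxE ij liftK.
  exact: (measurableT_comp (measurable_coord_rV j) measurable_snd).
apply: (eq_measurable_fun (fun u : R * 'rV[R]_n => u.1)) => [u _|].
  by rewrite mxE i0 unlift_none.
exact: measurable_fst.
Qed.

Section step.
Context (n : nat) (m : {sigma_finite_measure set 'rV[R]_n -> \bar R}).

Definition lebesgue_cons : set 'rV[R]_n.+1 -> \bar R :=
  pushforward (lebesgue_measure \x m)%E (@cons_rV n).

Let lebesgue_cons0 : lebesgue_cons set0 = 0%E.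
Proof. by rewrite /lebesgue_cons /pushforward preimage_set0 measure0. Qed.

Let lebesgue_cons_ge0 A : (0 <= lebesgue_cons A)%E.
Proof. by rewrite /lebesgue_cons /pushforward; exact: measure_ge0. Qed.

Let lebesgue_cons_sigma_additive : semi_sigma_additive lebesgue_cons.
Proof.
have mc B : measurable B -> measurable (@cons_rV n @^-1` B).
  by move=> mB; rewrite -[X in measurable X]setTI; exact: measurable_cons_rV.
move=> F mF tF mUF; rewrite /lebesgue_cons /pushforward preimage_bigcup.
apply: measure_semi_sigma_additive => [k||]; first exact: mc.
- apply/trivIsetP => /= i j _ _ ij; rewrite -preimage_setI.
  by move/trivIsetP : tF => /(_ _ _ _ _ ij) ->//; rewrite preimage_set0.
- by rewrite -preimage_bigcup; exact: mc.
Qed.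

HB.instance Definition _ := isMeasure.Build _ _ _ lebesgue_cons
  lebesgue_cons0 lebesgue_cons_ge0 lebesgue_cons_sigma_additive.

Let lebesgue_cons_sigma_finite : sigma_finite setT lebesgue_cons.
Proof.
have /sigma_finiteP[F [TF ndF Foo]] :=
  sigma_finiteT (@lebesgue_measure R).
have /sigma_finiteP[G [TG ndG Goo]] := sigma_finiteT m.
pose unc (x : 'rV[R]_n.+1) : R * 'rV[R]_n :=
  (x 0 ord0, \row_j x 0 (lift ord0 j)).
have consK : cancel (@cons_rV n) unc.
  move=> [a y]; rewrite /unc !mxE unlift_none /=; congr pair.
  by apply/rowP => j; rewrite !mxE liftK.
have munc : measurable_fun setT unc.
  apply/measurable_fun_pairP; split; first exact: measurable_coord_rV.
  apply: measurable_fun_rV => j.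
  rewrite (_ : (fun _ => _) = fun x : 'rV[R]_n.+1 => x 0 (lift ord0 j)).
    exact: measurable_coord_rV.
  by apply/funext => x; rewrite /= mxE.
exists (fun k => unc @^-1` (F k `*` G k)) => [|k].
  rewrite -preimage_bigcup; apply/esym; rewrite -subTset => x _.
  have : setT (unc x).1 by []. have : setT (unc x).2 by [].
  rewrite {1}TF {1}TG => -[k _ Gk] [j _ Fj].
  exists (maxn j k) => //; split.
    by move: Fj; exact/subsetPset/ndF/leq_maxl.
  by move: Gk; exact/subsetPset/ndG/leq_maxr.
have [mFk Fk] := Foo k; have [mGk Gk] := Goo k; split.
  by rewrite -[X in measurable X]setTI; apply: munc => //; exact: measurableX.
rewrite /lebesgue_cons /pushforward (_ : _ @^-1` _ = F k `*` G k).
  by rewrite product_measure1E// lte_mul_pinfty// ge0_fin_numE.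
by rewrite -comp_preimage (_ : unc \o _ = id)//; exact/funext/consK.
Qed.

HB.instance Definition _ := Measure_isSigmaFinite.Build _ _ _ lebesgue_cons
  lebesgue_cons_sigma_finite.

End step.

Fixpoint lebesgue_rV n : {sigma_finite_measure set 'rV[R]_n -> \bar R} :=
  if n is m.+1 then lebesgue_cons (lebesgue_rV m) else \d_(0 : 'rV[R]_0).

Lemma lebesgue_rV_box n (A : 'I_n -> set (measurableTypeR R)) :
  (forall i, measurable (A i)) ->
  lebesgue_rV n [set x | forall i, A i (x 0 i)]
  = (\prod_(i < n) lebesgue_measure (A i))%E.
Proof.
elim: n => [|n IHn] in A *; move=> mA.
  by rewrite big_ord0 /= diracE mem_set// => -[].
rewrite big_ord_recl -IHn//= /lebesgue_cons /pushforward.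
rewrite -product_measure1E//; last first.
  rewrite [X in measurable X](_ : _ = \bigcap_(i in [set: 'I_n])
      ((fun x : 'rV[R]_n => x 0 i) @^-1` A (lift ord0 i))).
    apply: fin_bigcap_measurable => // i _.
    rewrite -[X in measurable X]setTI.
    by apply: measurable_coord_rV => //; exact: mA.
  by apply/seteqP; split => [x Ax i _|x Ax i]; exact: Ax.
congr (product_measure1 _ _ _); apply/seteqP; split => -[a x] /=.
  move=> Ax; split => [|i]; first by have := Ax ord0; rewrite mxE unlift_none.
  by have := Ax (lift ord0 i); rewrite mxE liftK.
by move=> [Aa Ax] i; rewrite mxE; case: unliftP => [j|] ->.
Qed.

End lebesgue_rV.

Notation measures R d := {measure set 'rV[R]_d -> \bar R}.

Section heat.
Context {R : realType} {d : nat}.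
Implicit Types (x : 'rV[R]_d) (t : R) (mu : measures R d).

(* The library norm on 'rV[R]_d is the sup norm, hence the explicit
   Euclidean one. *)
Definition enorm x : R := Num.sqrt (\sum_(i < d) x 0 i ^+ 2).

Definition eball x (r : R) : set 'rV[R]_d := [set y | enorm (y - x) < r].

Definition heat_kernel t x : R :=
  (2 * pi * t) `^ (- (d%:R / 2)) * expR (- (enorm x ^+ 2 / (2 * t))).

Definition heat_convolution mu t x : \bar R :=
  \int[mu]_y (heat_kernel t (x - y))%:E.

Definition heat_semigroup t (g : 'rV[R]_d -> R) x : \bar R :=
  \int[lebesgue_rV d]_y (heat_kernel t (x - y) * g y)%:E.

(* Mild form of dv/dt = 1/2 Laplacian v - v^(1+beta), v_0 = f: the nonlinear
   term is kept on the left so that both sides are nonnegative. *)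
Definition mild_solution (beta : R) (f : 'rV[R]_d -> R)
    (v : R -> 'rV[R]_d -> R) : Prop :=
  [/\ measurable_fun [set tx : R * 'rV[R]_d | 0 <= tx.1]
        (fun tx : R * 'rV[R]_d => v tx.1 tx.2),
      forall t x, 0 <= t -> 0 <= v t x,
      forall x, v 0 x = f x &
      forall t x, 0 < t ->
        ((v t x)%:E + \int[lebesgue_measure]_(s in `]0%R, t[)
           heat_semigroup (t - s)%R (fun y => v s y `^ (1 + beta))%R x)%E
        = heat_semigroup t f x].

End heat.

Section vague.
Context {R : realType} {d : nat}.

Definition locally_finite (nu : measures R d) : Prop :=
  forall B : set 'rV[R]_d, measurable B -> bounded_set B -> (nu B < +oo)%E.

Definition test_function (f : 'rV[R]_d -> R) : Prop :=
  [/\ continuous f, forall x, 0 <= f x &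
      exists2 K : set 'rV[R]_d, compact K & forall x, ~ K x -> f x = 0].

Definition vague_cvg (F : set_system R) (p : R -> measures R d)
    (nu : measures R d) : Prop :=
  forall f, test_function f ->
    (\int[p s]_x (f x)%:E)%E @[s --> F] --> (\int[nu]_x (f x)%:E)%E.

Definition vaguely_rcll (p : R -> measures R d) : Prop :=
  (forall t, 0 <= t -> vague_cvg t^'+ p (p t)) /\
  (forall t, 0 < t ->
     exists2 nu : measures R d, locally_finite nu & vague_cvg t^'- p nu).

End vague.

Section superprocess.
Context {R : realType} {d : nat}.

(* Sigma-field on the space of measure-valued paths indexed by [0, +oo[,
   generated by the evaluations p |-> p t B. *)
Definition path_events : set (set (R -> measures R d)) :=
  <<s [set A | exists t B C, [/\ 0 <= t, measurable B, measurable C &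
                 A = [set p : R -> measures R d | C (p t B)]]] >>.

Context {dW : measure_display} {W : measurableType dW}.
Variable xi : R -> W -> measures R d.

Definition measure_valued_process : Prop :=
  forall t B, 0 <= t -> measurable B ->
    measurable_fun [set: W] (fun w => xi t w B).

Definition history (t : R) : set (set W) :=
  <<s [set A | exists s B C, [/\ 0 <= s <= t, measurable B, measurable C &
                 A = [set w | C (xi s w B)]]] >>.

Definition optional_time (tau : W -> \bar R) : Prop :=
  (forall w, 0 <= tau w)%E /\
  forall t, 0 <= t -> history t [set w | tau w <= t%:E]%E.

Definition history_at (tau : W -> \bar R) (H : set W) : Prop :=
  measurable H /\
  forall t, 0 <= t -> history t (H `&` [set w | tau w <= t%:E]%E).

Variable P : measures R d -> probability W R.

Definition strong_markov (mu : measures R d) : Prop :=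
  forall tau H A, optional_time tau -> history_at tau H -> path_events A ->
    P mu (H `&` [set w | tau w < +oo]%E
            `&` [set w | A (fun t => xi (fine (tau w) + t) w)])
    = (\int[P mu]_(w in H `&` [set w | tau w < +oo])
         P (xi (fine (tau w)) w) [set w' | A (xi ^~ w')])%E.

(* xi under P mu has the law of the sum of countably many independent copies
   Y n of xi under P (m n), where the m n are finite with sum mu. *)
Definition sum_of_finite_copies (mu : measures R d) : Prop :=
  exists m : (measures R d)^nat,
    [/\ forall n, (m n setT < +oo)%E,
        forall B, measurable B -> mu B = mseries m 0 B &
    exists (dV : measure_display) (V : measurableType dV)
           (Pr : probability V R) (Y : nat -> R -> V -> measures R d),
      [/\ forall n t B, 0 <= t -> measurable B ->
            measurable_fun [set: V] (fun v => Y n t v B),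
          forall N (A : (set (R -> measures R d))^nat),
            (forall n, path_events (A n)) ->
            Pr (\bigcap_(n in `I_N) [set v | A n (Y n ^~ v)])
            = (\prod_(n < N) P (m n) [set w | A n (xi ^~ w)])%E &
          forall A, path_events A ->
            P mu [set w | A (xi ^~ w)]
            = Pr [set v | A (fun t => mseries (fun n => Y n t v) 0)]]].

(* P mu is the law governing xi when started from mu; it is constrained only
   for sigma-finite mu. *)
Record superprocess (beta : R) : Prop := Superprocess {
  superprocess_measurable : measure_valued_process ;
  superprocess_start : forall mu : measures R d, (mu setT < +oo)%E ->
    {ae P mu, forall w, forall B, measurable B -> xi 0 w B = mu B} ;
  superprocess_paths : forall mu : measures R d, (mu setT < +oo)%E ->
    {ae P mu, forall w, (forall t, 0 <= t -> (xi t w setT < +oo)%E) /\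
                        vaguely_rcll (xi ^~ w)} ;
  superprocess_markov : forall mu : measures R d, (mu setT < +oo)%E ->
    strong_markov mu ;
  superprocess_laplace : forall f : 'rV[R]_d -> R,
    measurable_fun setT f -> (forall x, 0 <= f x) ->
    (exists K : R, forall x, f x <= K) ->
    exists2 v, mild_solution beta f v &
      forall (mu : measures R d) t, (mu setT < +oo)%E -> 0 <= t ->
        (\int[P mu]_w expeR (- \int[xi t w]_x (f x)%:E)
         = expeR (- \int[mu]_x (v t x)%:E))%E ;
  superprocess_sigma_finite : forall mu : measures R d,
    sigma_finite setT mu -> sum_of_finite_copies mu }.

Definition locally_finite_under (mu : measures R d) : Prop :=
  forall t, 0 < t -> {ae P mu, forall w, locally_finite (xi t w)}.

Context {dV : measure_display} {V : measurableType dV}.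
Variables (eta : R -> V -> measures R d) (Q : R.-pker 'rV[R]_d ~> V).

(* Q x is the law P_x governing the cluster eta t rooted at x. *)
Record cluster_family (beta : R) : Prop := ClusterFamily {
  cluster_measurable : forall t B, 0 < t -> measurable B ->
    measurable_fun [set: V] (fun w => eta t w B) ;
  cluster_nonzero : forall t x, 0 < t ->
    {ae Q x, forall w, (0 < eta t w setT)%E} ;
  cluster_laplace : forall t x (f : 'rV[R]_d -> R), 0 < t ->
    measurable_fun setT f -> (forall y, 0 <= f y) ->
    (\int[P \d_x]_w expeR (- \int[xi t w]_y (f y)%:E)
     = expeR (- (((beta * t) `^ (- beta^-1))%:E *
         \int[Q x]_w (1 - expeR (- \int[eta t w]_y (f y)%:E)))))%E }.

End superprocess.

Section hitting.
Context {R : realType} {d : nat} {dW : measure_display} {W : measurableType dW}.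

Definition superprocess_hit (xi : R -> W -> measures R d)
    (P : measures R d -> probability W R) (mu : measures R d) t x r : \bar R :=
  P mu [set w | 0 < xi t w (eball x r)]%E.

(* P_mu {eta_t in .} is the mixture of the laws Q y over mu(dy). *)
Definition cluster_hit (eta : R -> W -> measures R d)
    (Q : R.-pker 'rV[R]_d ~> W) (mu : measures R d) t x r : \bar R :=
  (\int[mu]_y Q y [set w | 0 < eta t w (eball x r)])%E.

End hitting.

(* c is the constant c_{beta,d}; vinf is the increasing limit of the solutions
   v l started from l f. *)
Definition hitting_constant {R : realType} (d : nat) (beta c : R) : Prop :=
  0 < c /\
  exists (f : 'rV[R]_d -> R) (v : R -> R -> 'rV[R]_d -> R)
         (vinf : R -> 'rV[R]_d -> R),
    [/\ continuous f,
        forall x, eball 0 1 x -> 0 < f x <= 1,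
        forall x, ~ eball 0 1 x -> f x = 0,
        forall l, 0 < l -> mild_solution beta (fun x => l * f x) (v l) &
        (forall t x, 0 < t -> v l t x @[l --> +oo] --> vinf t x) /\
        (forall t x, 0 < t ->
           e ^- d * vinf (e ^- 2 * t) (e^-1 *: x) @[e --> 0^'+]
           --> c * heat_kernel t x)].

(* Main.v *)
Require Import Defs.
From HB Require Import structures.
From mathcomp Require Import all_boot all_order all_algebra.
From mathcomp Require Import all_classical all_reals all_analysis.
From mathcomp Require Import measurable_realfun.
From mathcomp Require Import ring lra.

Import Order.TTheory GRing.Theory Num.Theory.
Import numFieldNormedType.Exports.

Set Implicit Arguments.
Unset Strict Implicit.
Unset Printing Implicit Defensive.

Local Open Scope classical_set_scope.
Local Open Scope ring_scope.

(** Write h t y for the hitting exponent of the ball of radius e around x, that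
    is (beta t)^(-1/beta) times the probability that a cluster of age t rooted
    at y charges the ball. Since the clusters are rooted at a Poisson process,
    the process hits the ball with probability 1 - exp (- mu h), while the
    cluster probability of the theorem is (beta t)^(1/beta) mu h. With
    kappa = e^(2/beta - d), which tends to infinity because d > 2/beta, the
    numbers kappa (1 - exp (- mu h)) and kappa mu h have the same limit, and
    everything reduces to the convergence of kappa mu h to c mu * p_t.

    The exponent h is the increasing limit of the cumulants of n 1_B, and a
    cumulant is a mild solution of the equation: started from a unit mass, the
    Laplace formulas of the process and of the clusters express the same
    number. Uniqueness of bounded mild solutions (mild_unique) gives the
    semiflow, Brownian scaling, and the identification of the limit that
    defines c. Scaling writes kappa h t y = phi_e t (y - x), where phi_e t
    tends pointwise to c p_t (hitting_exponent_ball, scaled_exponent_cvg).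

    Passing to the limit under mu needs a dominating function. The data n 1_B
    are unbounded in n, but every cumulant at time t is at most
    (beta t)^(-1/beta). Run the semiflow with time steps 15 * 16^-k through
    balls whose radii decrease by 2^-k: inside the k-th ball the universal
    bound holds, and what the heat flow leaks out of it in one step is a
    Gaussian tail, exponentially small in 4^k, which beats the power 4^(2k/beta)
    of the bound. The leaks are summable, so phi_e t <= C p_(10 t) as soon as
    e^2 <= t (hitting_exponent_gaussian, scaled_exponent_bounds). For infinite
    mu the convolutions mu * p_t are finite because xi is locally finite
    (heat_convolution_fin); the Laplace formula reaches such mu through the
    product rule for countably many independent copies (laplace_sigma_finite).

    For the uniform statements let s = a/2 and t >= a. Between the times s and
    t the absorption removes only O(e^(d beta - 2)) in the scaling of phi_e, so
    phi_e t is almost the heat flow of phi_e s; that flow turns the L1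
    convergence of phi_e s into uniform convergence (scaled_exponent_heat,
    scaled_exponent_cvg_unif). Large t are covered by the decay t^(-d/2), which
    beats the factor t^(1/beta) of the cluster normalization. *)

(** * Integration over row vectors *)

Section lebesgue_integral_rV.
Context {R : realType}.
Implicit Types (n : nat) (e : R).
Local Notation mu1 := (@lebesgue_measure R).

Lemma integral_rV0 (f : 'rV[R]_0 -> \bar R) :
  measurable_fun setT f -> (\int[lebesgue_rV 0]_x f x)%E = f 0.
Proof. by move=> mf; rewrite /= integral_dirac// diracT mul1e. Qed.

Lemma integral_rV_cons n (f : 'rV[R]_n.+1 -> \bar R) :
  measurable_fun setT f -> (forall x, 0 <= f x)%E ->
  (\int[lebesgue_rV n.+1]_x f x
   = \int[mu1]_a \int[lebesgue_rV n]_y f (cons_rV (a, y)))%E.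
Proof.
move=> mf f0.
rewrite [LHS](_ : _ =
  (\int[pushforward (mu1 \x lebesgue_rV n) (@cons_rV R n)]_x f x)%E) //.
rewrite ge0_integral_pushforward//; last exact: measurable_cons_rV.
rewrite preimage_setT.
apply: (@fubini_tonelli1 _ _ _ _ _ mu1 (lebesgue_rV n) (f \o @cons_rV R n)) => [|x].
  by apply: measurableT_comp => //; exact: measurable_cons_rV.
exact: f0.
Qed.

(** Both sides are measures in A that agree on intervals. *)
Lemma measure_affine e (z : R) (A : set (measurableTypeR R)) : 0 < e ->
  measurable A ->
  mu1 A = (e%:E * mu1 ((fun a : measurableTypeR R => (z + e * a)%R) @^-1` A))%E.
Proof.
move=> e0 mA.
have mphi : measurable_fun setT
    ((fun a => z + e * a) : measurableTypeR R -> measurableTypeR R).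
  by apply: measurable_funD => //; exact: measurable_funM.
pose phi_mixin := isMeasurableFun.Build _ _ _ _ _ mphi.
pose phi : {mfun measurableTypeR R >-> measurableTypeR R} :=
  HB.pack ((fun a => z + e * a) : measurableTypeR R -> measurableTypeR R)
    phi_mixin.
have -> := @lebesgue_measure_unique R
  (mscale (NngNum (ltW e0)) (pushforward mu1 phi)) _ A mA.
  by rewrite /mscale /=.
move=> _ [[a b]] _ <-; rewrite /= /mscale /= /pushforward.
have -> : (fun a : R => z + e * a) @^-1` `]a, b] =
    `](a - z) / e, (b - z) / e]%classic.
  apply/seteqP; split => x; rewrite /= !in_itv /= ltr_pdivrMr// ler_pdivlMr//;
    by rewrite ltrBlDl lerBrDl (mulrC x).
rewrite !lebesgue_measure_itv /= !lte_fin ltr_pM2r ?invr_gt0// ltrD2r.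
case: ifPn => _; last by rewrite mule0.
by rewrite -!EFinB -EFinM; congr (_%:E); field; rewrite gt_eqF.
Qed.

Lemma integral_affine e (z : R) (f : R -> \bar R) : 0 < e ->
  measurable_fun setT f -> (forall x, 0 <= f x)%E ->
  (\int[mu1]_a f a = e%:E * \int[mu1]_a f (z + e * a)%R)%E.
Proof.
move=> e0 mf f0.
have mphi : measurable_fun setT
    ((fun a => z + e * a) : measurableTypeR R -> measurableTypeR R).
  by apply: measurable_funD => //; exact: measurable_funM.
have := @ge0_integral_pushforward _ _ _ _ _ _ mphi mu1 setT f measurableT mf
  (fun x _ => f0 x).
rewrite preimage_setT /comp => <-.
rewrite -(@ge0_integral_mscale _ _ _ _ _ measurableT (NngNum (ltW e0)))//.
apply: eq_measure_integral => A mA _; exact: (measure_affine z e0 mA).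
Qed.

Definition tail_rV n (x : 'rV[R]_n.+1) : 'rV[R]_n := \row_j x 0 (lift ord0 j).

Lemma measurable_tail_rV n : measurable_fun setT (@tail_rV n).
Proof.
apply: measurable_fun_rV => j.
rewrite (_ : (fun _ => _) = fun x : 'rV[R]_n.+1 => x 0 (lift ord0 j)).
  exact: measurable_coord_rV.
by apply/funext => x; rewrite mxE.
Qed.

Lemma cons_rV_head n a (y : 'rV[R]_n) : cons_rV (a, y) 0 ord0 = a.
Proof. by rewrite mxE unlift_none. Qed.

Lemma cons_rV_tail n a (y : 'rV[R]_n) : tail_rV (cons_rV (a, y)) = y.
Proof. by apply/rowP => j; rewrite !mxE liftK. Qed.

Lemma integral_rV_head_tail n (g : R -> R) (h : 'rV[R]_n -> R) :
  measurable_fun setT g -> measurable_fun setT h ->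
  (forall a, 0 <= g a) -> (forall y, 0 <= h y) ->
  (\int[lebesgue_rV n.+1]_x (g (x 0 ord0) * h (tail_rV x))%:E
   = \int[mu1]_a (g a)%:E * \int[lebesgue_rV n]_y (h y)%:E)%E.
Proof.
move=> mg mh g0 h0; rewrite integral_rV_cons; last 2 first.
- apply/measurable_EFinP/measurable_funM.
    exact: (measurableT_comp mg (measurable_coord_rV _)).
  exact: (measurableT_comp mh (@measurable_tail_rV n)).
- by move=> x; rewrite lee_fin mulr_ge0.
under eq_integral => a _.
  under eq_integral do rewrite cons_rV_head cons_rV_tail EFinM.
  rewrite ge0_integralZl_EFin//; last 2 first.
  - by move=> y _; rewrite lee_fin.
  - exact/measurable_EFinP.
  over.
rewrite ge0_integralZr//.
- exact/measurable_EFinP.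
- by move=> a _; rewrite lee_fin.
- by apply: integral_ge0 => y _; rewrite lee_fin.
Qed.

Lemma measurable_affine_rV n e (z : 'rV[R]_n) :
  measurable_fun setT (fun y : 'rV[R]_n => z + e *: y).
Proof.
apply: measurable_fun_rV => i.
rewrite (_ : (fun _ => _) = fun x : 'rV[R]_n => z 0 i + e * x 0 i).
  apply: measurable_funD => //; apply: measurable_funM => //.
  exact: measurable_coord_rV.
by apply/funext => x; rewrite !mxE.
Qed.

(** One coordinate at a time, by the recursive form of the measure. *)
Lemma integral_rV_affine n e (z : 'rV[R]_n) (f : 'rV[R]_n -> \bar R) :
  0 < e -> measurable_fun setT f -> (forall x, 0 <= f x)%E ->
  (\int[lebesgue_rV n]_x f x
   = (e ^+ n)%:E * \int[lebesgue_rV n]_x f (z + e *: x)%R)%E.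
Proof.
move=> e0; elim: n => [|n IHn] in z f *; move=> mf f0.
  rewrite expr0 mul1e !integral_rV0//.
    by congr f; apply/rowP => -[].
  by apply: measurableT_comp mf _; exact: measurable_affine_rV.
have cE a (y : 'rV[R]_n) : z + e *: cons_rV (a, y) =
    cons_rV (z 0 ord0 + e * a, tail_rV z + e *: y).
  apply/rowP => i; rewrite !mxE; case: unliftP => [j|] -> //=.
  by rewrite !mxE.
have msec a : measurable_fun setT (fun y => f (cons_rV (a, y))).
  apply: (measurableT_comp mf); apply: (measurableT_comp (@measurable_cons_rV R n)).
  exact: pair1_measurable.
have mint : measurable_fun setT
    (fun a : R => \int[lebesgue_rV n]_y f (cons_rV (a, y)))%E.
  apply: (measurable_fun_fubini_tonelli_F (f \o @cons_rV R n)) => [|x].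
    2: exact: f0.
  by apply: measurableT_comp => //; exact: measurable_cons_rV.
rewrite (integral_rV_cons mf f0).
rewrite (@integral_rV_cons n (fun x => f (z + e *: x)%R))//; last first.
  by apply: measurableT_comp mf _; exact: measurable_affine_rV.
rewrite (@integral_affine e (z 0 ord0))//; last first.
  by move=> a; exact: integral_ge0.
rewrite exprS EFinM -muleA; congr (_ * _)%E.
rewrite -ge0_integralZl//; last 3 first.
- apply: (measurable_fun_fubini_tonelli_F
    (fun u : R * 'rV[R]_n => f (z + e *: cons_rV u))) => //.
  apply: (measurableT_comp mf); apply: (measurableT_comp (measurable_affine_rV _ _)).
  exact: measurable_cons_rV.
- by move=> a _; exact: integral_ge0.
- by rewrite lee_fin exprn_ge0// ltW.
apply: eq_integral => a _.
rewrite (IHn (tail_rV z))//; congr (_ * _)%E.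
by apply: eq_integral => y _; rewrite cE.
Qed.

End lebesgue_integral_rV.

(** * The heat kernel *)

Section heat_kernel_theory.
Context {R : realType}.
Implicit Types (n d : nat) (t s : R).
Local Notation mu1 := (@lebesgue_measure R).

Lemma measurable_invr : measurable_fun setT (fun r : R => r^-1).
Proof.
(* The square makes the real power meaningful for negative r. *)
apply: (eq_measurable_fun (fun r : R => r * (r ^+ 2) `^ (-1))) => [r _|].
  rewrite powR_inv1 ?sqr_ge0//; have [->|r0] := eqVneq r 0.
    by rewrite mul0r invr0.
  by field.
apply: measurable_funM => //.
exact: (measurableT_comp (measurable_powR _)).
Qed.

Lemma enorm_sqr d (x : 'rV[R]_d) : enorm x ^+ 2 = \sum_(i < d) x 0 i ^+ 2.
Proof. by rewrite sqr_sqrtr// sumr_ge0// => i _; exact: sqr_ge0. Qed.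

Lemma enorm_ge0 d (x : 'rV[R]_d) : 0 <= enorm x.
Proof. exact: sqrtr_ge0. Qed.

Lemma enormN d (x : 'rV[R]_d) : enorm (- x) = enorm x.
Proof.
by rewrite /enorm; congr Num.sqrt; apply: eq_bigr => i _; rewrite mxE sqrrN.
Qed.

Lemma enormZ d (e : R) (x : 'rV[R]_d) : 0 <= e -> enorm (e *: x) = e * enorm x.
Proof.
move=> e0; apply: (@pexpIrn _ 2) => //; rewrite ?nnegrE ?mulr_ge0 ?enorm_ge0//.
rewrite exprMn !enorm_sqr mulr_sumr; apply: eq_bigr => i _.
by rewrite mxE exprMn.
Qed.

(** The triangle inequality in the quadratic form that suits Gaussian
    exponents. *)
Lemma enorm_sqrD d (x y : 'rV[R]_d) (k : R) : 0 < k ->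
  enorm (x + y) ^+ 2 <= (1 + k) * enorm x ^+ 2 + (1 + k^-1) * enorm y ^+ 2.
Proof.
move=> k0; rewrite !enorm_sqr !mulr_sumr -big_split /=.
apply: ler_sum => i _; rewrite mxE.
rewrite -subr_ge0.
rewrite [X in 0 <= X](_ : _ = k * (x 0 i - k^-1 * y 0 i) ^+ 2).
  by rewrite mulr_ge0 ?sqr_ge0// ltW.
by field; rewrite gt_eqF.
Qed.

(** The weight (a - b) / b makes the quadratic triangle inequality sharp. *)
Lemma enorm_dist_lb d (y z : 'rV[R]_d) (a b : R) : 0 < b -> b < a ->
  a <= enorm y -> enorm z < b -> (a - b) ^+ 2 <= enorm (y - z) ^+ 2.
Proof.
move=> b0 ba ay zb; have ab0 : 0 < a - b by rewrite subr_gt0.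
have := @enorm_sqrD d z (y - z) ((a - b) / b) (divr_gt0 ab0 b0).
rewrite addrC subrK => h.
have a0 : 0 < a by apply: lt_trans ba.
have ay2 : a ^+ 2 <= enorm y ^+ 2 by rewrite ler_pXn2r// nnegrE ?ltW ?(lt_le_trans a0 ay).
have zb2 : enorm z ^+ 2 <= b ^+ 2.
  by rewrite ler_pXn2r ?nnegrE ?enorm_ge0// ltW.
have k1 : 1 + (a - b) / b = a / b by field; rewrite gt_eqF.
have k2 : 1 + ((a - b) / b)^-1 = a / (a - b) by field; rewrite !gt_eqF.
rewrite k1 k2 in h.
have h1 : a / b * enorm z ^+ 2 <= a * b.
  have -> : a * b = a / b * b ^+ 2 by field; rewrite gt_eqF.
  by rewrite ler_wpM2l// divr_ge0// ltW.
have h2 : a * (a - b) <= a / (a - b) * enorm (y - z) ^+ 2 by nra.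
have -> : (a - b) ^+ 2 = (a - b) / a * (a * (a - b)) by field; rewrite gt_eqF.
have -> : enorm (y - z) ^+ 2 = (a - b) / a * (a / (a - b) * enorm (y - z) ^+ 2).
  by field; rewrite !gt_eqF.
by rewrite ler_wpM2l// divr_ge0// ltW.
Qed.

Lemma measurable_enorm_sqr d :
  measurable_fun setT (fun x : 'rV[R]_d => enorm x ^+ 2).
Proof.
apply: (eq_measurable_fun (fun x : 'rV[R]_d => \sum_(i < d) x 0 i ^+ 2)).
  by move=> x _; rewrite enorm_sqr.
apply: measurable_sum => i; apply: measurable_funX.
exact: measurable_coord_rV.
Qed.

Lemma measurable_heat_kernel d :
  measurable_fun setT (fun u : R * 'rV[R]_d => heat_kernel u.1 u.2).
Proof.
have m1 : measurable_fun setT (fst : R * 'rV[R]_d -> R) by exact: measurable_fst.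
apply: measurable_funM.
  apply: (measurableT_comp (measurable_powR _)).
  by apply: measurable_funM.
apply: (measurableT_comp (@measurable_expR R)).
apply: measurable_funN; apply: measurable_funM.
  by apply: (measurableT_comp (@measurable_enorm_sqr d)); exact: measurable_snd.
by apply: (measurableT_comp measurable_invr); exact: measurable_funM.
Qed.

Lemma measurable_heat_kernelx d t :
  measurable_fun setT (fun y : 'rV[R]_d => heat_kernel t y).
Proof.
exact: (measurableT_comp (@measurable_heat_kernel d) (pair1_measurable t)).
Qed.

Lemma measurable_heat_kernelB d t (x : 'rV[R]_d) :
  measurable_fun setT (fun y : 'rV[R]_d => heat_kernel t (x - y)).
Proof.
apply: (measurableT_comp (@measurable_heat_kernelx d t)).
apply: (eq_measurable_fun (fun y : 'rV[R]_d => x + (-1) *: y)) => [y _|].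
  by rewrite scaleN1r.
apply: measurable_fun_rV => i.
apply: (eq_measurable_fun (fun y : 'rV[R]_d => x 0 i + (-1) * y 0 i)) => [y _|].
  by rewrite !mxE.
apply: measurable_funD => //; apply: measurable_funM => //.
exact: measurable_coord_rV.
Qed.

Lemma heat_kernel_ge0 d t (x : 'rV[R]_d) : 0 <= heat_kernel t x.
Proof. by rewrite mulr_ge0 ?powR_ge0 ?expR_ge0. Qed.

Lemma pi2_gt0 t : 0 < t -> 0 < 2 * pi * t.
Proof. by move=> t0; rewrite !mulr_gt0 ?pi_gt0. Qed.

Lemma heat_kernelN d t (x : 'rV[R]_d) : heat_kernel t (- x) = heat_kernel t x.
Proof. by rewrite /heat_kernel enormN. Qed.

Lemma heat_kernelBC d t (x y : 'rV[R]_d) :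
  heat_kernel t (x - y) = heat_kernel t (y - x).
Proof. by rewrite -heat_kernelN opprB. Qed.

Lemma heat_kernel_le_max d t (x : 'rV[R]_d) : 0 < t ->
  heat_kernel t x <= (2 * pi * t) `^ (- (d%:R / 2)).
Proof.
move=> t0; rewrite /heat_kernel ler_piMr ?powR_ge0//.
rewrite -[leRHS]expR0 ler_expR oppr_le0 divr_ge0 ?sqr_ge0//.
by rewrite mulr_ge0// ltW.
Qed.

(** Widening a Gaussian costs only the ratio of the normalizations. *)
Lemma heat_kernel_widen d s t (x : 'rV[R]_d) : 0 < s -> s <= t ->
  heat_kernel s x <= (t / s) `^ (d%:R / 2) * heat_kernel t x.
Proof.
move=> s0 st; have t0 := lt_le_trans s0 st.
rewrite /heat_kernel mulrA ler_pM ?powR_ge0 ?expR_ge0//.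
  have {1}-> : 2 * pi * s = (2 * pi * t) * (t / s)^-1 by field; rewrite !gt_eqF.
  have ts0 : 0 <= t / s by rewrite divr_ge0// ltW.
  rewrite powRM ?invr_ge0 ?(ltW (pi2_gt0 t0))// mulrC.
  by rewrite -(powR_inv1 ts0) -powRrM mulN1r opprK.
rewrite ler_expR lerN2 ler_wpM2l ?sqr_ge0// lef_pV2 ?posrE ?mulr_gt0//.
by rewrite ler_pM2l.
Qed.

Lemma heat_kernel_scale d t (e : R) (x : 'rV[R]_d) : 0 < t -> 0 < e ->
  heat_kernel (e ^+ 2 * t) (e *: x) = e ^- d * heat_kernel t x.
Proof.
move=> t0 e0; rewrite /heat_kernel enormZ ?ltW// [in RHS]mulrA; congr (_ * expR _).
  rewrite mulrCA (powRM _ (sqr_ge0 e) (ltW (pi2_gt0 t0))); congr (_ * _).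
  rewrite -(powR_mulrn 2 (ltW e0)) -powRrM mulrN mulrCA divff// mulr1 powRN.
  by rewrite powR_mulrn// ltW.
by congr (- _); field; rewrite !gt_eqF.
Qed.

Let heat1 t (r : R) : R := (2 * pi * t) `^ (- (1 / 2)) * expR (- (r ^+ 2 / (2 * t))).

Let heat1_ge0 t r : 0 <= heat1 t r.
Proof. by rewrite mulr_ge0 ?powR_ge0 ?expR_ge0. Qed.

Let heat1_normal t a r : 0 < t -> heat1 t (r - a) = normal_pdf a (Num.sqrt t) r.
Proof.
move=> t0; have st0 : Num.sqrt t != 0 by rewrite gt_eqF// sqrtr_gt0.
rewrite normal_pdfE// /normal_peak /normal_fun /heat1.
rewrite sqr_sqrtr ?ltW// powRN mul1r powR12_sqrt ?(ltW (pi2_gt0 t0))//.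
congr (_^-1 * expR _); first by congr Num.sqrt; rewrite -mulr_natl; ring.
by rewrite mulNr mulr_natl.
Qed.

Let measurable_heat1B t a : 0 < t -> measurable_fun setT (fun r : R => heat1 t (r - a)).
Proof.
move=> t0; apply: (eq_measurable_fun (normal_pdf a (Num.sqrt t))).
  by move=> r _; rewrite heat1_normal.
exact: measurable_normal_pdf.
Qed.

Let integral_heat1 t a : 0 < t -> (\int[mu1]_r (heat1 t (r - a))%:E = 1)%E.
Proof.
move=> t0; under eq_integral do rewrite heat1_normal//.
exact: integral_normal_pdf.
Qed.

Let heat1C t r : heat1 t (- r) = heat1 t r.
Proof. by rewrite /heat1 sqrrN. Qed.

(* Completing the square: the product of two Gaussians in r is a Gaussian in r
   times the Gaussian of the sum of the variances. *)
Let heat1_mul s t (x z r : R) : 0 < s -> 0 < t ->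
  heat1 s (x - r) * heat1 t (r - z) =
  heat1 (s + t) (x - z) * heat1 (s * t / (s + t)) (r - (t * x + s * z) / (s + t)).
Proof.
move=> s0 t0; have st0 : 0 < s + t by rewrite addr_gt0.
rewrite /heat1 mulrACA [in RHS]mulrACA -!expRD; congr (_ * expR _).
  rewrite -!powRM ?(ltW (pi2_gt0 _))// ?divr_gt0 ?mulr_gt0//.
  by congr (_ `^ _); field; rewrite gt_eqF.
by field; rewrite !gt_eqF.
Qed.

Let integral_heat1_mul s t (x z : R) : 0 < s -> 0 < t ->
  (\int[mu1]_r (heat1 s (x - r) * heat1 t (r - z))%:E = (heat1 (s + t) (x - z))%:E)%E.
Proof.
move=> s0 t0; under eq_integral do rewrite heat1_mul// EFinM.
have st0 : 0 < s * t / (s + t) by rewrite divr_gt0 ?mulr_gt0 ?addr_gt0.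
rewrite ge0_integralZl_EFin//; last 2 first.
- by move=> r _; rewrite lee_fin.
- by apply/measurable_EFinP; exact: measurable_heat1B.
by rewrite integral_heat1// mule1.
Qed.

Let heat_kernel_head_tail d t (x : 'rV[R]_d.+1) : 0 < t ->
  heat_kernel t x = heat1 t (x 0 ord0) * heat_kernel t (tail_rV x).
Proof.
move=> t0; rewrite /heat_kernel /heat1 mulrACA -expRD -powRD; last first.
  by rewrite (gt_eqF (pi2_gt0 t0)) implybT.
rewrite !enorm_sqr big_ord_recl; congr (_ `^ _ * expR _).
  by rewrite -addn1 natrD; field.
rewrite -opprD -mulrDl; congr (- (_ * _)).
by congr (_ + _); apply: eq_bigr => i _; rewrite mxE.
Qed.

Let heat_kernel0 t (x : 'rV[R]_0) : heat_kernel t x = 1.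
Proof.
by rewrite /heat_kernel enorm_sqr big_ord0 !mul0r oppr0 powRr0 expR0 mulr1.
Qed.

Let tail_rVB d (x y : 'rV[R]_d.+1) : tail_rV (x - y) = tail_rV x - tail_rV y.
Proof. by apply/rowP => i; rewrite !mxE. Qed.

(** The kernel is a product of normal densities. *)
Lemma integral_heat_kernel d t (x : 'rV[R]_d) : 0 < t ->
  (\int[lebesgue_rV d]_y (heat_kernel t (x - y))%:E = 1)%E.
Proof.
move=> t0; elim: d x => [|d IHd] x.
  rewrite integral_rV0 ?heat_kernel0//.
  by apply/measurable_EFinP; exact: measurable_heat_kernelB.
under eq_integral => y _.
  rewrite heat_kernel_head_tail// tail_rVB mxE [X in _ + X]mxE -heat1C opprB.
  over.
rewrite (integral_rV_head_tail (g := fun r : R => heat1 t (r - x 0 ord0))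
  (h := fun y : 'rV[R]_d => heat_kernel t (tail_rV x - y)))//.
- by rewrite IHd integral_heat1// mule1.
- exact: measurable_heat1B.
- exact: measurable_heat_kernelB.
- by move=> y; exact: heat_kernel_ge0.
Qed.

(** Chapman-Kolmogorov; the kernel is a product over the coordinates. *)
Lemma heat_kernel_convolution d s t (x z : 'rV[R]_d) : 0 < s -> 0 < t ->
  (\int[lebesgue_rV d]_y (heat_kernel s (x - y) * heat_kernel t (y - z))%:E
   = (heat_kernel (s + t) (x - z))%:E)%E.
Proof.
move=> s0 t0; elim: d x z => [|d IHd] x z.
  rewrite integral_rV0 ?heat_kernel0 ?mulr1//.
  apply/measurable_EFinP; apply: measurable_funM.
    exact: measurable_heat_kernelB.
  under eq_fun do rewrite heat_kernelBC.
  exact: measurable_heat_kernelB.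
under eq_integral => y _.
  rewrite !heat_kernel_head_tail// !tail_rVB mxE [X in _ + X]mxE.
  rewrite [(y - z) _ _]mxE [(- z) _ _]mxE mulrACA.
  over.
rewrite (integral_rV_head_tail
  (g := fun r : R => heat1 s (x 0 ord0 - r) * heat1 t (r - z 0 ord0))
  (h := fun y : 'rV[R]_d => heat_kernel s (tail_rV x - y) * heat_kernel t (y - tail_rV z)))//.
- rewrite IHd integral_heat1_mul// -EFinM heat_kernel_head_tail ?addr_gt0//.
  by rewrite tail_rVB !mxE.
- apply: measurable_funM; last exact: measurable_heat1B.
  apply: (eq_measurable_fun (fun r : R => heat1 s (r - x 0 ord0))) => [r _|].
    by rewrite -heat1C opprB.
  exact: measurable_heat1B.
- apply: measurable_funM; first exact: measurable_heat_kernelB.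
  under eq_fun do rewrite heat_kernelBC.
  exact: measurable_heat_kernelB.
- by move=> r; rewrite mulr_ge0.
- by move=> y; rewrite mulr_ge0 ?heat_kernel_ge0.
Qed.

(** Moving the source by y and doubling the time costs a factor that is
    uniform in x. *)
Lemma heat_kernel_shift_lb d t (x y : 'rV[R]_d) : 0 < t ->
  2 `^ (- (d%:R / 2)) * expR (- (enorm y ^+ 2 / (2 * t))) * heat_kernel t x
  <= heat_kernel (2 * t) (x - y).
Proof.
move=> t0; rewrite /heat_kernel [2 * pi * (2 * t)]mulrCA.
rewrite (powRM _ _ (ltW (pi2_gt0 t0)))//.
rewrite mulrACA -expRD ler_wpM2l ?mulr_ge0 ?powR_ge0// ler_expR -opprD lerN2.
rewrite -mulrDl invfM mulrA ler_wpM2r ?invr_ge0 ?mulr_ge0 ?(ltW t0)//.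
have := @enorm_sqrD d x (- y) 1 ltr01; rewrite invr1 enormN.
by rewrite ler_pdivrMr//; nra.
Qed.

End heat_kernel_theory.

(** * The heat operator *)

Section heat_operator.
Context {R : realType} {d : nat}.
Implicit Types (s t : R) (x y : 'rV[R]_d) (g : 'rV[R]_d -> \bar R).
Local Notation mu1 := (@lebesgue_measure R).
Local Notation leb := (@lebesgue_rV R d).
Local Open Scope ereal_scope.

(** Extended nonnegative arguments allow the operator to be iterated and applied
    to Duhamel integrals without finiteness conditions. *)
Definition heatE t g x := \int[leb]_y ((heat_kernel t (x - y))%:E * g y).

Lemma heat_semigroupE t (f : 'rV[R]_d -> R) x :
  heat_semigroup t f x = heatE t (fun y => (f y)%:E) x.
Proof. by []. Qed.

Lemma heatE_ge0 t g x : (forall y, 0 <= g y) -> 0 <= heatE t g x.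
Proof.
by move=> g0; apply: integral_ge0 => y _; rewrite mule_ge0// lee_fin heat_kernel_ge0.
Qed.

Lemma measurable_heatE_integrand t g x : measurable_fun setT g ->
  measurable_fun setT (fun y => (heat_kernel t (x - y))%:E * g y).
Proof.
move=> mg; apply: emeasurable_funM => //.
by apply/measurable_EFinP; exact: measurable_heat_kernelB.
Qed.

Lemma le_heatE t g h x : measurable_fun setT g -> measurable_fun setT h ->
  (forall y, 0 <= g y) -> (forall y, g y <= h y) ->
  heatE t g x <= heatE t h x.
Proof.
move=> mg mh g0 gh; apply: ge0_le_integral => //.
- by move=> y _; rewrite mule_ge0// lee_fin heat_kernel_ge0.
- exact: measurable_heatE_integrand.
- exact: measurable_heatE_integrand.
- by move=> y _; rewrite lee_wpmul2l// lee_fin heat_kernel_ge0.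
Qed.

Lemma heatED t g h x : measurable_fun setT g -> measurable_fun setT h ->
  (forall y, 0 <= g y) -> (forall y, 0 <= h y) ->
  heatE t (fun y => g y + h y) x = heatE t g x + heatE t h x.
Proof.
move=> mg mh g0 h0; rewrite -ge0_integralD//.
- by apply: eq_integral => y _; rewrite ge0_muleDr.
- by move=> y _; rewrite mule_ge0// lee_fin heat_kernel_ge0.
- exact: measurable_heatE_integrand.
- by move=> y _; rewrite mule_ge0// lee_fin heat_kernel_ge0.
- exact: measurable_heatE_integrand.
Qed.

Lemma heatEZ t g x (c : R) : measurable_fun setT g ->
  (forall y, 0 <= g y) -> (0 <= c)%R ->
  heatE t (fun y => c%:E * g y) x = c%:E * heatE t g x.
Proof.
move=> mg g0 c0; rewrite -ge0_integralZl_EFin//.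
- by apply: eq_integral => y _; rewrite muleCA.
- by move=> y _; rewrite mule_ge0// lee_fin heat_kernel_ge0.
- exact: measurable_heatE_integrand.
Qed.

Lemma heatE_cst t x (c : R) : (0 < t)%R -> (0 <= c)%R ->
  heatE t (fun=> c%:E) x = c%:E.
Proof.
move=> t0 c0; rewrite /heatE ge0_integralZr//=; last 2 first.
- by apply/measurable_EFinP; exact: measurable_heat_kernelB.
- by move=> y _; rewrite lee_fin heat_kernel_ge0.
by rewrite integral_heat_kernel// mul1e.
Qed.

Lemma heatE_le_cst t g x (c : R) : (0 < t)%R -> measurable_fun setT g ->
  (forall y, 0 <= g y) -> (forall y, g y <= c%:E) -> heatE t g x <= c%:E.
Proof.
move=> t0 mg g0 gc.
have c0 : (0 <= c)%R by rewrite -lee_fin (le_trans (g0 0%R)).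
by rewrite -[leRHS](heatE_cst x t0 c0); exact: le_heatE.
Qed.

Lemma heatE_heat_kernel s t x : (0 < s)%R -> (0 < t)%R ->
  heatE s (fun y => (heat_kernel t y)%:E) x = (heat_kernel (s + t) x)%:E.
Proof.
move=> s0 t0; have := heat_kernel_convolution x 0%R s0 t0; rewrite subr0 => <-.
by apply: eq_integral => y _; rewrite subr0 EFinM.
Qed.

(** Joint measurability in time and both points, for iterated integrals. *)
Lemma measurable_heat_kernel2 dT (T : measurableType dT) (tau : T -> R) (p q : T -> 'rV[R]_d) :
  measurable_fun setT tau -> measurable_fun setT p -> measurable_fun setT q ->
  measurable_fun setT (fun u : T => heat_kernel (tau u) (p u - q u)).
Proof.
move=> mtau mp mq.
apply: (measurableT_comp (@measurable_heat_kernel R d)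
  (g := fun u => (tau u, p u - q u)%R)).
apply/measurable_fun_pairP; split => //=.
apply: measurable_fun_rV => i.
apply: (eq_measurable_fun (fun u => p u 0%R i - q u 0%R i)%R) => [u _|].
  by rewrite !mxE.
by apply: measurable_funB; apply: (measurableT_comp (measurable_coord_rV i)).
Qed.

Lemma measurable_heatE_param dT (T : measurableType dT) (tau : T -> R)
    (p : T -> 'rV[R]_d) (g : T * 'rV[R]_d -> \bar R) :
  measurable_fun setT tau -> measurable_fun setT p -> measurable_fun setT g ->
  (forall u, 0 <= g u) ->
  measurable_fun setT (fun u => heatE (tau u) (fun y => g (u, y)) (p u)).
Proof.
move=> mtau mp mg g0.
apply: (@measurable_fun_fubini_tonelli_F _ _ _ _ _ leb
  (fun z : T * 'rV[R]_d => (heat_kernel (tau z.1) (p z.1 - z.2))%:E * g z)).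
  apply: emeasurable_funM => //; apply/measurable_EFinP.
  apply: measurable_heat_kernel2.
  - exact: (measurableT_comp mtau measurable_fst).
  - exact: (measurableT_comp mp measurable_fst).
  - exact: measurable_snd.
by move=> z; rewrite mule_ge0// lee_fin heat_kernel_ge0.
Qed.

Lemma measurable_heatE t g : measurable_fun setT g -> (forall y, 0 <= g y) ->
  measurable_fun setT (heatE t g).
Proof.
move=> mg g0.
apply: (@measurable_heatE_param _ _ (fun=> t) id (fun z => g z.2)) => //.
exact: (measurableT_comp mg measurable_snd).
Qed.

Lemma heatE_comp s t g x : (0 < s)%R -> (0 < t)%R -> measurable_fun setT g ->
  (forall y, 0 <= g y) -> heatE s (heatE t g) x = heatE (s + t) g x.
Proof.
move=> s0 t0 mg g0; rewrite /heatE.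
pose F (u : 'rV[R]_d * 'rV[R]_d) :=
  (heat_kernel s (x - u.1) * heat_kernel t (u.1 - u.2))%:E * g u.2.
have mF : measurable_fun setT F.
  apply: emeasurable_funM; last exact: (measurableT_comp mg measurable_snd).
  apply/measurable_EFinP; apply: measurable_funM.
    by apply: measurable_heat_kernel2 => //; exact: measurable_fst.
  by apply: measurable_heat_kernel2.
have F0 u : 0 <= F u.
  by rewrite mule_ge0// lee_fin mulr_ge0// heat_kernel_ge0.
transitivity (\int[leb]_y \int[leb]_z F (y, z)).
  apply: eq_integral => y _; rewrite -ge0_integralZl_EFin//.
  - by apply: eq_integral => z _; rewrite /F /= EFinM muleA.
  - by move=> z _; rewrite mule_ge0// lee_fin heat_kernel_ge0.
  - exact: measurable_heatE_integrand.
  - exact: heat_kernel_ge0.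
rewrite (@fubini_tonelli _ _ _ _ _ leb leb F mF F0).
apply: eq_integral => z _; rewrite /F /= ge0_integralZr//.
- by rewrite heat_kernel_convolution.
- apply/measurable_EFinP; apply: measurable_funM.
    by apply: measurable_heat_kernel2.
  by apply: measurable_heat_kernel2.
- by move=> y _; rewrite lee_fin mulr_ge0// heat_kernel_ge0.
Qed.

Lemma heatE_scale t (k : R) (z x : 'rV[R]_d) g : (0 < t)%R -> (0 < k)%R ->
  measurable_fun setT g -> (forall y, 0 <= g y) ->
  heatE t (fun y => g (k *: (y - z))%R) x
  = heatE (k ^+ 2 * t) g (k *: (x - z))%R.
Proof.
move=> t0 k0 mg g0; rewrite /heatE [in RHS](@integral_rV_affine _ _ k (- (k *: z))%R)//.
- rewrite -ge0_integralZl_EFin//; last 3 first.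
  + by move=> y _; rewrite mule_ge0// lee_fin heat_kernel_ge0.
  + apply: (measurableT_comp (measurable_heatE_integrand _ _ mg)).
    exact: measurable_affine_rV.
  + by rewrite exprn_ge0// ltW.
  apply: eq_integral => y _.
  have -> : (k *: (x - z) - (- (k *: z) + k *: y) = k *: (x - y))%R.
    by rewrite !scalerBr opprD opprK addrA subrK.
  rewrite heat_kernel_scale// muleA -EFinM mulrA divff ?mul1r; last first.
    by rewrite expf_neq0// gt_eqF.
  by congr (_ * g _); rewrite scalerBr addrC.
- exact: measurable_heatE_integrand.
- by move=> y; rewrite mule_ge0// lee_fin heat_kernel_ge0.
Qed.

End heat_operator.

(** * Exponential weights and powers *)

Section interval_change.
Context {R : realType}.
Local Notation mu1 := (@lebesgue_measure R).

Lemma is_derive_expRM (K x : R) :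
  is_derive x (1 : R) (fun s : R => expR (K * s)) (K * expR (K * x)).
Proof.
have h : is_derive x (1 : R) (fun s : R => K * s) (K *: (1 : R)) by exact: is_deriveZ.
have := @is_derive1_comp R expR (fun s => K * s) x _ _ (is_derive_expR _) h.
by rewrite /comp [K *: _]mulr1 mulrC.
Qed.

Local Open Scope ereal_scope.

Lemma integral_itv_affine (z e t : R) (G : R -> \bar R) : (0 < e)%R ->
  measurable_fun `]z, (z + e * t)%R[ G ->
  (forall r, `]z, (z + e * t)%R[%classic r -> 0 <= G r) ->
  \int[mu1]_(r in `]z, (z + e * t)%R[) G r
  = e%:E * \int[mu1]_(r in `]0%R, t[) G (z + e * r)%R.
Proof.
move=> e0 mG G0; rewrite integral_mkcond (@integral_affine _ e z)//.
- congr (_ * _); rewrite [RHS]integral_mkcond; apply: eq_integral => r _.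
  rewrite /patch; congr (if _ then _ else _).
  apply/idP/idP; rewrite !inE /= !in_itv/= => /andP[h1 h2].
    by move: h1 h2; rewrite ltrDl ltrD2l pmulr_rgt0// ltr_pM2l// => -> ->.
  by rewrite ltrDl ltrD2l pmulr_rgt0// ltr_pM2l// h1 h2.
- by apply/(measurable_restrictT _ _).1 => //.
- move=> r; rewrite /patch; case: ifPn => //; rewrite inE => h; exact: G0.
Qed.

(** The exponential weight of the uniqueness argument: integrating it over
    time gains the factor 1 / K. *)
Lemma integral_expRM_le (K t : R) : (0 < K)%R -> (0 < t)%R ->
  \int[mu1]_(s in `]0%R, t[) (K * expR (K * s))%:E <= (expR (K * t))%:E.
Proof.
move=> K0 t0.
have dF := is_derive_expRM K.
have cF : continuous (fun s : R => expR (K * s)).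
  by move=> x; apply/differentiable_continuous/derivable1_diffP; have [] := dF x.
rewrite -(@integral_itv_bndoo _ _ _ _ true false); last first.
  apply/measurable_EFinP/measurable_funTS.
  apply: measurable_funM => //.
  by apply: continuous_measurable_fun.
rewrite (@continuous_FTC2 _ _ (fun s => expR (K * s)))//.
- by rewrite mulr0 expR0 -EFinB lee_fin gerBl.
- by apply: continuous_subspaceT => x; apply: cvgM; [exact: cvg_cst|exact: cF].
- split => [x _||].
  + by have [] := dF x.
  + exact/cvg_at_right_filter/cF.
  + exact/cvg_at_left_filter/cF.
- by move=> x _; rewrite derive1E; have [_] := dF x.
Qed.

End interval_change.

Section power_lipschitz.
Context {R : realType}.

Lemma powR1D (a beta : R) : 0 < beta -> 0 <= a -> a `^ (1 + beta) = a * a `^ beta.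
Proof.
move=> b0 a0; rewrite powRD ?powRr1//.
by rewrite gt_eqF// addr_gt0.
Qed.

Lemma powR_ge_linear (k beta : R) : 0 < beta <= 1 -> 0 <= k <= 1 -> k <= k `^ beta.
Proof.
move=> /andP[b0 b1] /andP[k0 k1]; have [->|kn0] := eqVneq k 0.
  by rewrite powR_ge0.
have kp : 0 < k by rewrite lt_neqAle eq_sym kn0.
rewrite -[X in X <= _]powRr1//.
by rewrite /powR gt_eqF// ler_expR ler_wnM2r// ln_le0.
Qed.

(** For b = k a with k <= 1 the bound reduces to k <= k^beta. *)
Lemma powR_lipschitz (a b M beta : R) : 0 < beta <= 1 -> 0 <= a <= M -> 0 <= b <= M ->
  a `^ (1 + beta) <= b `^ (1 + beta) + 2 * M `^ beta * `|a - b|.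
Proof.
move=> /[dup] b01 /andP[b0 b1] /andP[a0 aM] /andP[b0' bM].
have [ab|ba] := leP a b.
  apply: ler_wpDr; first by rewrite !mulr_ge0 ?powR_ge0.
  by rewrite ge0_ler_powR ?nnegrE// addr_ge0// ltW.
have ap : 0 < a by apply: le_lt_trans ba.
rewrite gtr0_norm ?subr_gt0// !powR1D//.
have AM : a `^ beta <= M `^ beta.
  by rewrite ge0_ler_powR ?nnegrE ?(ltW b0)// (le_trans a0).
have k01 : 0 <= b / a <= 1.
  by rewrite divr_ge0//= ler_pdivrMr// mul1r ltW.
have hB : a `^ beta * (b / a) <= b `^ beta.
  have {2}-> : b = a * (b / a) by field; rewrite gt_eqF.
  rewrite powRM//; last by case/andP: k01.
  by rewrite ler_wpM2l ?powR_ge0// powR_ge_linear.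
have -> : b = a * (b / a) by field; rewrite gt_eqF.
move: hB; set k := b / a in k01 *; case/andP: k01 => k0 k1.
rewrite [X in _ <= X `^ _ -> _](_ : b = a * k); last first.
  by rewrite /k; field; rewrite gt_eqF.
set B := (a * k) `^ beta; set A := a `^ beta in AM *; move=> hB.
have A0 : 0 <= A by exact: powR_ge0.
have h1 : a * k * (A * k) <= a * k * B by rewrite ler_wpM2l// mulr_ge0.
have h2 : A * (a - a * k) <= M `^ beta * (a - a * k).
  by rewrite ler_wpM2r// subr_ge0 ger_pMr.
have h3 : 0 <= a * A * ((1 - k) * (1 - k)).
  by rewrite !mulr_ge0// subr_ge0.
nra.
Qed.

End power_lipschitz.

(** * Duhamel integrals *)

Section duhamel.
Context {R : realType} {d : nat}.
Implicit Types (s t : R) (x y : 'rV[R]_d) (w : R -> 'rV[R]_d -> R).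
Local Notation mu1 := (@lebesgue_measure R).
Local Notation leb := (@lebesgue_rV R d).
Local Open Scope ereal_scope.

Definition spacetime w :=
  measurable_fun [set tx : R * 'rV[R]_d | (0 <= tx.1)%R] (fun tx => w tx.1 tx.2)
  /\ forall t x, (0 <= t)%R -> (0 <= w t x)%R.

(** Extension by zero to negative times, which reduces measurability on a half
    space to measurability on the whole product. *)
Definition zero_past w (u : R * 'rV[R]_d) : \bar R :=
  (((fun u => (w u.1 u.2)%:E) : R * 'rV[R]_d -> \bar R)
    \_ [set tx : R * 'rV[R]_d | (0 <= tx.1)%R]) u.

Lemma measurable_future :
  measurable [set tx : R * 'rV[R]_d | (0 <= tx.1)%R].
Proof.
have -> : [set tx : R * 'rV[R]_d | (0 <= tx.1)%R] =
    setT `&` (fst @^-1` `[0%R, +oo[%classic).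
  by rewrite setTI; apply/seteqP; split => u /=; rewrite in_itv /= andbT.
exact: measurable_fst.
Qed.

Lemma zero_pastE w s x : (0 <= s)%R -> zero_past w (s, x) = (w s x)%:E.
Proof. by move=> s0; rewrite /zero_past /patch mem_set. Qed.

Lemma zero_past_ge0 w u : spacetime w -> 0 <= zero_past w u.
Proof.
move=> [_ w0]; rewrite /zero_past /patch; case: ifPn => //.
by rewrite inE lee_fin; exact: w0.
Qed.

Lemma measurable_zero_past w : spacetime w -> measurable_fun setT (zero_past w).
Proof.
move=> [/measurable_EFinP mw _].
exact: (measurable_restrictT _ measurable_future).1 mw.
Qed.

Lemma measurable_spacetime w s : spacetime w -> (0 <= s)%R ->
  measurable_fun setT (w s).
Proof.
move=> hw s0; apply/measurable_EFinP.
apply: (eq_measurable_fun (fun y => zero_past w (s, y))) => [y _|].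
  by rewrite zero_pastE.
exact: (measurableT_comp (measurable_zero_past hw) (pair1_measurable s)).
Qed.

Lemma measurable_heat_history (D : set R) (c : R) w x : spacetime w ->
  measurable D -> (forall s, D s -> (0 <= s)%R) ->
  measurable_fun D (fun s => heat_semigroup (c - s) (w s) x).
Proof.
move=> hw mD D0.
apply: (eq_measurable_fun (fun s => heatE (c - s) (fun y => zero_past w (s, y)) x)).
  move=> s; rewrite inE => /D0 s0; rewrite heat_semigroupE.
  by congr heatE; apply/funext => y; rewrite zero_pastE.
apply: measurable_funTS.
apply: (@measurable_heatE_param _ _ _ _ (fun s => c - s)%R (fun=> x) (zero_past w)).
- exact: measurable_funB.
- exact: measurable_cst.
- exact: measurable_zero_past.
- by move=> u; exact: zero_past_ge0.
Qed.

Lemma heat_semigroup_ge0 t (f : 'rV[R]_d -> R) x : (forall y, (0 <= f y)%R) ->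
  0 <= heat_semigroup t f x.
Proof. by move=> f0; rewrite heat_semigroupE heatE_ge0// => y; rewrite lee_fin. Qed.

Definition duhamel w t x :=
  \int[mu1]_(s in `]0%R, t[) heat_semigroup (t - s) (w s) x.

Lemma duhamel_ge0 w t x : spacetime w -> 0 <= duhamel w t x.
Proof.
move=> [_ w0]; apply: integral_ge0 => s /=; rewrite in_itv /= => /andP[s0 _].
by apply: heat_semigroup_ge0 => y; rewrite w0// ltW.
Qed.

Let patch_itv0 (t : R) (f : R -> \bar R) :
  f \_ `]0%R, t[ = fun r => f r * (\1_(`]0%R, t[) r)%:E.
Proof. by apply/funext => r; rewrite epatch_indic. Qed.

Lemma measurable_duhamel_integrand w t : spacetime w ->
  measurable_fun setT (fun u : 'rV[R]_d * R =>
    heatE (t - u.2) (fun z => zero_past w (u.2, z)) u.1 *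
    (\1_(`]0%R, t[) u.2)%:E).
Proof.
move=> hw; apply: emeasurable_funM.
  apply: (@measurable_heatE_param _ _ _ _ (fun u : 'rV[R]_d * R => t - u.2)%R
    (fun u => u.1) (fun z => zero_past w (z.1.2, z.2))).
  - by apply: measurable_funB => //; exact: measurable_snd.
  - exact: measurable_fst.
  - apply: (measurableT_comp (measurable_zero_past hw)
      (g := fun z : ('rV[R]_d * R) * 'rV[R]_d => (z.1.2, z.2))).
    apply/measurable_fun_pairP; split => /=.
      exact: (measurableT_comp measurable_snd measurable_fst).
    exact: measurable_snd.
  - by move=> u; exact: zero_past_ge0.
apply/measurable_EFinP.
apply: (measurableT_comp (f := \1_(`]0%R, t[) : R -> R)); last exact: measurable_snd.
by apply: measurable_indic.
Qed.

Lemma duhamelE w t x : spacetime w -> duhamel w t x =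
  \int[mu1]_r (heatE (t - r) (fun z => zero_past w (r, z)) x *
    (\1_(`]0%R, t[) r)%:E).
Proof.
move=> hw; rewrite /duhamel integral_mkcond patch_itv0.
apply: eq_integral => r _; rewrite indicE; case: (boolP (r \in _)); rewrite ?mule0//.
rewrite inE /= in_itv /= => /andP[r0 _]; rewrite heat_semigroupE !mule1.
by congr heatE; apply/funext => z; rewrite zero_pastE// ltW.
Qed.

Lemma measurable_duhamel w t : spacetime w -> measurable_fun setT (duhamel w t).
Proof.
move=> hw; apply: (eq_measurable_fun (fun x => \int[mu1]_r
  (heatE (t - r) (fun z => zero_past w (r, z)) x * (\1_(`]0%R, t[) r)%:E))).
  by move=> x _; rewrite duhamelE.
apply: (@measurable_fun_fubini_tonelli_F _ _ _ _ _ mu1 (fun u : 'rV[R]_d * R =>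
    heatE (t - u.2) (fun z => zero_past w (u.2, z)) u.1 *
    (\1_(`]0%R, t[) u.2)%:E)).
  exact: measurable_duhamel_integrand.
by move=> u; rewrite mule_ge0// ?lee_fin// heatE_ge0// => y; exact: zero_past_ge0.
Qed.

(** Tonelli and Chapman-Kolmogorov. *)
Lemma heatE_duhamel w s t x : (0 < s)%R -> (0 < t)%R -> spacetime w ->
  heatE s (duhamel w t) x =
  \int[mu1]_(r in `]0%R, t[) heat_semigroup (s + t - r) (w r) x.
Proof.
move=> s0 t0 hw.
pose K (u : 'rV[R]_d * R) := (heat_kernel s (x - u.1))%:E *
  (heatE (t - u.2) (fun z => zero_past w (u.2, z)) u.1 *
    (\1_(`]0%R, t[) u.2)%:E).
have K0 u : 0 <= K u.
  rewrite !mule_ge0// ?lee_fin ?heat_kernel_ge0// heatE_ge0// => y.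
  exact: zero_past_ge0.
have mK : measurable_fun setT K.
  apply: emeasurable_funM; last exact: measurable_duhamel_integrand.
  by apply/measurable_EFinP; apply: measurable_heat_kernel2.
transitivity (\int[leb]_y \int[mu1]_r K (y, r)).
  apply: eq_integral => y _; rewrite duhamelE// -ge0_integralZl_EFin//.
  - move=> r _; rewrite !mule_ge0// ?lee_fin// heatE_ge0// => z.
    exact: zero_past_ge0.
  - exact: (measurableT_comp (measurable_duhamel_integrand t hw) (pair1_measurable y)).
  - exact: heat_kernel_ge0.
rewrite (@fubini_tonelli _ _ _ _ _ leb mu1 K mK K0).
rewrite [RHS]integral_mkcond patch_itv0; apply: eq_integral => r _.
rewrite /K /= indicE; case: (boolP (r \in _)); last first.
  by move=> _; rewrite mule0; under eq_integral do rewrite !mule0; rewrite integral0.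
rewrite inE /= in_itv /= => /andP[r0 rt]; rewrite mule1.
under eq_integral do rewrite mule1.
rewrite -[LHS]/(heatE s (heatE (t - r) (fun z => zero_past w (r, z))) x).
rewrite heatE_comp ?subr_gt0//.
- rewrite addrA heat_semigroupE; congr heatE; apply/funext => z.
  by rewrite zero_pastE// ltW.
- exact: (measurableT_comp (measurable_zero_past hw) (pair1_measurable r)).
- by move=> z; exact: zero_past_ge0.
Qed.

End duhamel.

(** * Mild solutions *)

Lemma fin_num_addeI {R : realType} (a b c : \bar R) : a \is a fin_num ->
  (a + b = a + c)%E -> b = c.
Proof.
by move=> fa e; have := congr1 (fun z => z - a)%E e; rewrite ![(a + _)%E]addeC !addeK.
Qed.

Section heat_semigroup_real.
Context {R : realType} {d : nat}.
Implicit Types (s t : R) (x : 'rV[R]_d) (f : 'rV[R]_d -> R).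

Lemma measurable_heat_semigroup t f : measurable_fun setT f ->
  (forall y, 0 <= f y) -> measurable_fun setT (heat_semigroup t f).
Proof.
move=> mf f0; apply: (@measurable_heatE _ _ t (fun y => (f y)%:E)) => //.
exact/measurable_EFinP.
Qed.

Lemma heat_semigroup_comp s t f x : 0 < s -> 0 < t -> measurable_fun setT f ->
  (forall y, 0 <= f y) ->
  heatE s (heat_semigroup t f) x = heat_semigroup (s + t) f x.
Proof.
move=> s0 t0 mf f0; rewrite heat_semigroupE -heatE_comp//.
exact/measurable_EFinP.
Qed.

Lemma heat_semigroup_le t f x M : 0 < t -> measurable_fun setT f ->
  (forall y, 0 <= f y <= M) -> (heat_semigroup t f x <= M%:E)%E.
Proof.
move=> t0 mf f0M; rewrite heat_semigroupE; apply: heatE_le_cst => //.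
- exact/measurable_EFinP.
- by move=> y; rewrite lee_fin; case/andP: (f0M y).
- by move=> y; rewrite lee_fin; case/andP: (f0M y).
Qed.

End heat_semigroup_real.

Section mild_solutions.
Context {R : realType} {d : nat} (beta : R) (beta01 : 0 < beta <= 1).
Implicit Types (s t M : R) (x y : 'rV[R]_d) (f : 'rV[R]_d -> R).
Implicit Types (u v : R -> 'rV[R]_d -> R).
Local Notation mu1 := (@lebesgue_measure R).
Local Open Scope ereal_scope.

Let beta0 : (0 < beta)%R. Proof. by case/andP: beta01. Qed.

Definition absorption v : R -> 'rV[R]_d -> R :=
  fun s y => (v s y `^ (1 + beta))%R.

Lemma mild_spacetime f v : mild_solution beta f v -> spacetime v.
Proof. by case=> mv v0 _ _; split. Qed.

Lemma spacetime_absorption v : spacetime v -> spacetime (absorption v).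
Proof.
move=> [mv v0]; split => [|t x t0]; last exact: powR_ge0.
exact: (measurableT_comp (measurable_powR _) mv).
Qed.

Lemma mild_eq f v t x : mild_solution beta f v -> (0 < t)%R ->
  (v t x)%:E + duhamel (absorption v) t x = heat_semigroup t f x.
Proof. by case=> _ _ _ h t0; rewrite -h. Qed.

Lemma mild_measurable f v : mild_solution beta f v -> measurable_fun setT f.
Proof.
move=> hv; have := measurable_spacetime (mild_spacetime hv) (lexx 0%R).
by case: hv => _ _ v0 _; apply: eq_measurable_fun => y _; exact: v0.
Qed.

Lemma mild_init_ge0 f v : mild_solution beta f v -> forall y, (0 <= f y)%R.
Proof. by case=> _ v0 v0f _ y; rewrite -v0f v0. Qed.

Lemma mild_le_heat f v t x : mild_solution beta f v -> (0 < t)%R ->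
  (v t x)%:E <= heat_semigroup t f x.
Proof.
move=> hv t0; rewrite -(mild_eq x hv t0) leeDl//.
exact/duhamel_ge0/spacetime_absorption/(mild_spacetime hv).
Qed.

Lemma duhamel_le_heat f v t x : mild_solution beta f v -> (0 < t)%R ->
  duhamel (absorption v) t x <= heat_semigroup t f x.
Proof.
move=> hv t0; rewrite -(mild_eq x hv t0) leeDr// lee_fin.
by case: hv => _ v0 _ _; rewrite v0// ltW.
Qed.

Lemma mild_bounds f v M t x : mild_solution beta f v ->
  (forall y, f y <= M)%R -> (0 <= t)%R -> (0 <= v t x <= M)%R.
Proof.
move=> hv fM t0; have f0 := mild_init_ge0 hv.
apply/andP; split; first by case: hv => _ v0 _ _; exact: v0.
move: t0; rewrite le_eqVlt => /predU1P[<-|t0].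
  by case: hv => _ _ -> _.
rewrite -lee_fin (le_trans (mild_le_heat x hv t0))// heat_semigroup_le//.
- exact: mild_measurable hv.
- by move=> y; rewrite f0 fM.
Qed.

(* One step of the uniqueness iteration: the nonlinearity is Lipschitz on
   [0, M]. *)
Let mild_step f u v M (b : R -> R) t x :
  mild_solution beta f u -> mild_solution beta f v ->
  (forall y, f y <= M)%R -> (0 < t)%R ->
  measurable_fun `]0%R, t[ b -> (forall s, (0 < s < t)%R -> (0 <= b s)%R) ->
  (forall s y, (0 < s < t)%R -> (`|v s y - u s y| <= b s)%R) ->
  (u t x)%:E <= (v t x)%:E +
    \int[mu1]_(s in `]0%R, t[) (2 * M `^ beta * b s)%:E.
Proof.
move=> hu hv fM t0 mb b0 uvb.
have su := spacetime_absorption (mild_spacetime hu).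
have sv := spacetime_absorption (mild_spacetime hv).
have L0 : (0 <= 2 * M `^ beta)%R by rewrite mulr_ge0// powR_ge0.
have mI (w : R -> 'rV[R]_d -> R) : spacetime w -> measurable_fun `]0%R, t[
    (fun s => heat_semigroup (t - s) (w s) x).
  move=> sw; apply: measurable_heat_history => // s /=.
  by rewrite in_itv /= => /andP[/ltW].
have I0 (w : R -> 'rV[R]_d -> R) s : spacetime w -> `]0%R, t[%classic s ->
    0 <= heat_semigroup (t - s) (w s) x.
  move=> [_ w0]; rewrite /= in_itv /= => /andP[s0 _].
  by apply: heat_semigroup_ge0 => y; rewrite w0// ltW.
have Dv : duhamel (absorption v) t x <= duhamel (absorption u) t x +
    \int[mu1]_(s in `]0%R, t[) (2 * M `^ beta * b s)%:E.
  rewrite /duhamel -ge0_integralD//.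
  - apply: ge0_le_integral => //.
    + by move=> s; exact: I0.
    + exact: mI.
    + apply: emeasurable_funD; first exact: mI.
      by apply/measurable_EFinP; exact: measurable_funM.
    + move=> s /=; rewrite in_itv /= => st; have /andP[s0 s_t] := st.
      have ts0 : (0 < t - s)%R by rewrite subr_gt0.
      have Lb0 : (0 <= 2 * M `^ beta * b s)%R by rewrite mulr_ge0// b0.
      rewrite -[X in _ + X](heatE_cst x ts0 Lb0) !heat_semigroupE -heatED//.
      * apply: le_heatE.
        -- by apply/measurable_EFinP; exact: measurable_spacetime sv (ltW s0).
        -- apply: emeasurable_funD => //.
           by apply/measurable_EFinP; exact: measurable_spacetime su (ltW s0).
        -- by move=> y; rewrite lee_fin powR_ge0.
        -- move=> y; rewrite -EFinD lee_fin.
           apply: le_trans (powR_lipschitz beta01 _ _) _.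
           ++ exact: mild_bounds hv fM (ltW s0).
           ++ exact: (mild_bounds _ hu fM (ltW s0)).
           ++ by rewrite lerD2l ler_wpM2l// uvb.
      * by apply/measurable_EFinP; exact: measurable_spacetime su (ltW s0).
      * by move=> y; rewrite lee_fin powR_ge0.
  - by move=> s; exact: I0.
  - exact: mI.
  - move=> s /=; rewrite in_itv /= => st.
    by rewrite lee_fin mulr_ge0// b0.
  - by apply/measurable_EFinP; exact: measurable_funM.
have fin : duhamel (absorption u) t x \is a fin_num.
  rewrite ge0_fin_numE; last exact: duhamel_ge0.
  apply: le_lt_trans (duhamel_le_heat x hu t0) _.
  apply: le_lt_trans (ltry M); apply: heat_semigroup_le => //.
  - exact: mild_measurable hu.
  - by move=> y; rewrite (mild_init_ge0 hu) fM.
rewrite -(leeD2rE _ _ fin) (mild_eq x hu t0) -(mild_eq x hv t0).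
by rewrite -addeA leeD2l// addeC.
Qed.

(** Bounded mild solutions are determined by their initial value: the
    difference of two of them is at most M 2^-n e^(2Kt) for every n. *)
Lemma mild_unique f u v M t x :
  mild_solution beta f u -> mild_solution beta f v ->
  (forall y, f y <= M)%R -> (0 <= t)%R -> u t x = v t x.
Proof.
move=> hu hv fM; set K : R := (2 * (2 * M `^ beta + 1))%R.
have L0 : (0 <= 2 * M `^ beta)%R by rewrite mulr_ge0// powR_ge0.
have K0 : (0 < K)%R by rewrite mulr_gt0// ltr_wpDl.
have M0 : (0 <= M)%R := le_trans (mild_init_ge0 hu 0%R) (fM 0%R).
pose b n s : R := (M * 2^-1 ^+ n * expR (K * s))%R.
have b0 n s : (0 <= b n s)%R by rewrite !mulr_ge0 ?expR_ge0// exprn_ge0.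
have mb n : measurable_fun setT (b n).
  apply: measurable_funM => //; apply: (measurableT_comp (@measurable_expR R)).
  exact: measurable_funM.
have bS n s : (0 < s)%R ->
    \int[mu1]_(r in `]0%R, s[) (2 * M `^ beta * b n r)%:E <= (b n.+1 s)%:E.
  move=> s0; pose c : R := (M * 2^-1 ^+ n.+1)%R.
  have c0 : (0 <= c)%R by rewrite mulr_ge0// exprn_ge0.
  have mKe : measurable_fun setT (fun r : R => (K * expR (K * r))%R).
    apply: measurable_funM => //; apply: (measurableT_comp (@measurable_expR R)).
    exact: measurable_funM.
  have mLb : measurable_fun setT (fun r : R => (2 * M `^ beta * b n r)%R).
    exact: measurable_funM.
  apply: (@le_trans _ _ (c%:E * \int[mu1]_(r in `]0%R, s[) (K * expR (K * r))%:E)).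
    rewrite -ge0_integralZl_EFin//; last 2 first.
    - by move=> r _; rewrite lee_fin mulr_ge0 ?expR_ge0// ltW.
    - exact/measurable_EFinP/measurable_funTS.
    apply: ge0_le_integral => //.
    - by move=> r _; rewrite lee_fin mulr_ge0.
    - exact/measurable_EFinP/measurable_funTS.
    - apply: emeasurable_funM => //; exact/measurable_EFinP/measurable_funTS.
    - move=> r _; rewrite -EFinM lee_fin /b /c exprS.
      set e := expR _; set h := (2^-1 ^+ n)%R; set m := (M `^ beta)%R.
      have -> : (M * (2^-1 * h) * (K * e) = (2 * m + 1) * (M * h * e))%R.
        by rewrite /K -/m; field.
      by rewrite ler_wpM2r ?b0// lerDl.
  apply: le_trans (lee_wpmul2l _ (integral_expRM_le K0 s0)) _.
    by rewrite lee_fin.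
  by rewrite -EFinM.
have main n : forall s y, (0 <= s)%R -> (`|u s y - v s y| <= b n s)%R.
  elim: n => [|n IHn] s y s0.
    rewrite /b expr0 mulr1.
    have /andP[u0 uM] := mild_bounds y hu fM s0.
    have /andP[v0 vM] := mild_bounds y hv fM s0.
    have e1 : (1 <= expR (K * s))%R by rewrite -expR0 ler_expR mulr_ge0// ltW.
    rewrite (@le_trans _ _ M)//; last by rewrite ler_peMr.
    by rewrite ler_norml; apply/andP; split; lra.
  move: (s0); rewrite le_eqVlt => /predU1P[<-|sp].
    by case: hu => _ _ -> _; case: hv => _ _ -> _; rewrite subrr normr0.
  have h1 : (u s y <= v s y + b n.+1 s)%R.
    rewrite -lee_fin EFinD.
    apply: le_trans (leeD2l _ (bS n s sp)).
    apply: (@mild_step f) => //.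
    - exact: measurable_funTS.
    - by move=> r z /andP[r0 _]; rewrite distrC IHn// ltW.
  have h2 : (v s y <= u s y + b n.+1 s)%R.
    rewrite -lee_fin EFinD.
    apply: le_trans (leeD2l _ (bS n s sp)).
    apply: (@mild_step f) => //.
    - exact: measurable_funTS.
    - by move=> r z /andP[r0 _]; rewrite IHn// ltW.
  by rewrite ler_norml; apply/andP; split; lra.
move=> t0; apply/eqP; rewrite -subr_eq0 -normr_le0.
have cvg0 : b n t @[n --> \oo] --> (0 : R)%R.
  have -> : (0 = M * 0 * expR (K * t) :> R)%R by rewrite mulr0 mul0r.
  apply: cvgM; last exact: cvg_cst.
  apply: cvgM; first exact: cvg_cst.
  by apply: cvg_expr; rewrite ger0_norm ?invr_ge0// invf_lt1 ?ltr1n.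
rewrite -(cvg_lim _ cvg0)//; apply: limr_ge; first by apply/cvg_ex; exists 0%R.
by apply: nearW => n; exact: main.
Qed.

Lemma spacetime_comp v (phi : R * 'rV[R]_d -> R * 'rV[R]_d) :
  spacetime v -> measurable_fun setT phi ->
  (forall tx, (0 <= tx.1)%R -> (0 <= (phi tx).1)%R) ->
  measurable_fun [set tx : R * 'rV[R]_d | (0 <= tx.1)%R]
    (fun tx => v (phi tx).1 (phi tx).2).
Proof.
move=> hv mphi phi0; apply/measurable_EFinP.
apply: (eq_measurable_fun (zero_past v \o phi)) => [tx|].
  rewrite inE /= => /phi0 h.
  by rewrite -zero_pastE//; case: (phi tx) h.
apply: measurable_funTS; exact: (measurableT_comp (measurable_zero_past hv) mphi).
Qed.

(** Chapman-Kolmogorov splits the absorption integral at time s. *)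
Lemma mild_shift f v M s : mild_solution beta f v -> (forall y, f y <= M)%R ->
  (0 < s)%R -> mild_solution beta (v s) (fun t => v (s + t)%R).
Proof.
move=> hv fM s0; have sv := mild_spacetime hv.
have sa := spacetime_absorption sv.
split.
- apply: (@spacetime_comp v (fun tx => (s + tx.1, tx.2)%R) sv) => [|tx t0].
    apply/measurable_fun_pairP; split => /=; last exact: measurable_snd.
    by apply: measurable_funD => //; exact: measurable_fst.
  by rewrite /= addr_ge0// ltW.
- by move=> t x t0; case: sv => _ v0; rewrite v0// addr_ge0// ltW.
- by move=> x; rewrite addr0.
- move=> t x t0; have st0 : (0 < s + t)%R by rewrite addr_gt0.
  rewrite -[X in _ + X]/(duhamel (absorption (fun t => v (s + t)%R)) t x).
  have itvE : `]0%R, (s + t)%R[%classic = `]0%R, s[ `|` `[s, (s + t)%R[ :> set R.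
    rewrite (@itv_bndbnd_setU _ _ (BRight 0%R) (BLeft s) (BLeft (s + t)%R))//.
    by rewrite bnd_simp lerDl ltW.
  have mv0 := measurable_spacetime sv (ltW s0).
  have v0 r y : (0 <= r)%R -> (0 <= v r y)%R by case: sv => _; exact.
  have h1 := mild_eq x hv st0.
  have h2 : heat_semigroup (s + t) f x = heat_semigroup t (v s) x +
      \int[mu1]_(r in `]0%R, s[) heat_semigroup (s + t - r) (absorption v r) x.
    rewrite (addrC s t) -heatE_duhamel// -heat_semigroup_comp//; last 2 first.
    - exact: mild_measurable hv.
    - exact: mild_init_ge0 hv.
    rewrite heat_semigroupE -heatED//.
    - by congr heatE; apply/funext => y; rewrite -[LHS](mild_eq y hv s0).
    - exact/measurable_EFinP.
    - exact: measurable_duhamel.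
    - by move=> y; rewrite lee_fin v0// ltW.
    - by move=> y; exact: duhamel_ge0.
  set A := \int[mu1]_(r in `]0%R, s[) _ in h2.
  have I0 r : (0 <= r)%R -> 0 <= heat_semigroup (s + t - r) (absorption v r) x.
    by move=> r0; apply: heat_semigroup_ge0 => y; exact: powR_ge0.
  have mI (D : set R) : measurable D -> (forall r, D r -> (0 <= r)%R) ->
      measurable_fun D (fun r => heat_semigroup (s + t - r) (absorption v r) x).
    exact: measurable_heat_history.
  have Afin : A \is a fin_num.
    have A0 : 0 <= A.
      apply: integral_ge0 => r /=; rewrite in_itv /= => /andP[r0 _].
      exact/I0/ltW.
    rewrite (ge0_fin_numE A0).
    apply: (@le_lt_trans _ _ (heat_semigroup (s + t) f x)).
      rewrite h2; apply: leeDr; apply: heat_semigroup_ge0 => y.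
      exact/v0/ltW.
    apply: le_lt_trans (ltry M); apply: heat_semigroup_le => //.
    + exact: mild_measurable hv.
    + by move=> y; rewrite (mild_init_ge0 hv) fM.
  have h3b : \int[mu1]_(r in `[s, (s + t)%R[)
        heat_semigroup (s + t - r) (absorption v r) x =
      duhamel (absorption (fun t => v (s + t)%R)) t x.
    have mIst : measurable_fun `]s, (s + t)%R[
        (fun r => heat_semigroup (s + t - r) (absorption v r) x).
      apply: mI => // r /=; rewrite in_itv /= => /andP[h _].
      by rewrite ltW// (lt_trans _ h).
    rewrite (integral_itv_bndoo _ _ mIst).
    have := @integral_itv_affine R s 1 t
      (fun r => heat_semigroup (s + t - r) (absorption v r) x) ltr01.
    rewrite mul1r => /(_ mIst) ->; last first.
      move=> r /=; rewrite in_itv /= => /andP[h _].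
      by apply: I0; rewrite ltW// (lt_trans _ h).
    rewrite mul1e; apply: eq_integral => r _; rewrite mul1r.
    by rewrite opprD addrACA subrr add0r.
  have pos (r : R) : (`]0%R, s[ `|` `[s, (s + t)%R[)%classic r -> (0 <= r)%R.
    case; rewrite /= in_itv /= => /andP[h _]; first exact: ltW.
    exact: le_trans (ltW s0) h.
  have h3 : duhamel (absorption v) (s + t) x =
      A + duhamel (absorption (fun t => v (s + t)%R)) t x.
    rewrite -h3b /duhamel.
    rewrite itvE.
    apply: (@ge0_integral_setU _ _ _ mu1 `]0%R, s[%classic `[s, (s + t)%R[%classic
      (measurable_itv _) (measurable_itv _)).
    - apply: mI; first by apply: measurableU; exact: measurable_itv.
      exact: pos.
    - by move=> r /pos; exact: I0.
    - apply/disj_setPS => r [] /=; rewrite !in_itv /= => /andP[_ h] /andP[h' _].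
      by move: h; rewrite ltNge h'.
  move: h1; rewrite h2 h3 addeCA [RHS]addeC => e.
  exact: fin_num_addeI Afin e.
Qed.

(** With the amplitude k^(2/beta) the Laplacian and the power 1 + beta scale
    alike. *)
Lemma mild_scale f v (k : R) (z : 'rV[R]_d) : mild_solution beta f v ->
  (0 < k)%R ->
  mild_solution beta (fun x => k `^ (2 / beta) * f (k *: (x - z)))%R
    (fun t x => k `^ (2 / beta) * v (k ^+ 2 * t) (k *: (x - z)))%R.
Proof.
move=> hv k0; have sv := mild_spacetime hv.
have sa := spacetime_absorption sv.
have v0 r y : (0 <= r)%R -> (0 <= v r y)%R by case: sv => _; exact.
have k20 : (0 < k ^+ 2)%R by rewrite exprn_gt0.
have maff : measurable_fun setT (fun x : 'rV[R]_d => k *: (x - z))%R.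
  apply: (eq_measurable_fun (fun x => (- (k *: z)) + k *: x)%R) => [y _|].
    by rewrite scalerBr addrC.
  exact: measurable_affine_rV.
split.
- apply: measurable_funM => //.
  apply: (@spacetime_comp v (fun tx => (k ^+ 2 * tx.1, k *: (tx.2 - z)))%R sv).
    apply/measurable_fun_pairP; split => /=.
      by apply: measurable_funM => //; exact: measurable_fst.
    by apply: (measurableT_comp maff); exact: measurable_snd.
  by move=> tx t0 /=; rewrite mulr_ge0// ltW.
- by move=> t x t0; rewrite mulr_ge0 ?powR_ge0// v0// mulr_ge0// ltW.
- by move=> x; rewrite mulr0; case: hv => _ _ -> _.
- move=> t x t0; have kt0 : (0 < k ^+ 2 * t)%R by rewrite mulr_gt0.
  have sc (g : 'rV[R]_d -> R) r y : (0 < r)%R -> measurable_fun setT g ->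
      (forall y, 0 <= g y)%R -> forall c : R, (0 <= c)%R ->
      heat_semigroup r (fun x => c * g (k *: (x - z)))%R y =
      c%:E * heat_semigroup (k ^+ 2 * r) g (k *: (y - z))%R.
    move=> r0 mg g0 c c0; rewrite !heat_semigroupE.
    rewrite -(@heatE_scale _ _ r k z y (fun y => (g y)%:E))//; last exact/measurable_EFinP.
    rewrite -heatEZ//.
    + by apply/measurable_EFinP; exact: (measurableT_comp mg maff).
    + by move=> w; rewrite lee_fin.
  have kb0 : (0 <= k `^ (2 / beta))%R by exact: powR_ge0.
  rewrite sc//; [|exact: mild_measurable hv|exact: mild_init_ge0 hv].
  rewrite -(mild_eq _ hv kt0) ge0_muleDr; last 2 first.
  - by rewrite lee_fin v0// ltW.
  - exact: duhamel_ge0.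
  rewrite -EFinM; congr (_ + _).
  have := @integral_itv_affine R 0 (k ^+ 2) t
    (fun r => heat_semigroup (k ^+ 2 * t - r) (absorption v r) (k *: (x - z))) k20.
  rewrite add0r => h; rewrite /duhamel h; last 2 first.
  - apply: measurable_heat_history => // s /=.
    by rewrite in_itv /= => /andP[/ltW].
  - move=> r /=; rewrite in_itv /= => /andP[r0 _].
    by apply: heat_semigroup_ge0 => y; exact: powR_ge0.
  rewrite muleA -EFinM -ge0_integralZl_EFin//; last 3 first.
  - move=> r /=; rewrite in_itv /= => /andP[r0 _].
    by apply: heat_semigroup_ge0 => y; exact: powR_ge0.
  - apply: (@measurable_comp _ _ _ _ _ _ `]0%R, (k ^+ 2 * t)%R[%classic
      (fun r => heat_semigroup (k ^+ 2 * t - r) (absorption v r) (k *: (x - z)))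
      _ (fun r : R => 0 + k ^+ 2 * r)%R) => //.
    + move=> _ [r /=] /[!in_itv]/= /andP[r0 rt] <-.
      by rewrite add0r mulr_gt0//= ltr_pM2l.
    + apply: measurable_heat_history => // s /=.
      by rewrite in_itv /= => /andP[/ltW].
    + by apply: measurable_funTS; apply: measurable_funD => //; exact: measurable_funM.
  - by rewrite mulr_ge0// ltW.
  apply: eq_integral => r; rewrite inE /= in_itv /= => /andP[r0 rt].
  rewrite add0r -mulrBr -(sc _ (t - r)%R)//.
  - rewrite !heat_semigroupE; congr heatE; apply/funext => y; congr (_%:E).
    rewrite powRM// ?v0//; last by rewrite mulr_ge0// ltW.
    congr (_ * _)%R; rewrite -powRrM mulrDr mulr1 divfK ?gt_eqF// powRD.
      by rewrite powR_mulrn// ltW.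
    by rewrite (gt_eqF k0) implybT.
  - by rewrite subr_gt0.
  - by apply: measurable_spacetime sa _; rewrite mulr_ge0// ltW.
  - by move=> y; exact: powR_ge0.
  - by rewrite mulr_ge0// ltW.
Qed.

Lemma duhamel_le_cst v (K : R) t x : spacetime v -> (0 < t)%R -> (0 <= K)%R ->
  (forall s y, (0 < s < t)%R -> (v s y <= K)%R) ->
  duhamel (absorption v) t x <= (t * K `^ (1 + beta))%:E.
Proof.
move=> sv t0 K0 vK; have sa := spacetime_absorption sv.
apply: (@le_trans _ _ (\int[mu1]_(s in `]0%R, t[) (K `^ (1 + beta))%:E)).
  apply: ge0_le_integral => //.
  - move=> s /=; rewrite in_itv /= => /andP[s0 _].
    by apply: heat_semigroup_ge0 => y; exact: powR_ge0.
  - apply: measurable_heat_history => // s /=.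
    by rewrite in_itv /= => /andP[/ltW].
  - move=> s /=; rewrite in_itv /= => /andP[s0 st].
    apply: heat_semigroup_le; first by rewrite subr_gt0.
      exact: measurable_spacetime sa (ltW s0).
    move=> y; rewrite powR_ge0/= ge0_ler_powR ?nnegrE//.
    + by rewrite addr_ge0// ltW.
    + by case: sv => _ -> //; exact: ltW.
    + by rewrite vK// s0.
rewrite integral_cst//= lebesgue_measure_itv /= lte_fin t0 sube0.
by rewrite -EFinM mulrC.
Qed.

(** As v^(1 + beta) <= M^beta v and v lies below the heat flow, absorption takes
    only a fraction of that flow when the data are small or the time short. *)
Lemma mild_ge_heat f v (M : R) t x : mild_solution beta f v ->
  (forall y, f y <= M)%R -> (0 < t)%R ->
  ((1 - t * M `^ beta)%:E * heat_semigroup t f x <= (v t x)%:E).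
Proof.
move=> hv fM t0; have sv := mild_spacetime hv.
have sa := spacetime_absorption sv.
have mf := mild_measurable hv; have f0 := mild_init_ge0 hv.
have D : duhamel (absorption v) t x <= (t * M `^ beta)%:E * heat_semigroup t f x.
  apply: (@le_trans _ _ (\int[mu1]_(s in `]0%R, t[)
      ((M `^ beta)%:E * heat_semigroup t f x))).
    apply: ge0_le_integral => //.
    - move=> s /=; rewrite in_itv /= => /andP[s0 _].
      by apply: heat_semigroup_ge0 => y; exact: powR_ge0.
    - apply: measurable_heat_history => // s /=.
      by rewrite in_itv /= => /andP[/ltW].
    - move=> s /=; rewrite in_itv /= => /andP[s0 st].
      have ts0 : (0 < t - s)%R by rewrite subr_gt0.
      have mP := measurable_heat_semigroup s mf f0.
      have P0 y : 0 <= heat_semigroup s f y by apply: heat_semigroup_ge0.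
      have -> : heat_semigroup t f x = heatE (t - s) (heat_semigroup s f) x.
        by rewrite (heat_semigroup_comp x ts0 s0 mf f0) subrK.
      rewrite -heatEZ// ?powR_ge0// heat_semigroupE; apply: le_heatE.
      + by apply/measurable_EFinP; exact: measurable_spacetime sa (ltW s0).
      + exact: measurable_funeM.
      + by move=> y; rewrite lee_fin powR_ge0.
      + move=> y; have /andP[v0 vM] := mild_bounds y hv fM (ltW s0).
        rewrite /absorption powR1D// mulrC EFinM.
        apply: lee_pmul; rewrite ?lee_fin ?powR_ge0//.
          by rewrite (ge0_ler_powR (ltW beta0)) ?nnegrE// (le_trans v0 vM).
        exact: mild_le_heat hv s0.
  rewrite integral_cst//= lebesgue_measure_itv /= lte_fin t0 sube0.
  by rewrite muleAC -EFinM mulrC.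
have Pfin : heat_semigroup t f x \is a fin_num.
  rewrite ge0_fin_numE; last exact: heat_semigroup_ge0.
  by apply: le_lt_trans (ltry M); apply: heat_semigroup_le => // y; rewrite f0 fM.
move: D Pfin; rewrite -(mild_eq x hv t0).
case: (duhamel _ _ _) (duhamel_ge0 t x sa) => [D||]//= D0.
by rewrite -EFinD -!EFinM !lee_fin => h _; nra.
Qed.

End mild_solutions.

(** * Laplace functionals *)

Section laplace_tools.
Context {R : realType}.
Local Open Scope ereal_scope.

Lemma measurable_expeR : measurable_fun setT (@expeR R).
Proof.
apply: (eq_measurable_fun (fun x => maxe (er_map expR x) 0)) => [[r||] _ //=|].
- by rewrite max_l// lee_fin expR_ge0.
- by rewrite max_r// leNye.
apply: measurable_maxe; last exact: measurable_cst.
by apply: (@measurable_er_map _ R R expR); exact: measurable_expR.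
Qed.

Lemma expeRN_le1 (x : \bar R) : 0 <= x -> expeR (- x) <= 1.
Proof. by move=> x0; rewrite -expeR0 lee_expeR oppe_le0. Qed.

Lemma expeRN_fin (x : \bar R) : 0 <= x -> expeR (- x) \is a fin_num.
Proof.
move=> x0; rewrite ge0_fin_numE ?expeR_ge0//.
exact: le_lt_trans (expeRN_le1 x0) (ltry 1).
Qed.

Lemma sube1_expeRN_ge0 (x : \bar R) : 0 <= x -> 0 <= 1 - expeR (- x).
Proof. by move=> x0; rewrite sube_ge0 ?expeRN_le1// expeRN_fin. Qed.

Lemma sube1_expeRN_le1 (x : \bar R) : 0 <= x -> 1 - expeR (- x) <= 1.
Proof. by move=> x0; rewrite leeBlDr ?expeRN_fin// leeDl// expeR_ge0. Qed.

Lemma le_sube1_expeRN (x y : \bar R) : 0 <= x -> x <= y ->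
  1 - expeR (- x) <= 1 - expeR (- y).
Proof. by move=> x0 xy; rewrite leeB// lee_expeR leeN2. Qed.

Lemma sube1_expeRND (x y : \bar R) : 0 <= x -> 0 <= y ->
  1 - expeR (- (x + y)) <= (1 - expeR (- x)) + (1 - expeR (- y)).
Proof.
move=> x0 y0; rewrite oppeD ?ge0_adde_def ?inE// expeRD.
have ha := expeRN_le1 x0; have hb := expeRN_le1 y0.
move: ha hb (expeR_ge0 (- x)) (expeR_ge0 (- y)) (expeRN_fin x0) (expeRN_fin y0).
case: (expeR (- x)) => [a| |] //; case: (expeR (- y)) => [b| |] //.
rewrite -!EFinB -EFinD !lee_fin => a1 b1 a0 b0 _ _.
have : (0 <= (1 - a) * (1 - b))%R by rewrite mulr_ge0// subr_ge0.
by rewrite mulrBl mulrBr; lra.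
Qed.

Lemma cvg_expeRN (a : (\bar R)^nat) (l : \bar R) : (forall n, 0 <= a n) ->
  a n @[n --> \oo] --> l -> expeR (- a n) @[n --> \oo] --> expeR (- l).
Proof.
move=> a0; case: l => [l| |] al.
- have /fine_cvgP[fina cva] := al.
  have h : (expR (- fine (a n)))%:E @[n --> \oo] --> (expR (- l))%:E.
    apply: cvg_EFin; first exact: nearW.
    apply: (cvg_comp _ _ (cvgN cva)); exact: continuous_expR.
  apply: cvg_trans h; apply: near_eq_cvg; near=> n.
  by rewrite -[in RHS](fineK (_ : a n \is a fin_num))//; near: n.
- rewrite /=; apply/fine_cvgP; split.
    by apply: nearW => n; exact: expeRN_fin.
  apply/cvgrPdist_le => e e0 /=.
  move/cvgeyPge : al => /(_ (- ln e)%R) al.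
  near=> n; rewrite sub0r normrN ger0_norm ?fine_ge0 ?expeR_ge0//.
  rewrite -lee_fin fineK ?expeRN_fin//.
  apply: (@le_trans _ _ (expeR (ln e)%:E)); last by rewrite /= lnK ?posrE.
  by rewrite lee_expeR leeNl -EFinN; near: n.
- have : 0 <= -oo :> \bar R by apply: (cvge_to_ge al); exact: nearW.
  by rewrite leeNy_eq.
Unshelve. all: by end_near. Qed.

Lemma bounded_cvg_integral d (T : measurableType d)
    (mu : {measure set T -> \bar R}) (f_ : (T -> \bar R)^nat) (f : T -> \bar R) :
  mu setT < +oo -> (forall n, measurable_fun setT (f_ n)) ->
  (forall n x, `|f_ n x| <= 1) ->
  (forall x, f_ n x @[n --> \oo] --> f x) ->
  \int[mu]_x f_ n x @[n --> \oo] --> \int[mu]_x f x.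
Proof.
move=> mufin mf f1 ff.
have mlim : measurable_fun setT f by apply: (emeasurable_fun_cvg f_) => // x _.
have [] // := @dominated_convergence _ _ _ mu setT measurableT f_ f (cst 1).
- by apply: aeW => x _; exact: ff.
- apply/integrableP; split; first exact: measurable_cst.
  rewrite (eq_integral (cst 1)) => [|x _]; last by rewrite /= normr1.
  by rewrite integral_cst//= mul1e.
- exact: aeW.
Qed.

End laplace_tools.

(** * Cumulants *)

Section cumulants.
Context {R : realType} {d : nat} (beta : R)
    {dW : measure_display} {W : measurableType dW}
    (xi : R -> W -> measures R d) (P : measures R d -> probability W R)
    {dV : measure_display} {V : measurableType dV}
    (eta : R -> V -> measures R d) (Q : R.-pker 'rV[R]_d ~> V)
    (beta01 : 0 < beta <= 1)
    (hX : superprocess xi P beta) (hC : cluster_family xi P eta Q beta).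
Implicit Types (s t : R) (x y : 'rV[R]_d) (f g : 'rV[R]_d -> R).
Local Open Scope ereal_scope.

Let beta0 : (0 < beta)%R. Proof. by case/andP: beta01. Qed.

Lemma measurable_cluster_integral t f : (0 < t)%R -> measurable_fun setT f ->
  (forall y, 0 <= f y)%R ->
  measurable_fun setT (fun w => \int[eta t w]_y (f y)%:E).
Proof.
move=> t0 mf f0; apply: measurable_fun_integral_kernel => //.
- by move=> U mU; exact: (cluster_measurable hC t0 mU).
- exact/measurable_EFinP.
Qed.

Definition cluster_loss t f x : \bar R :=
  \int[Q x]_w (1 - expeR (- \int[eta t w]_y (f y)%:E)).

Definition cluster_rate t : R := ((beta * t) `^ (- beta^-1))%R.

(** The cumulant semigroup of xi in its cluster form: for t > 0 it is
    -ln E exp(- xi_t f) under the law started from the unit mass at x. Its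
    monotonicity and subadditivity in f are visible in this form. *)
Definition cumulant t f x : R :=
  if (0 < t)%R then (cluster_rate t * fine (cluster_loss t f x))%R else f x.

Lemma cluster_rate_gt0 t : (0 < t)%R -> (0 < cluster_rate t)%R.
Proof. by move=> t0; rewrite powR_gt0// mulr_gt0. Qed.

Section cluster_loss_theory.
Context (t : R) (t0 : (0 < t)%R).

Let int_ge0 f w : (forall y, 0 <= f y)%R -> 0 <= \int[eta t w]_y (f y)%:E.
Proof. by move=> f0; apply: integral_ge0 => y _; rewrite lee_fin. Qed.

Lemma measurable_cluster_loss_integrand f : measurable_fun setT f ->
  (forall y, 0 <= f y)%R ->
  measurable_fun setT (fun w => 1 - expeR (- \int[eta t w]_y (f y)%:E)).
Proof.
move=> mf f0; apply: emeasurable_funB; first exact: measurable_cst.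
apply: (measurableT_comp measurable_expeR).
by apply: measurableT_comp => //; exact: measurable_cluster_integral.
Qed.

Lemma cluster_loss_ge0 f x : (forall y, 0 <= f y)%R -> 0 <= cluster_loss t f x.
Proof.
by move=> f0; apply: integral_ge0 => w _; exact/sube1_expeRN_ge0/int_ge0.
Qed.

Lemma cluster_loss_le1 f x : measurable_fun setT f ->
  (forall y, 0 <= f y)%R -> cluster_loss t f x <= 1.
Proof.
move=> mf f0.
apply: (@le_trans _ _ (\int[Q x]_w cst 1 w)).
  apply: ge0_le_integral => //.
  - by move=> w _; exact/sube1_expeRN_ge0/int_ge0.
  - exact: measurable_cluster_loss_integrand.
  - by move=> w _; exact/sube1_expeRN_le1/int_ge0.
by rewrite integral_cst// mul1e prob_kernel.
Qed.

Lemma cluster_loss_fin f x : measurable_fun setT f ->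
  (forall y, 0 <= f y)%R -> cluster_loss t f x \is a fin_num.
Proof.
move=> mf f0; rewrite ge0_fin_numE; last exact: cluster_loss_ge0.
exact: le_lt_trans (cluster_loss_le1 x mf f0) (ltry 1).
Qed.

Lemma cumulantE f x : measurable_fun setT f -> (forall y, 0 <= f y)%R ->
  (cumulant t f x)%:E = (cluster_rate t)%:E * cluster_loss t f x.
Proof.
by move=> mf f0; rewrite /cumulant t0 EFinM fineK// cluster_loss_fin.
Qed.

Lemma cumulant_laplace f x : measurable_fun setT f -> (forall y, 0 <= f y)%R ->
  \int[P \d_x]_w expeR (- \int[xi t w]_y (f y)%:E) = expeR (- (cumulant t f x)%:E).
Proof.
by move=> mf f0; rewrite (cluster_laplace hC x t0 mf f0) cumulantE.
Qed.

Lemma cumulant_ge0 f x : (forall y, 0 <= f y)%R -> (0 <= cumulant t f x)%R.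
Proof.
move=> f0; rewrite /cumulant t0 mulr_ge0//; first exact/ltW/cluster_rate_gt0.
exact/fine_ge0/cluster_loss_ge0.
Qed.

Lemma le_cumulant f g x : measurable_fun setT f -> measurable_fun setT g ->
  (forall y, 0 <= f y)%R -> (forall y, f y <= g y)%R ->
  (cumulant t f x <= cumulant t g x)%R.
Proof.
move=> mf mg f0 fg; have g0 y : (0 <= g y)%R := le_trans (f0 y) (fg y).
rewrite -lee_fin (cumulantE x mf f0) (cumulantE x mg g0).
apply: lee_wpmul2l; first by rewrite lee_fin; exact/ltW/cluster_rate_gt0.
apply: ge0_le_integral => //.
- by move=> w _; exact/sube1_expeRN_ge0/int_ge0.
- exact: measurable_cluster_loss_integrand.
- exact: measurable_cluster_loss_integrand.
- move=> w _; apply: le_sube1_expeRN; first exact: int_ge0.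
  apply: ge0_le_integral => //.
  + by move=> y _; rewrite lee_fin.
  + exact/measurable_EFinP.
  + exact/measurable_EFinP.
  + by move=> y _; rewrite lee_fin.
Qed.

(** From 1 - exp (- (a + b)) <= (1 - exp (- a)) + (1 - exp (- b)). *)
Lemma cumulant_subadditive f g x : measurable_fun setT f -> measurable_fun setT g ->
  (forall y, 0 <= f y)%R -> (forall y, 0 <= g y)%R ->
  (cumulant t (fun y => f y + g y) x <= cumulant t f x + cumulant t g x)%R.
Proof.
move=> mf mg f0 g0; have fg0 y : (0 <= f y + g y)%R by rewrite addr_ge0.
have mfg : measurable_fun setT (fun y => f y + g y)%R by exact: measurable_funD.
rewrite -lee_fin EFinD !cumulantE// -ge0_muleDr ?cluster_loss_ge0//.
rewrite lee_wpmul2l ?lee_fin//; first exact/ltW/cluster_rate_gt0.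
rewrite /cluster_loss -ge0_integralD//.
- apply: ge0_le_integral => //.
  + by move=> w _; exact/sube1_expeRN_ge0/int_ge0.
  + exact: measurable_cluster_loss_integrand.
  + by apply: emeasurable_funD; exact: measurable_cluster_loss_integrand.
  + move=> w _; under eq_integral do rewrite EFinD.
    rewrite ge0_integralD//.
    * by apply: sube1_expeRND; exact: int_ge0.
    * by move=> y _; rewrite lee_fin.
    * exact/measurable_EFinP.
    * by move=> y _; rewrite lee_fin.
    * exact/measurable_EFinP.
- by move=> w _; exact/sube1_expeRN_ge0/int_ge0.
- exact: measurable_cluster_loss_integrand.
- by move=> w _; exact/sube1_expeRN_ge0/int_ge0.
- exact: measurable_cluster_loss_integrand.
Qed.

(** This bound does not depend on f, because a single cluster contributes at
    most 1 whatever f is. *)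
Lemma cumulant_le_rate f x : measurable_fun setT f -> (forall y, 0 <= f y)%R ->
  (cumulant t f x <= cluster_rate t)%R.
Proof.
move=> mf f0; rewrite -lee_fin cumulantE// -[leRHS]mule1.
by rewrite lee_wpmul2l ?cluster_loss_le1// lee_fin ltW// cluster_rate_gt0.
Qed.

Lemma cumulant_cvg (f_ : nat -> 'rV[R]_d -> R) f x :
  (forall n, measurable_fun setT (f_ n)) -> (forall n y, 0 <= f_ n y)%R ->
  (forall y, nondecreasing_seq (f_ ^~ y)) ->
  (forall y, f_ n y @[n --> \oo] --> f y) ->
  cumulant t (f_ n) x @[n --> \oo] --> cumulant t f x.
Proof.
move=> mf f0 ndf cf.
have cfE y : (f_ n y)%:E @[n --> \oo] --> (f y)%:E.
  by apply: cvg_EFin; [exact: nearW|exact: cf].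
have fge0 y : (0 <= f y)%R.
  by rewrite -lee_fin; apply: (cvge_to_ge (cfE y)); apply: nearW => n; rewrite lee_fin.
have mfl : measurable_fun setT f.
  by apply: (@measurable_fun_cvg _ _ _ _ f_) => // y _; exact: cf.
suff : (cumulant t (f_ n) x)%:E @[n --> \oo] --> (cumulant t f x)%:E.
  by move=> /fine_cvgP[].
rewrite cumulantE//; under eq_fun do rewrite cumulantE//.
apply: cvgeZl => //; apply: bounded_cvg_integral.
- by rewrite prob_kernel ltry.
- by move=> n; exact: measurable_cluster_loss_integrand.
- move=> n w; rewrite gee0_abs; first exact/sube1_expeRN_le1/int_ge0.
  exact/sube1_expeRN_ge0/int_ge0.
- move=> w; apply: cvgeB.
  + exact: fin_num_adde_defr.
  + exact: cvg_cst.
  + apply: cvg_expeRN; first by move=> n; exact: int_ge0.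
    have -> : \int[eta t w]_y (f y)%:E =
        \int[eta t w]_y limn (fun n => (f_ n y)%:E).
      by apply: eq_integral => y _; apply/esym/cvg_lim.
    apply: cvg_monotone_convergence => //.
    * by move=> n; exact/measurable_EFinP.
    * by move=> n y _; rewrite lee_fin.
    * by move=> y _ n m nm; rewrite lee_fin; exact: ndf.
Qed.

End cluster_loss_theory.

Lemma mild_ext f (u v : R -> 'rV[R]_d -> R) :
  (forall t x, (0 <= t)%R -> u t x = v t x) ->
  mild_solution beta f u -> mild_solution beta f v.
Proof.
move=> uv [mu u0 uf ueq]; split.
- apply: eq_measurable_fun mu => tx; rewrite inE /= => h; exact: uv.
- by move=> t x t0; rewrite -uv// u0.
- by move=> x; rewrite -uv.
- move=> t x t0; have := ueq t x t0; rewrite (uv t x (ltW t0)) => <-.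
  have E : duhamel (absorption beta u) t x = duhamel (absorption beta v) t x.
    apply: eq_integral => s; rewrite inE /= in_itv /= => /andP[s0 _].
    have -> : absorption beta u s = absorption beta v s.
      by apply/funext => y; rewrite /absorption (uv s y (ltW s0)).
    by [].
  exact: (congr1 (fun z => (v t x)%:E + z) (esym E)).
Qed.

(** Started from the unit mass at x, the process and its clusters express the
    same Laplace functional; this identifies the solution of the equation, which
    then serves for every finite initial measure. *)
Lemma cumulant_superprocess f : measurable_fun setT f -> (forall y, 0 <= f y)%R ->
  (exists M, forall y, f y <= M)%R ->
  mild_solution beta f (fun t => cumulant t f) /\
  forall (mu : measures R d) t, mu setT < +oo -> (0 <= t)%R ->
    \int[P mu]_w expeR (- \int[xi t w]_x (f x)%:E)
    = expeR (- \int[mu]_x (cumulant t f x)%:E).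
Proof.
move=> mf f0 fM; have [v mv vE] := superprocess_laplace hX mf f0 fM.
have vc t x : (0 <= t)%R -> v t x = cumulant t f x.
  rewrite le_eqVlt => /predU1P[<-|t0].
    by rewrite /cumulant ltxx; case: mv => _ _ -> _.
  have fin : (\d_x : measures R d) setT < +oo.
    by rewrite [X in X < _](_ : _ = 1) ?ltry//; exact: diracT.
  have := vE _ t fin (ltW t0); rewrite (cumulant_laplace t0)//.
  rewrite integral_dirac//; last first.
    apply/measurable_EFinP.
    exact: measurable_spacetime (mild_spacetime mv) (ltW t0).
  by rewrite diracT mul1e => /expeR_inj /oppe_inj [].
split; first exact: mild_ext mv.
move=> mu t mufin t0; rewrite vE//; congr (expeR (- _)).
by apply: eq_integral => x _; rewrite vc.
Qed.

Lemma cumulant_mild f : measurable_fun setT f -> (forall y, 0 <= f y)%R ->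
  (exists M, forall y, f y <= M)%R ->
  mild_solution beta f (fun t => cumulant t f).
Proof. by move=> mf f0 fM; case: (cumulant_superprocess mf f0 fM). Qed.

Lemma measurable_cumulant t f : (0 <= t)%R -> measurable_fun setT f ->
  (forall y, 0 <= f y)%R -> (exists M, forall y, f y <= M)%R ->
  measurable_fun setT (cumulant t f).
Proof.
move=> t0 mf f0 fM; have := mild_spacetime (cumulant_mild mf f0 fM).
by move/measurable_spacetime; exact.
Qed.

Lemma cumulant_le_heat t f x : (0 < t)%R -> measurable_fun setT f ->
  (forall y, 0 <= f y)%R -> (exists M, forall y, f y <= M)%R ->
  (cumulant t f x)%:E <= heat_semigroup t f x.
Proof. by move=> t0 mf f0 fM; exact: (mild_le_heat x (cumulant_mild mf f0 fM)). Qed.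

Lemma cumulant_unique f v t x : mild_solution beta f v ->
  (exists M, forall y, f y <= M)%R -> (0 <= t)%R -> v t x = cumulant t f x.
Proof.
move=> mv fM t0.
have mc : mild_solution beta f (fun t => cumulant t f).
  by apply: cumulant_mild => //; [exact: mild_measurable mv|exact: mild_init_ge0 mv].
case: fM => M fM; exact: (mild_unique beta01 x mv mc fM t0).
Qed.

Lemma cumulant_flow s t f x : (0 < s)%R -> (0 <= t)%R -> measurable_fun setT f ->
  (forall y, 0 <= f y)%R -> (exists M, forall y, f y <= M)%R ->
  cumulant (s + t) f x = cumulant t (cumulant s f) x.
Proof.
move=> s0 t0 mf f0 [M fM].
have mc : mild_solution beta f (fun t => cumulant t f).
  by apply: cumulant_mild => //; exists M.
have := mild_shift mc fM s0.
move/cumulant_unique => /(_ t x) -> //.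
by exists M => y; have /andP[] := mild_bounds y mc fM (ltW s0).
Qed.

End cumulants.

(** * Hitting exponents *)

Section hitting_exponents.
Context {R : realType} {d : nat} (beta : R)
    {dW : measure_display} {W : measurableType dW}
    (xi : R -> W -> measures R d) (P : measures R d -> probability W R)
    {dV : measure_display} {V : measurableType dV}
    (eta : R -> V -> measures R d) (Q : R.-pker 'rV[R]_d ~> V)
    (beta01 : 0 < beta <= 1)
    (hX : superprocess xi P beta) (hC : cluster_family xi P eta Q beta).
Implicit Types (s t : R) (x y : 'rV[R]_d) (f g : 'rV[R]_d -> R).
Implicit Types (B : set 'rV[R]_d).
Local Notation cum := (cumulant beta eta Q).
Local Open Scope ereal_scope.

Let beta0 : (0 < beta)%R. Proof. by case/andP: beta01. Qed.

(** The intensity with which clusters rooted at x charge B; it is the limit of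
    the cumulants of multiples of any function with support set B. *)
Definition hitting_exponent t B x : R :=
  (cluster_rate beta t * fine (Q x [set w | (0 < eta t w B)%E]))%R.

Lemma measurable_cluster_hit t B : (0 < t)%R -> measurable B ->
  measurable [set w | 0 < eta t w B].
Proof.
move=> t0 mB; rewrite -[X in measurable X]setTI.
apply: emeasurable_fun_o_infty => //; exact: (cluster_measurable hC t0 mB).
Qed.

Lemma prob_kernel_fin x (A : set V) : measurable A -> Q x A \is a fin_num.
Proof.
move=> mA; rewrite ge0_fin_numE//; apply: (@le_lt_trans _ _ 1); last exact: ltry.
have <- : Q x setT = 1 by exact: prob_kernel.
by rewrite le_measure ?inE.
Qed.

Lemma prob_kernel_le1 x (A : set V) : measurable A -> Q x A <= 1.
Proof.
move=> mA; have <- : Q x setT = 1 by exact: prob_kernel.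
by rewrite le_measure ?inE.
Qed.

Lemma hitting_exponent_ge0 t B x : (0 < t)%R -> (0 <= hitting_exponent t B x)%R.
Proof.
move=> t0; rewrite mulr_ge0//; exact/ltW/(cluster_rate_gt0 beta01).
Qed.

Lemma hitting_exponent_le_rate t B x : (0 < t)%R -> measurable B ->
  (hitting_exponent t B x <= cluster_rate beta t)%R.
Proof.
move=> t0 mB; rewrite /hitting_exponent ler_piMr//.
  exact/ltW/(cluster_rate_gt0 beta01).
have mA := measurable_cluster_hit t0 mB.
by rewrite -lee_fin fineK ?prob_kernel_fin// prob_kernel_le1.
Qed.

Lemma integral_gt0_support (m : measures R d) f B :
  measurable_fun setT f -> measurable B -> (forall y, 0 <= f y)%R ->
  (forall y, (0 < f y)%R <-> B y) ->
  (0 < \int[m]_y (f y)%:E) = (0 < m B).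
Proof.
move=> mf mB f0 fB.
have mfE : measurable_fun setT (EFin \o f) by exact/measurable_EFinP.
have absE : \int[m]_y `|(EFin \o f) y| = \int[m]_y (f y)%:E.
  by apply: eq_integral => y _; rewrite gee0_abs// lee_fin.
have E : (\int[m]_y (f y)%:E = 0) <-> m B = 0.
  rewrite -absE; apply: (iff_trans (ae_eq_integral_abs m measurableT mfE)).
  have BE : ~` [set y | [set: 'rV[R]_d] y -> (EFin \o f) y = cst 0 y] = B.
    apply/seteqP; split => y /=.
      move=> h; apply/fB; rewrite lt_neqAle f0 andbT eq_sym; apply/eqP => fy.
      by apply: h => _; rewrite fy.
    move=> By /(_ Logic.I) [] fy; have := (fB y).2 By; by rewrite fy ltxx.
  split.
    by move=> /negligibleP; rewrite BE; exact.
  by move=> mB0; apply/negligibleP; rewrite BE.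
have i0 : 0 <= \int[m]_y (f y)%:E by apply: integral_ge0 => y _; rewrite lee_fin.
rewrite !lt_neqAle i0 measure_ge0 !andbT ![0 == _]eq_sym; congr (~~ _).
by apply/eqP/eqP => /E.
Qed.

Lemma cvg_muln_ereal (z : \bar R) : 0 < z -> n%:R%:E * z @[n --> \oo] --> +oo.
Proof.
case: z => [z| |]// z0.
- rewrite lte_fin in z0.
  apply/cvgeyPge => A; near=> n.
  rewrite -EFinM lee_fin -ler_pdivrMr//; near: n.
  by apply: nbhs_infty_ger.
- apply: cvg_near_cst; near=> n; rewrite gt0_muley// lte_fin ltr0n.
  by near: n; exists 1%N.
Unshelve. all: by end_near. Qed.

(** The functionals 1 - exp (- n eta_t f) increase to the indicator of
    eta_t f > 0, so that only the support of f matters. *)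
Lemma hitting_exponent_cvg t f B x : (0 < t)%R ->
  measurable_fun setT f -> measurable B -> (forall y, 0 <= f y)%R ->
  (forall y, (0 < f y)%R <-> B y) ->
  cum t (fun y => n%:R * f y)%R x @[n --> \oo] --> hitting_exponent t B x.
Proof.
move=> t0 mf mB f0 fB.
have mA := measurable_cluster_hit t0 mB.
suff : (cum t (fun y => n%:R * f y)%R x)%:E @[n --> \oo] -->
    (hitting_exponent t B x)%:E by move=> /fine_cvgP[].
have nf0 n y : (0 <= n%:R * f y)%R by rewrite mulr_ge0.
have mnf n : measurable_fun setT (fun y => n%:R * f y)%R.
  exact: measurable_funM.
rewrite EFinM fineK ?prob_kernel_fin//.
under eq_fun => n do rewrite (cumulantE hC t0 x (mnf n) (nf0 n)).
apply: cvgeZl => //.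
have -> : Q x [set w | 0 < eta t w B] =
    \int[Q x]_w (\1_[set w | (0 < eta t w B)%E] w)%:E.
  by rewrite integral_indic// setIT.
have i0 n w : 0 <= \int[eta t w]_y (n%:R * f y)%:E.
  by apply: integral_ge0 => y _; rewrite lee_fin.
apply: bounded_cvg_integral.
- by rewrite prob_kernel ltry.
- by move=> n; apply: (measurable_cluster_loss_integrand hC t0).
- move=> n w; rewrite gee0_abs; first exact: sube1_expeRN_le1.
  exact: sube1_expeRN_ge0.
- move=> w.
  have E n : \int[eta t w]_y (n%:R * f y)%:E = n%:R%:E * \int[eta t w]_y (f y)%:E.
    under eq_integral do rewrite EFinM.
    rewrite ge0_integralZl_EFin//; first by move=> y _; rewrite lee_fin.
    exact/measurable_EFinP.
  have -> : (\1_[set w | (0 < eta t w B)%E] w)%:E =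
      1 - expeR (- (if 0 < eta t w B then +oo else 0)) :> \bar R.
    rewrite indicE; case: ifPn => h; first by rewrite mem_set//= sube0.
    by rewrite memNset/= ?oppr0 ?expR0 ?subee//; exact/negP.
  apply: cvgeB; [exact: fin_num_adde_defr|exact: cvg_cst|].
  apply: cvg_expeRN => //.
  under eq_fun do rewrite E.
  rewrite -(integral_gt0_support (eta t w) mf mB f0 fB).
  case: ifPn => [z0|]; first exact: cvg_muln_ereal.
  rewrite -leNgt => z0.
  have -> : \int[eta t w]_y (f y)%:E = 0.
    by apply/eqP; rewrite eq_le z0/=; apply: integral_ge0 => y _; rewrite lee_fin.
  by under eq_fun do rewrite mule0; exact: cvg_cst.
Qed.

Let indic_supp B y : (0 < (\1_B y : R))%R <-> B y.
Proof.
rewrite indicE; split; last by move=> By; rewrite mem_set.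
by case: (boolP (y \in B)); [rewrite inE|rewrite ltxx].
Qed.

Let nindic_bounded n B : exists M : R, forall y, (n%:R * \1_B y <= M)%R.
Proof.
by exists n%:R => y; rewrite ler_piMr// indicE; case: (_ \in _).
Qed.

Let nindic_ge0 n B y : (0 <= n%:R * (\1_B y : R))%R.
Proof. by rewrite mulr_ge0// indicE. Qed.

Let measurable_nindic (n : nat) B : measurable B ->
  measurable_fun setT (fun y => n%:R * (\1_B y : R))%R.
Proof. by move=> mB; apply: measurable_funM => //; exact: measurable_indic. Qed.

Lemma hitting_exponent_indic_cvg t B x : (0 < t)%R -> measurable B ->
  cum t (fun y => n%:R * \1_B y)%R x @[n --> \oo] --> hitting_exponent t B x.
Proof.
move=> t0 mB; exact: hitting_exponent_cvg.
Qed.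

Lemma measurable_hitting_exponent t B : (0 < t)%R -> measurable B ->
  measurable_fun setT (hitting_exponent t B).
Proof.
move=> t0 mB.
apply: (@measurable_fun_cvg _ _ _ _ (fun n => cum t (fun y => n%:R * \1_B y)%R)).
  move=> n; apply: (measurable_cumulant hX hC (ltW t0)) => //.
  exact: measurable_nindic.
by move=> x _; exact: hitting_exponent_indic_cvg.
Qed.

(** Monotone limit of the flow of the cumulants. *)
Lemma hitting_exponent_flow s t B x : (0 < s)%R -> (0 < t)%R -> measurable B ->
  hitting_exponent (s + t) B x = cum t (hitting_exponent s B) x.
Proof.
move=> s0 t0 mB.
have h1 : cum (s + t) (fun y => n%:R * \1_B y)%R x @[n --> \oo] -->
    hitting_exponent (s + t) B x.
  by apply: hitting_exponent_indic_cvg => //; exact: addr_gt0.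
have h2 : cum (s + t) (fun y => n%:R * \1_B y)%R x @[n --> \oo] -->
    cum t (hitting_exponent s B) x.
  have E n : cum (s + t) (fun y => n%:R * \1_B y)%R x =
      cum t (cum s (fun y => n%:R * \1_B y)%R) x.
    apply: (cumulant_flow beta01 hX hC) => //; first exact: ltW.
    exact: measurable_nindic.
  under eq_fun do rewrite E.
  apply: (cumulant_cvg hC) => //.
  - move=> n; apply: (measurable_cumulant hX hC (ltW s0)) => //.
    exact: measurable_nindic.
  - by move=> n y; exact: (cumulant_ge0 eta Q beta01).
  - move=> y n m nm; apply: (le_cumulant beta01 hC) => //.
    + exact: measurable_nindic.
    + exact: measurable_nindic.
    + by move=> z; rewrite ler_wpM2r ?ler_nat// indicE.
  - by move=> y; exact: hitting_exponent_indic_cvg.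
exact: cvg_unique h1 h2.
Qed.

End hitting_exponents.

(** * Localization *)

Section gaussian_tail.
Context {R : realType} {d : nat}.
Implicit Types (y z : 'rV[R]_d).

Lemma measurable_eball y (r : R) : measurable (eball y r).
Proof.
have [r0|r0] := leP r 0.
  rewrite (_ : eball y r = set0) //; apply/seteqP; split => // z /=.
  by rewrite /eball /= ltNge (le_trans r0)// enorm_ge0.
have -> : eball y r = setT `&`
    (fun z => enorm (z - y) ^+ 2) @^-1` `]-oo, (r ^+ 2)[%classic.
  rewrite setTI; apply/seteqP; split => z; rewrite /eball /= in_itv /=.
    by move=> h; rewrite ltr_pXn2r ?nnegrE ?enorm_ge0// ltW.
  by rewrite ltr_pXn2r ?nnegrE ?enorm_ge0// ltW.
suff : measurable_fun setT (fun z : 'rV[R]_d => enorm (z - y) ^+ 2) by exact.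
apply: (measurableT_comp (@measurable_enorm_sqr R d) (g := fun z => z - y)).
apply: measurable_fun_rV => i.
apply: (eq_measurable_fun (fun z : 'rV[R]_d => z 0 i - y 0 i)) => [z _|].
  by rewrite !mxE.
by apply: measurable_funB => //; exact: measurable_coord_rV.
Qed.

(** Outside a slightly larger ball the heat flow of a multiple L of the
    indicator of a ball is Gaussian, with a factor that beats any L as soon as
    the time is short on the scale of the gap between the two balls. *)
Lemma heat_ball_tail (L tau a b : R) (g : 'rV[R]_d -> R) y :
  0 <= L -> 0 < tau <= 1 -> 0 < b -> b < a -> b <= 2 ->
  measurable_fun setT g -> (forall z, 0 <= g z <= L) ->
  (forall z, b <= enorm z -> g z = 0) -> a <= enorm y ->
  (heat_semigroup tau g y <=
   (L * 2 `^ (d%:R / 2) * expR (- ((a - b) ^+ 2 / (8 * tau))) *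
    (expR 2^-1 * expR (- (enorm y ^+ 2 / 16))))%:E)%E.
Proof.
move=> L0 /andP[tau0 tau1] b0 ba b2 mg gL gb ay.
set c := L * _ * _ * _.
have c0 : 0 <= c by rewrite !mulr_ge0 ?powR_ge0 ?expR_ge0.
have t20 : 0 < 2 * tau by rewrite mulr_gt0.
rewrite heat_semigroupE -(heatE_cst y t20 c0).
have key z : heat_kernel tau (y - z) * g z <= heat_kernel (2 * tau) (y - z) * c.
  have /andP[gz0 gzL] := gL z.
  have [bz|zb] := leP b (enorm z).
    by rewrite (gb _ bz) mulr0 mulr_ge0 ?heat_kernel_ge0.
  have w1 := enorm_dist_lb b0 ba ay zb.
  have w2 : enorm y ^+ 2 <= 2 * 4 + 2 * enorm (y - z) ^+ 2.
    have := @enorm_sqrD R d z (y - z) 1 ltr01; rewrite addrC subrK invr1.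
    have z4 : enorm z ^+ 2 <= 4.
      have -> : (4 : R) = 2 ^+ 2 by rewrite expr2 -natrM.
      by rewrite ler_pXn2r ?nnegrE ?enorm_ge0// (le_trans (ltW zb)).
    by nra.
  have -> : heat_kernel tau (y - z) = heat_kernel (2 * tau) (y - z) *
      (2 `^ (d%:R / 2) * expR (- (enorm (y - z) ^+ 2 / (4 * tau)))).
    rewrite /heat_kernel [2 * pi * (2 * tau)]mulrCA.
    rewrite (powRM _ _ (ltW (pi2_gt0 tau0)))// mulrACA.
    rewrite [X in _ = X * _]mulrAC -powRD; last by rewrite pnatr_eq0 implybT.
    rewrite addNr powRr0 mul1r -expRD; congr (_ * expR _).
    by field; rewrite gt_eqF.
  have hE : expR (- (enorm (y - z) ^+ 2 / (4 * tau))) <=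
      expR (- ((a - b) ^+ 2 / (8 * tau))) *
      (expR 2^-1 * expR (- (enorm y ^+ 2 / 16))).
    rewrite -!expRD ler_expR.
    set W := enorm (y - z) ^+ 2 in w1 w2 *; set D := (a - b) ^+ 2 in w1 *.
    have -> : W / (4 * tau) = 2 * W * (8 * tau)^-1 by field; rewrite gt_eqF.
    have q8 : 8^-1 <= (8 * tau)^-1.
      by rewrite lef_pV2 ?posrE ?mulr_gt0// ger_pMr.
    set q := (8 * tau)^-1 in q8 *.
    have W0 : 0 <= W by exact: sqr_ge0.
    have q0 : 0 <= q by rewrite (le_trans _ q8)// invr_ge0.
    have h1 : 0 <= q * (W - D) by rewrite mulr_ge0// subr_ge0.
    have h2 : 0 <= W * (q - 8^-1) by rewrite mulr_ge0// subr_ge0.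
    move: w2 h1 h2; set Y := enorm y ^+ 2; rewrite mulrBr mulrBr; lra.
  rewrite -mulrA ler_wpM2l ?heat_kernel_ge0//.
  have -> : c = 2 `^ (d%:R / 2) * (expR (- ((a - b) ^+ 2 / (8 * tau))) *
      (expR 2^-1 * expR (- (enorm y ^+ 2 / 16)))) * L by rewrite /c; ring.
  rewrite ler_pM ?mulr_ge0 ?powR_ge0 ?expR_ge0//.
  by rewrite ler_wpM2l ?powR_ge0.
apply: ge0_le_integral => //.
- move=> z _; have /andP[gz0 _] := gL z.
  by rewrite -EFinM lee_fin mulr_ge0 ?heat_kernel_ge0.
- by apply: measurable_heatE_integrand; exact/measurable_EFinP.
- exact: measurable_heatE_integrand.
- by move=> z _; rewrite -!EFinM lee_fin.
Qed.

Lemma powR_expRN_le (p q N : R) (m : nat) : 0 < q -> p <= m.+1%:R -> 1 <= N ->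
  N `^ p * expR (- (q * N)) <= (m.+1%:R / q) ^+ m.+1.
Proof.
move=> q0 pm N1; have N0 : 0 < N by exact: lt_le_trans N1.
have m0 : 0 < m.+1%:R :> R by rewrite ltr0n.
apply: (@le_trans _ _ (N ^+ m.+1 * expR (- (q * N)))).
  rewrite ler_wpM2r ?expR_ge0// -powR_mulrn ?(ltW N0)//.
  by rewrite ler_powR.
rewrite expRN ler_pdivrMr ?expR_gt0//.
have -> : expR (q * N) = expR (q * N / m.+1%:R) ^+ m.+1.
  by rewrite -expRM_natl [_%:R * _]mulrC divfK// gt_eqF.
rewrite -exprMn ler_pXn2r ?nnegrE ?mulr_ge0 ?divr_ge0 ?expR_ge0 ?(ltW N0) ?(ltW q0)//.
have h := expR_ge1Dx (q * N / m.+1%:R).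
have -> : N = m.+1%:R / q * (q * N / m.+1%:R).
  by field; rewrite gt_eqF//= gt_eqF.
rewrite ler_wpM2l ?divr_ge0 ?(ltW q0)//.
have -> : q * (m.+1%:R / q * (q * N / m.+1%:R)) / m.+1%:R = q * N / m.+1%:R.
  by field; rewrite gt_eqF//= gt_eqF.
- by apply: le_trans h; rewrite lerDr.
- by rewrite invr_ge0 ltW.
Qed.

End gaussian_tail.

Section localization.
Context {R : realType} {d : nat} (beta : R)
    {dW : measure_display} {W : measurableType dW}
    (xi : R -> W -> measures R d) (P : measures R d -> probability W R)
    {dV : measure_display} {V : measurableType dV}
    (eta : R -> V -> measures R d) (Q : R.-pker 'rV[R]_d ~> V)
    (beta01 : 0 < beta <= 1)
    (hX : superprocess xi P beta) (hC : cluster_family xi P eta Q beta).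
Implicit Types (s t : R) (x y : 'rV[R]_d) (f g : 'rV[R]_d -> R).
Local Notation cum := (cumulant beta eta Q).
Local Notation hit := (hitting_exponent beta eta Q).

Let beta0 : 0 < beta. Proof. by case/andP: beta01. Qed.

(* Dyadic schedule: time steps 15 * 16^-k, which sum to 1, and radii decreasing
   from 2 to 1 by steps 2^-k, far longer than the square roots of the times. *)
Let tau (k : nat) : R := 15 * 16^-1 ^+ k.
Let rad (k : nat) : R := 1 + 2^-1 ^+ k.
Let level (k : nat) : R := cluster_rate beta (tau k.+1).

Let pow16 k : 0 < (16^-1 : R) ^+ k <= 1.
Proof. by rewrite exprn_gt0//= exprn_ile1// invf_le1// ler1n. Qed.

Let pow2 k : 0 < (2^-1 : R) ^+ k <= 1.
Proof. by rewrite exprn_gt0//= exprn_ile1// invf_le1// ler1n. Qed.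

Let tau_gt0 k : 0 < tau k.
Proof. by rewrite mulr_gt0// exprn_gt0. Qed.

Let level_gt0 k : 0 < level k.
Proof. exact: (cluster_rate_gt0 beta01). Qed.

Let levelE k : level k = (beta * 15 / 16) `^ (- beta^-1) * (4 ^+ k) `^ (2 / beta).
Proof.
rewrite /level /cluster_rate /tau exprS.
have -> : beta * (15 * (16^-1 * 16^-1 ^+ k)) =
    (beta * 15 / 16) * ((4 ^+ k) ^+ 2)^-1.
  rewrite -exprM mulnC exprM exprVn.
  have -> : (4 : R) ^+ 2 = 16 by rewrite expr2 -natrM.
  by rewrite !mulrA.
have h4 : 0 < (4 : R) ^+ k by rewrite exprn_gt0.
rewrite powRM ?invr_ge0 ?exprn_ge0 ?divr_ge0 ?mulr_ge0 ?(ltW beta0)//.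
congr (_ * _).
move: h4; set N := (4 : R) ^+ k => N0.
rewrite -(powR_inv1 (ltW (exprn_gt0 2 N0))) -(powR_mulrn 2 (ltW N0)) -!powRrM.
by congr (_ `^ _); field; rewrite gt_eqF.
Qed.

(* The level grows like a power of 4^k, the leak decays exponentially in 4^k. *)
Let level_tail : exists2 A : R, 0 < A & forall k,
  level k * expR (- (4 ^+ k / 120)) <= A * 2^-1 ^+ k.
Proof.
have [m hm] : exists m : nat, 2 / beta + 1 <= m.+1%:R.
  exists (Num.truncn (2 / beta + 1)).
  by rewrite ltW// truncnS_gt// addr_ge0// divr_ge0// ltW.
set c := (beta * 15 / 16) `^ (- beta^-1).
have c0 : 0 < c by rewrite powR_gt0// divr_gt0// mulr_gt0.
exists (c * (m.+1%:R / 120^-1) ^+ m.+1) => [|k].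
  by rewrite mulr_gt0// exprn_gt0// divr_gt0// ltr0n.
rewrite levelE -/c -!mulrA ler_wpM2l ?(ltW c0)//.
set N := (4 : R) ^+ k.
have N1 : 1 <= N by rewrite exprn_ege1// ler1n.
have N0 : 0 < N by exact: lt_le_trans N1.
have N2 : (2^-1 : R) ^+ k * (2 ^+ k) = 1 by rewrite -exprMn mulVf// expr1n.
have N2N : 2 ^+ k <= N by rewrite lerXn2r ?nnegrE// ler_nat.
set E := expR _.
have -> : N `^ (2 / beta) * E = N `^ (2 / beta) * E * 2 ^+ k * 2^-1 ^+ k.
  by rewrite -[in RHS]mulrA [2 ^+ k * _]mulrC N2 mulr1.
rewrite ler_wpM2r ?exprn_ge0//.
have h := @powR_expRN_le R (2 / beta + 1) 120^-1 N m _ hm N1.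
apply: le_trans (h _); last by rewrite invr_gt0.
rewrite powRD ?powRr1 ?(ltW N0)//; last by rewrite (gt_eqF N0) implybT.
rewrite [120^-1 * _]mulrC -/E mulrAC.
by rewrite ler_wpM2r ?expR_ge0// ler_wpM2l ?powR_ge0.
Qed.

(* Variances of the accumulated Gaussian: each time step adds tau, and they
   stay between 8 and 9. *)
Let kap (k : nat) : R := 8 + 16^-1 ^+ k.

Let kap_bounds k : 8 < kap k <= 9.
Proof.
by have := pow16 k; rewrite /kap; lra.
Qed.

Let kap_gt0 k : 0 < kap k.
Proof. by have /andP[h _] := kap_bounds k; exact: lt_trans h. Qed.

Let kap_tau k : tau k.+1 + kap k.+1 = kap k.
Proof. by rewrite /kap /tau exprS; field. Qed.

Let tau_le1 k : tau k.+1 <= 1.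
Proof.
by have := pow16 k; rewrite /tau exprS; lra.
Qed.

Let gauss (t : R) := heat_kernel t : 'rV[R]_d -> R.

Let gauss_bounded t : 0 < t -> exists M, forall y, gauss t y <= M.
Proof. by move=> t0; eexists => y; exact: heat_kernel_le_max. Qed.

Let expR_gauss k y :
  expR (- (enorm y ^+ 2 / 16)) <= (2 * pi * 9) `^ (d%:R / 2) * gauss (kap k) y.
Proof.
have /andP[k8 k9] := kap_bounds k.
have p0 := pi2_gt0 (kap_gt0 k).
rewrite /gauss /heat_kernel mulrA -[leLHS]mul1r ler_pM// ?expR_ge0//.
  rewrite powRN ler_pdivlMr ?powR_gt0// mul1r.
  rewrite ge0_ler_powR ?nnegrE ?divr_ge0 ?(ltW p0)//.
    by rewrite !mulr_ge0 ?pi_ge0.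
  by rewrite ler_wpM2l// mulr_ge0 ?pi_ge0.
rewrite ler_expR lerN2 ler_wpM2l ?sqr_ge0// lef_pV2 ?posrE ?mulr_gt0//.
by rewrite (_ : 16 = 2 * 8) ?ler_wpM2l ?(ltW k8)// -natrM.
Qed.

Let heat_gauss s t (E : R) y : 0 < s -> 0 < t -> 0 <= E ->
  heat_semigroup s (fun z => E * gauss t z) y = (E * gauss (s + t) y)%:E.
Proof.
move=> s0 t0 E0; rewrite heat_semigroupE.
rewrite (_ : (fun _ => _) = fun z => (E%:E * (gauss t z)%:E)%E)//.
rewrite heatEZ//.
- by rewrite /gauss heatE_heat_kernel.
- by apply/measurable_EFinP; exact: measurable_heat_kernelx.
- by move=> z; rewrite lee_fin heat_kernel_ge0.
Qed.

Let measurable_gauss t (E : R) : measurable_fun setT (fun z => E * gauss t z).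
Proof. by apply: measurable_funM => //; exact: measurable_heat_kernelx. Qed.

Let gauss_ge0 t (E : R) y : 0 <= E -> 0 <= E * gauss t y.
Proof. by move=> E0; rewrite mulr_ge0// heat_kernel_ge0. Qed.

Let Egauss_bounded t (E : R) : 0 < t -> 0 <= E ->
  exists M, forall y, E * gauss t y <= M.
Proof.
by move=> t0 E0; have [M hM] := gauss_bounded t0; exists (E * M) => y; rewrite ler_wpM2l.
Qed.

(* The heat flow dominates the cumulants and preserves Gaussians. *)
Let cum_gauss s t (E : R) g y : 0 < s -> 0 < t -> 0 <= E ->
  measurable_fun setT g -> (forall z, 0 <= g z) ->
  (forall z, g z <= E * gauss t z) ->
  cum s g y <= E * gauss (s + t) y.
Proof.
move=> s0 t0 E0 mg g0 gE; rewrite -lee_fin -heat_gauss//.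
apply: (@le_trans _ _ (cum s (fun z => E * gauss t z) y)%:E).
  by rewrite lee_fin; apply: (le_cumulant beta01 hC).
apply: (cumulant_le_heat hX hC) => //; first by move=> z; exact: gauss_ge0.
exact: Egauss_bounded.
Qed.

(* One step of the schedule. Subadditivity treats separately the indicator,
   whose level drops inside the ball by the bound on cumulants and whose leak
   outside is the Gaussian tail above, and the Gaussian accumulated so far. *)
Let step : exists2 C : R, 0 < C & forall k g (E : R),
  measurable_fun setT g -> (forall y, 0 <= g y) -> 0 <= E ->
  (forall y, g y <= level k.+1 * \1_(eball 0 (rad k.+1)) y + E * gauss (kap k.+1) y) ->
  forall y, cum (tau k.+1) g y <=
    level k * \1_(eball 0 (rad k)) y + (E + C * 2^-1 ^+ k.+1) * gauss (kap k) y.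
Proof.
have [A A0 hA] := level_tail.
pose G := (2 * pi * 9 : R) `^ (d%:R / 2).
have G0 : 0 < G by rewrite powR_gt0// !mulr_gt0// pi_gt0.
pose C := 2 `^ (d%:R / 2) * expR 2^-1 * G * A.
exists C => [|k g E mg g0 E0 gE y]; first by rewrite !mulr_gt0// ?powR_gt0 ?expR_gt0.
have tk := tau_gt0 k.+1.
pose g1 (z : 'rV[R]_d) : R := level k.+1 * \1_(eball 0 (rad k.+1)) z.
have mg1 : measurable_fun setT g1.
  by apply: measurable_funM => //; apply: measurable_indic; exact: measurable_eball.
have g10 z : 0 <= g1 z <= level k.+1.
  rewrite /g1 indicE; case: (_ \in _); rewrite ?mulr1 ?mulr0 ?lexx ?(ltW (level_gt0 _))//.
have g1b : exists M, forall z, g1 z <= M.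
  by exists (level k.+1) => z; have /andP[] := g10 z.
have g1_ge0 z : 0 <= g1 z by have /andP[] := g10 z.
pose g2 (z : 'rV[R]_d) := E * gauss (kap k.+1) z.
have mg2 : measurable_fun setT g2 by exact: measurable_gauss.
have g20 z : 0 <= g2 z by exact: gauss_ge0.
apply: (@le_trans _ _ (cum (tau k.+1) g1 y + cum (tau k.+1) g2 y)).
  apply: le_trans (cumulant_subadditive beta01 hC tk y mg1 mg2 g1_ge0 g20).
  by apply: (le_cumulant beta01 hC) => //; exact: measurable_funD.
have h2 : cum (tau k.+1) g2 y <= E * gauss (kap k) y.
  by rewrite -kap_tau; apply: cum_gauss.
have /andP[_ r1] := pow2 k.
have r0 : 0 < 2^-1 ^+ k.+1 :> R by rewrite exprn_gt0.
have rS : 2^-1 ^+ k = 2 * 2^-1 ^+ k.+1 :> R by rewrite exprS mulVKf.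
have h1 : cum (tau k.+1) g1 y <= level k * \1_(eball 0 (rad k)) y +
    C * 2^-1 ^+ k.+1 * gauss (kap k) y.
  have C20 : 0 <= C * 2^-1 ^+ k.+1 * gauss (kap k) y.
    by apply: gauss_ge0; rewrite !mulr_ge0 ?powR_ge0 ?expR_ge0 ?(ltW r0) ?(ltW A0) ?(ltW G0).
  rewrite indicE; case: (boolP (y \in _)) => [yB|].
    by rewrite mulr1 ler_wpDr// (cumulant_le_rate beta01 hC).
  rewrite notin_setE /eball /= subr0 => /negP; rewrite -leNgt => yB.
  rewrite mulr0 add0r -lee_fin.
  apply: le_trans (cumulant_le_heat hX hC y tk mg1 g1_ge0 g1b) _.
  have rr : rad k.+1 < rad k by rewrite /rad ltrD2l rS; lra.
  have rp : 0 < rad k.+1 by rewrite /rad addr_gt0.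
  have r2 : rad k.+1 <= 2 by rewrite /rad; lra.
  have tb : 0 < tau k.+1 <= 1 by rewrite tk tau_le1.
  have gb z : rad k.+1 <= enorm z -> g1 z = 0.
    move=> hz; rewrite /g1 indicE memNset ?mulr0// /eball /= subr0 => h.
    by move: hz; rewrite leNgt h.
  apply: le_trans (heat_ball_tail (ltW (level_gt0 _)) tb rp rr r2 mg1 g10 gb yB) _.
  rewrite lee_fin.
  have -> : (rad k - rad k.+1) ^+ 2 / (8 * tau k.+1) = 4 ^+ k.+1 / 120.
    have -> : rad k - rad k.+1 = 2^-1 ^+ k.+1 by rewrite /rad rS; ring.
    rewrite /tau -exprM mulnC exprM.
    have -> : (2^-1 : R) ^+ 2 = 4^-1 by rewrite expr2 -invfM -natrM.
    have -> : (16^-1 : R) = 4^-1 * 4^-1 by rewrite -invfM -natrM.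
    by rewrite exprMn !exprVn; field; rewrite expf_neq0.
  have := hA k.+1; set e1 := expR _; set L := level k.+1; set h := 2^-1 ^+ k.+1 => hL.
  have hG := expR_gauss k y; rewrite -/G in hG.
  have -> : L * 2 `^ (d%:R / 2) * e1 * (expR 2^-1 * expR (- (enorm y ^+ 2 / 16))) =
    (2 `^ (d%:R / 2) * expR 2^-1) * ((L * e1) * expR (- (enorm y ^+ 2 / 16))) by ring.
  have -> : C * h * gauss (kap k) y =
    (2 `^ (d%:R / 2) * expR 2^-1) * ((A * h) * (G * gauss (kap k) y)) by rewrite /C; ring.
  rewrite ler_wpM2l ?mulr_ge0 ?powR_ge0 ?expR_ge0// ler_pM ?expR_ge0//.
  by rewrite mulr_ge0 ?expR_ge0// ltW// level_gt0.
have := lerD h1 h2; rewrite mulrDl; lra.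
Qed.

(* The k steps back to stage 0: the total time is 1 - 16^-k and the leaks sum
   to C (1 - 2^-k). *)
Let iterate : exists2 C : R, 0 < C & forall k g (E : R),
  measurable_fun setT g -> (forall y, 0 <= g y) -> 0 <= E ->
  (exists M, forall y, g y <= M) ->
  (forall y, g y <= level k * \1_(eball 0 (rad k)) y + E * gauss (kap k) y) ->
  forall y, cum (1 - 16^-1 ^+ k) g y <=
    level 0 * \1_(eball 0 (rad 0)) y + (E + C * (1 - 2^-1 ^+ k)) * gauss (kap 0) y.
Proof.
have [C C0 hC'] := step; exists C => // k.
elim: k => [|k IHk] g E mg g0 E0 gM gE y.
  by rewrite !expr0 !subrr mulr0 addr0 /cumulant ltxx.
have e16 : 1 - 16^-1 ^+ k.+1 = tau k.+1 + (1 - 16^-1 ^+ k) :> R.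
  by rewrite /tau exprS; field.
have q0 : 0 <= 1 - 16^-1 ^+ k :> R by have := pow16 k; lra.
rewrite e16 (cumulant_flow beta01 hX hC)//.
have -> : E + C * (1 - 2^-1 ^+ k.+1) =
    E + C * 2^-1 ^+ k.+1 + C * (1 - 2^-1 ^+ k) by rewrite exprS; field.
apply: IHk.
- by apply: (measurable_cumulant hX hC) => //; exact: ltW.
- by move=> z; exact: (cumulant_ge0 eta Q beta01).
- by rewrite addr_ge0// mulr_ge0 ?exprn_ge0// ltW.
- by exists (cluster_rate beta (tau k.+1)) => z; exact: (cumulant_le_rate beta01 hC).
- exact: hC'.
Qed.

Let level_unbounded (m : nat) : exists k, m%:R <= level k.
Proof.
pose c := (beta * 15 / 16) `^ (- beta^-1).
have c0 : 0 < c by rewrite powR_gt0// divr_gt0// mulr_gt0.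
exists (Num.truncn (m%:R / c)).+1.
set k := (Num.truncn (m%:R / c)).+1.
rewrite levelE -/c mulrC -ler_pdivrMr//.
have mk : m%:R / c <= k%:R by rewrite ltW// truncnS_gt// divr_ge0// ltW.
apply: (le_trans mk).
have k4 : k%:R <= 4 ^+ k :> R.
  by rewrite -natrX ler_nat ltnW// ltn_expl.
apply: (le_trans k4).
have N1 : 1 <= (4 : R) ^+ k by rewrite exprn_ege1// ler1n.
rewrite -[leLHS]powRr1; last by rewrite exprn_ge0.
rewrite ler_powR// ler_pdivlMr// mul1r.
by have /andP[_ b1] := beta01; rewrite (le_trans b1)// ler1n.
Qed.

(** The localization estimate: although the initial data n 1_B, with B the
    unit ball, have no common bound, at time 1 the cumulants lie below one
    Gaussian. *)
Lemma hitting_exponent_gaussian : exists2 C : R, 0 < C &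
  forall y, hit 1 (eball 0 1) y <= C * heat_kernel 10 y.
Proof.
have [C C0 hC'] := iterate.
pose G := (2 * pi * 9 : R) `^ (d%:R / 2).
have G0 : 0 < G by rewrite powR_gt0// !mulr_gt0// pi_gt0.
pose C1 := level 0 * (expR 4^-1 * G) + C.
have C10 : 0 < C1 by rewrite addr_gt0// !mulr_gt0// expR_gt0.
pose C2 := (10 / 9 : R) `^ (d%:R / 2) * C1.
exists C2 => [|y]; first by rewrite mulr_gt0 ?powR_gt0.
have mB : measurable (eball (0 : 'rV[R]_d) 1) by exact: measurable_eball.
have bound (n : nat) : cum 1 (fun z => n%:R * \1_(eball 0 1) z) y <= C2 * gauss 10 y.
  have [k nk] := level_unbounded n.
  pose f (z : 'rV[R]_d) : R := n%:R * \1_(eball 0 1) z.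
  have mf : measurable_fun setT f.
    by apply: measurable_funM => //; exact: measurable_indic.
  have f0 z : 0 <= f z by rewrite mulr_ge0// indicE.
  have fM : exists M, forall z, f z <= M.
    by exists n%:R => z; rewrite /f ler_piMr// indicE; case: (_ \in _).
  have p16 : 0 < 16^-1 ^+ k :> R by rewrite exprn_gt0.
  have h0 : forall z, f z <= level k * \1_(eball 0 (rad k)) z + 0 * gauss (kap k) z.
    move=> z; rewrite mul0r addr0 /f ler_pM// ?indicE// ler_nat.
    case: (boolP (z \in eball 0 1)) => // /set_mem; rewrite /eball /= => h.
    rewrite mem_set//= /rad; apply: lt_trans h _.
    by rewrite ltrDl exprn_gt0.
  have h1 := hC' k f 0 mf f0 (lexx 0) fM h0.
  have q0 : 0 <= 1 - 16^-1 ^+ k :> R by have := pow16 k; lra.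
  have h2 z : cum (1 - 16^-1 ^+ k) f z <= C1 * gauss 9 z.
    apply: (le_trans (h1 z)); rewrite add0r.
    have k09 : kap 0 = 9 by rewrite /kap expr0; ring.
    have gz0 : 0 <= gauss 9 z by exact: heat_kernel_ge0.
    rewrite k09 /C1 mulrDl lerD//; last first.
      by rewrite ler_wpM2r// ler_piMr ?(ltW C0)// lerBlDr lerDl exprn_ge0.
    rewrite indicE; case: (boolP (z \in _)) => [/set_mem|_]; last first.
      rewrite mulr0; apply: mulr_ge0 => //.
      by apply: mulr_ge0; rewrite ?(ltW (level_gt0 0)) ?mulr_ge0 ?expR_ge0 ?(ltW G0).
    rewrite /eball /= subr0 /rad expr0 => z2.
    rewrite mulr1 -mulrA ler_peMr ?(ltW (level_gt0 0))//.
    have := expR_gauss 0 z; rewrite k09 -/G -mulrA => hz.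
    apply: le_trans (ler_wpM2l (expR_ge0 _) hz).
    rewrite -expRD -[leLHS]expR0 ler_expR.
    have z4 : enorm z ^+ 2 <= 4.
      have -> : (4 : R) = (1 + 1) ^+ 2 by ring.
      by rewrite ler_pXn2r ?nnegrE ?enorm_ge0// ltW.
    by lra.
  have -> : cum 1 f y = cum (16^-1 ^+ k) (cum (1 - 16^-1 ^+ k) f) y.
    have [->|kn0] := eqVneq k 0%N.
      by rewrite expr0 subrr; congr (cum _ _ _); apply/funext => z; rewrite /cumulant ltxx.
    have q1 : 0 < 1 - 16^-1 ^+ k :> R.
      by rewrite subr_gt0 exprn_ilt1// invf_lt1// ltr1n.
    rewrite -[X in cum X f y](subrK (16^-1 ^+ k) 1).
    exact: (cumulant_flow beta01 hX hC y q1 (ltW p16) mf f0 fM).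
  have h3 : cum (16^-1 ^+ k) (cum (1 - 16^-1 ^+ k) f) y <= C1 * gauss (16^-1 ^+ k + 9) y.
    apply: cum_gauss => //; first exact: ltW.
    - exact: (measurable_cumulant hX hC).
    - move=> z; move: q0; rewrite le_eqVlt => /predU1P[<-|q0].
        by rewrite /cumulant ltxx.
      exact: (cumulant_ge0 eta Q beta01).
  apply: (le_trans h3); rewrite /C2 -mulrA [leRHS]mulrCA; apply: ler_wpM2l; first exact: ltW.
  have s0 : 0 < 16^-1 ^+ k + 9 :> R by rewrite addr_gt0.
  have s10 : 16^-1 ^+ k + 9 <= 10 :> R.
    by have := pow16 k; lra.
  apply: le_trans (heat_kernel_widen y s0 s10) _.
  rewrite ler_wpM2r ?heat_kernel_ge0// ge0_ler_powR ?nnegrE ?divr_ge0 ?(ltW s0)//.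
  by rewrite ler_pM2l// lef_pV2 ?posrE// lerDr ltW.
have h : cum 1 (fun z : 'rV[R]_d => n%:R * \1_(eball 0 1) z) y @[n --> \oo] -->
    hit 1 (eball 0 1) y by exact: (hitting_exponent_indic_cvg hC).
rewrite -(cvg_lim _ h)//; apply: limr_le; first by apply/cvg_ex; eexists; exact: h.
by apply: nearW.
Qed.

(** The semiflow carries the Gaussian bound to all later times. *)
Lemma hitting_exponent_le_gaussian : exists2 C : R, 0 < C &
  forall s y, 1 <= s -> hit s (eball 0 1) y <= C * heat_kernel (9 + s) y.
Proof.
have [C C0 hC'] := hitting_exponent_gaussian; exists C => // s y.
have mB : measurable (eball (0 : 'rV[R]_d) 1) by exact: measurable_eball.
rewrite le_eqVlt => /predU1P[<-|s1].
  by rewrite (_ : 9 + 1 = 10) ?hC'//; ring.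
have s10 : 0 < s - 1 by rewrite subr_gt0.
have sE : s = 1 + (s - 1) by ring.
rewrite [X in hit X _ y]sE (hitting_exponent_flow beta01 hX hC y ltr01 s10 mB).
have -> : 9 + s = (s - 1) + 10 by ring.
apply: cum_gauss => //; first exact: ltW.
- exact: (measurable_hitting_exponent hX hC).
- by move=> z; exact: (hitting_exponent_ge0 eta Q beta01).
Qed.

End localization.

(** * Scaling of hitting exponents *)

Section scaled_exponents.
Context {R : realType} {d : nat} (beta : R)
    {dW : measure_display} {W : measurableType dW}
    (xi : R -> W -> measures R d) (P : measures R d -> probability W R)
    {dV : measure_display} {V : measurableType dV}
    (eta : R -> V -> measures R d) (Q : R.-pker 'rV[R]_d ~> V)
    (beta01 : 0 < beta <= 1)
    (hX : superprocess xi P beta) (hC : cluster_family xi P eta Q beta).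
Implicit Types (s t e : R) (x y z : 'rV[R]_d) (f g : 'rV[R]_d -> R).
Local Notation cum := (cumulant beta eta Q).
Local Notation hit := (hitting_exponent beta eta Q).
Local Notation leb := (@lebesgue_rV R d).

Let beta0 : 0 < beta. Proof. by case/andP: beta01. Qed.

Let mB : measurable (eball (0 : 'rV[R]_d) 1).
Proof. exact: measurable_eball. Qed.

(** The normalization in which the exponents of small balls converge; see
    hitting_exponent_ball. *)
Definition scaled_exponent e t x : R :=
  e ^- d * hit (e ^- 2 * t) (eball 0 1) (e^-1 *: x).
Local Notation phi := scaled_exponent.

Lemma scaled_exponent_ge0 e t x : 0 < e -> 0 < t -> 0 <= phi e t x.
Proof.
move=> e0 t0; rewrite mulr_ge0 ?invr_ge0 ?exprn_ge0 ?(ltW e0)//.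
by rewrite (hitting_exponent_ge0 eta Q beta01)// mulr_gt0// invr_gt0 exprn_gt0.
Qed.

Let measurable_scale (k : R) : measurable_fun setT (fun x : 'rV[R]_d => k *: x).
Proof.
apply: (eq_measurable_fun (fun x : 'rV[R]_d => 0 + k *: x)) => [y _|].
  by rewrite add0r.
exact: measurable_affine_rV.
Qed.

Lemma measurable_scaled_exponent e t : 0 < e -> 0 < t ->
  measurable_fun setT (phi e t).
Proof.
move=> e0 t0; apply: measurable_funM => //.
apply: (measurableT_comp _ (measurable_scale e^-1)).
by apply: (measurable_hitting_exponent hX hC) => //; rewrite mulr_gt0// invr_gt0 exprn_gt0.
Qed.

(** Brownian scaling reduces every ball to the unit ball; it is transferred
    from the cumulants of multiples of the indicator. *)
Lemma hitting_exponent_ball e t x y : 0 < e -> 0 < t ->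
  e `^ (2 / beta - d%:R) * hit t (eball x e) y = phi e t (y - x).
Proof.
move=> e0 t0; pose k := e^-1; have k0 : 0 < k by rewrite invr_gt0.
have kb0 : 0 < k `^ (2 / beta) by rewrite powR_gt0.
have kt0 : 0 < k ^+ 2 * t by rewrite mulr_gt0// exprn_gt0.
have mb : measurable (eball x e) by exact: measurable_eball.
pose f z : R := k `^ (2 / beta) * \1_(eball x e) z.
have f0 z : 0 <= f z by rewrite mulr_ge0 ?(ltW kb0)// indicE.
have mf : measurable_fun setT f.
  by apply: measurable_funM => //; exact: measurable_indic.
have fB z : 0 < f z <-> eball x e z.
  rewrite /f indicE pmulr_rgt0//; split; last by move=> h; rewrite mem_set.
  by case: (boolP (z \in _)) => [/set_mem|]; rewrite ?ltxx.
have h1 : cum t (fun z => n%:R * f z) y @[n --> \oo] --> hit t (eball x e) y.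
  exact: (hitting_exponent_cvg hC).
have E (n : nat) : cum t (fun z => n%:R * f z) y =
    k `^ (2 / beta) * cum (k ^+ 2 * t) (fun z => n%:R * \1_(eball 0 1) z) (k *: (y - x)).
  pose g z : R := n%:R * \1_(eball 0 1) z.
  have mg : measurable_fun setT g.
    by apply: measurable_funM => //; exact: measurable_indic.
  have g0 z : 0 <= g z by rewrite mulr_ge0// indicE.
  have gM : exists M, forall z, g z <= M.
    by exists n%:R => z; rewrite /g ler_piMr// indicE; case: (_ \in _).
  have mc := cumulant_mild hX hC mg g0 gM.
  have := mild_scale beta01 x mc k0.
  have -> : (fun z => k `^ (2 / beta) * g (k *: (z - x))) = (fun z => n%:R * f z).
    apply/funext => z; rewrite /f /g mulrCA; congr (_ * (_ * _)).
    rewrite !indicE; congr ((nat_of_bool _)%:R); apply/idP/idP => /set_mem; rewrite /eball /= ?subr0.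
      rewrite enormZ ?(ltW k0)// => h; rewrite mem_set//=.
      by move: h; rewrite /k mulrC ltr_pdivrMr// mul1r.
    move=> h; rewrite mem_set//= subr0 enormZ ?(ltW k0)//.
    by rewrite /k mulrC ltr_pdivrMr// mul1r.
  move=> mk; apply/esym.
  apply: (cumulant_unique beta01 hX hC y mk _ (ltW t0)).
  have fk z : f z <= k `^ (2 / beta).
    by rewrite /f ler_piMr ?(ltW kb0)// indicE; case: (_ \in _).
  by exists (n%:R * k `^ (2 / beta)) => z; rewrite ler_wpM2l.
have h2 : cum t (fun z => n%:R * f z) y @[n --> \oo] -->
    k `^ (2 / beta) * hit (k ^+ 2 * t) (eball 0 1) (k *: (y - x)).
  under eq_fun do rewrite E.
  apply: cvgM; first exact: cvg_cst.
  exact: (hitting_exponent_indic_cvg hC).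
have -> : hit t (eball x e) y =
    k `^ (2 / beta) * hit (k ^+ 2 * t) (eball 0 1) (k *: (y - x)).
  exact: cvg_unique h1 h2.
rewrite /scaled_exponent -/k -exprVn -/k mulrA; congr (_ * _); last by rewrite /k exprVn.
rewrite /k -(powR_inv1 (ltW e0)) -powRrM -powRD; last by rewrite (gt_eqF e0) implybT.
rewrite mulN1r addrAC subrr add0r powRN powR_mulrn ?(ltW e0)//.
by rewrite powR_inv1 ?(ltW e0)// exprVn.
Qed.

Lemma scaled_exponent_gaussian : exists2 C : R, 0 < C &
  forall e t x, 0 < e -> e ^+ 2 <= t -> phi e t x <= C * heat_kernel (t + 9 * e ^+ 2) x.
Proof.
have [C C0 hC'] := hitting_exponent_le_gaussian beta01 hX hC; exists C => // e t x e0 et.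
have e20 : 0 < e ^+ 2 by rewrite exprn_gt0.
have T1 : 1 <= e ^- 2 * t by rewrite mulrC ler_pdivlMr// mul1r.
have T0 : 0 < 9 + e ^- 2 * t by rewrite addr_gt0// (lt_le_trans ltr01).
rewrite /scaled_exponent.
apply: (@le_trans _ _ (e ^- d * (C * heat_kernel (9 + e ^- 2 * t) (e^-1 *: x)))).
  by rewrite ler_wpM2l ?hC'// invr_ge0 exprn_ge0// ltW.
rewrite mulrCA -heat_kernel_scale// scalerA divff ?gt_eqF// scale1r.
have -> // : e ^+ 2 * (9 + e ^- 2 * t) = t + 9 * e ^+ 2.
by rewrite mulrDr mulrA divff ?gt_eqF// mul1r addrC mulrC.
Qed.

(** For e^2 <= t the variance t + 9 e^2 lies between t and 10 t, and the bound
    no longer depends on e. *)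
Lemma scaled_exponent_bounds : exists2 C : R, 0 < C &
  forall e t x, 0 < e -> e ^+ 2 <= t ->
    phi e t x <= C * heat_kernel (10 * t) x /\
    phi e t x <= C * (2 * pi * t) `^ (- (d%:R / 2)).
Proof.
have [C C0 hC'] := scaled_exponent_gaussian.
pose D : R := 10 `^ (d%:R / 2).
have D1 : 1 <= D.
  by rewrite -(powRr0 10) ler_powR ?divr_ge0// ler1n.
exists (C * D) => [|e t x e0 et]; first by rewrite mulr_gt0 ?powR_gt0.
have e20 : 0 < e ^+ 2 by rewrite exprn_gt0.
have t0 : 0 < t by exact: lt_le_trans et.
have T0 : 0 < t + 9 * e ^+ 2 by rewrite addr_gt0// mulr_gt0.
have T10 : t + 9 * e ^+ 2 <= 10 * t by lra.
have tT : t <= t + 9 * e ^+ 2 by rewrite lerDl mulr_ge0// ltW.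
split; apply: (le_trans (hC' e t x e0 et)); rewrite -mulrA ler_wpM2l ?(ltW C0)//.
  apply: le_trans (heat_kernel_widen x T0 T10) _.
  rewrite ler_wpM2r ?heat_kernel_ge0// ge0_ler_powR ?nnegrE ?divr_ge0 ?(ltW T0)//.
    by rewrite mulr_ge0// ltW.
  by rewrite ler_pdivrMr// ler_pM2l.
apply: le_trans (heat_kernel_le_max x T0) _.
apply: (@le_trans _ _ ((2 * pi * t) `^ (- (d%:R / 2)))); last by rewrite ler_peMl ?powR_ge0.
rewrite !powRN lef_pV2 ?posrE ?powR_gt0 ?pi2_gt0//.
rewrite ge0_ler_powR ?nnegrE ?divr_ge0 ?(ltW (pi2_gt0 _))//.
by rewrite ler_pM2l ?mulr_gt0 ?pi_gt0.
Qed.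

(** The absorption accumulated between the times s and t is negligible in the
    scaling limit because d beta > 2. *)
Lemma scaled_exponent_heat : exists2 C : R, 0 < C &
  forall e s t x, 0 < e -> e ^+ 2 <= s -> s < t ->
  ((phi e t x)%:E <= heat_semigroup (t - s) (phi e s) x)%E /\
  (heat_semigroup (t - s) (phi e s) x <= (phi e t x +
    (t - s) * (C * (2 * pi * s) `^ (- (d%:R / 2))) `^ (1 + beta) *
    e `^ (d%:R * beta - 2))%:E)%E.
Proof.
have [C C0 hC'] := scaled_exponent_bounds; exists C => // e s t x e0 es st.
pose k := e^-1; have k0 : 0 < k by rewrite invr_gt0.
have s0 : 0 < s by apply: lt_le_trans es; rewrite exprn_gt0.
have k2E : e ^- 2 = k ^+ 2 by rewrite exprVn.
have k20 : 0 < k ^+ 2 by rewrite exprn_gt0.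
have ed0 : 0 < e ^- d by rewrite invr_gt0 exprn_gt0.
pose s1 := k ^+ 2 * s; pose t1 := k ^+ 2 * (t - s).
have s10 : 0 < s1 by rewrite mulr_gt0.
have t10 : 0 < t1 by rewrite mulr_gt0// subr_gt0.
have st1 : s1 + t1 = k ^+ 2 * t by rewrite /s1 /t1; ring.
pose u1 := hit s1 (eball 0 1).
have mu1 : measurable_fun setT u1 by exact: (measurable_hitting_exponent hX hC).
have u10 y : 0 <= u1 y by exact: (hitting_exponent_ge0 eta Q beta01).
have u1M : exists M, forall y, u1 y <= M.
  by eexists => y; exact: (hitting_exponent_le_rate beta01 hC y s10 mB).
have mc := cumulant_mild hX hC mu1 u10 u1M.
have eqn := mild_eq (k *: x) mc t10.
have uE r y : 0 < r -> cum r u1 y = hit (s1 + r) (eball 0 1) y.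
  by move=> r0; rewrite (hitting_exponent_flow beta01 hX hC y s10 r0 mB).
have HE : heat_semigroup (t - s) (phi e s) x =
    ((e ^- d)%:E * heat_semigroup t1 u1 (k *: x))%E.
  have -> : phi e s = (fun y => e ^- d * u1 (k *: (y - 0))).
    by apply/funext => y; rewrite /scaled_exponent k2E subr0.
  have ts0 : 0 < t - s by rewrite subr_gt0.
  rewrite !heat_semigroupE -[X in heatE t1 _ (k *: X)]subr0.
  rewrite -(@heatE_scale _ _ (t - s) k 0 x (fun y => (u1 y)%:E))//; last exact/measurable_EFinP.
  rewrite -heatEZ ?(ltW ed0)//.
    apply/measurable_EFinP; apply: (measurableT_comp mu1).
    apply: (eq_measurable_fun (fun y : 'rV[R]_d => k *: y)) => [y _|].
      by rewrite subr0.
    exact: measurable_scale.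
  by move=> y; rewrite lee_fin.
pose K := C * (2 * pi * s) `^ (- (d%:R / 2)).
have K0 : 0 <= K by rewrite mulr_ge0 ?powR_ge0 ?(ltW C0).
pose K1 := e ^+ d * K.
have K10 : 0 <= K1 by rewrite mulr_ge0 ?exprn_ge0 ?(ltW e0).
have cK r y : 0 < r < t1 -> cum r u1 y <= K1.
  move=> /andP[r0 _]; rewrite uE//.
  pose r1 := s + e ^+ 2 * r.
  have e20 : 0 < e ^+ 2 by rewrite exprn_gt0.
  have sr1 : s <= r1 by rewrite lerDl mulr_ge0 ?(ltW e20) ?(ltW r0).
  have [_ h] := hC' e r1 (e *: y) e0 (le_trans es sr1).
  have -> : hit (s1 + r) (eball 0 1) y = e ^+ d * phi e r1 (e *: y).
    rewrite /scaled_exponent mulrA divff ?expf_neq0 ?gt_eqF// mul1r.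
    rewrite scalerA mulVf ?gt_eqF// scale1r; congr (hit _ _ _).
    by rewrite /s1 /r1 /k; field; rewrite gt_eqF.
  rewrite ler_wpM2l ?exprn_ge0 ?(ltW e0)// (le_trans h)// ler_wpM2l ?(ltW C0)//.
  have r10 : 0 < r1 by exact: lt_le_trans sr1.
  rewrite !powRN lef_pV2 ?posrE ?powR_gt0 ?pi2_gt0//.
  rewrite ge0_ler_powR ?nnegrE ?divr_ge0 ?(ltW (pi2_gt0 _))//.
  by rewrite ler_pM2l ?mulr_gt0 ?pi_gt0.
have D1 := duhamel_le_cst beta01 (k *: x) (mild_spacetime mc) t10 K10 cK.
have D0 := duhamel_ge0 t1 (k *: x) (spacetime_absorption beta (mild_spacetime mc)).
have phiE : phi e t x = e ^- d * cum t1 u1 (k *: x).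
  by rewrite uE// st1 /scaled_exponent k2E.
rewrite HE -eqn phiE.
move: D0 D1; case: (duhamel _ _ _) => [D||]//; rewrite !lee_fin => D0 D1.
split.
  by rewrite ler_wpM2l ?(ltW ed0)// lerDl.
rewrite mulrDr lerD2l.
apply: (le_trans (ler_wpM2l (ltW ed0) D1)).
rewrite le_eqVlt; apply/orP; left; apply/eqP.
rewrite /K1 powRM ?exprn_ge0 ?(ltW e0)// -/K.
rewrite -powR_mulrn ?(ltW e0)// -powRrM /t1 /k.
have -> : e^-1 ^+ 2 = e `^ (- 2).
  by rewrite powRN powR_mulrn ?(ltW e0)// exprVn.
have ee a b : e `^ (a + b) = e `^ a * e `^ b.
  by rewrite powRD// (gt_eqF e0) implybT.
have -> : d%:R * beta - 2 = - d%:R + (- 2 + d%:R * (1 + beta)) :> R by ring.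
rewrite !ee [e `^ (- d%:R)]powRN powR_mulrn ?(ltW e0)//.
set p := K `^ _; set q := e `^ (- 2); set r := e `^ (_ * _); ring.
Qed.

End scaled_exponents.

(** * The scaling limit *)

Section scaling_limit.
Context {R : realType} {d : nat} (beta c : R)
    {dW : measure_display} {W : measurableType dW}
    (xi : R -> W -> measures R d) (P : measures R d -> probability W R)
    {dV : measure_display} {V : measurableType dV}
    (eta : R -> V -> measures R d) (Q : R.-pker 'rV[R]_d ~> V)
    (beta01 : 0 < beta <= 1) (beta_d : 2 / beta < d%:R)
    (hX : superprocess xi P beta) (hC : cluster_family xi P eta Q beta)
    (hc : hitting_constant d beta c).
Implicit Types (s t e : R) (x y z : 'rV[R]_d) (f g : 'rV[R]_d -> R).
Local Notation cum := (cumulant beta eta Q).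
Local Notation hit := (hitting_exponent beta eta Q).
Local Notation phi := (scaled_exponent beta eta Q).
Local Notation leb := (@lebesgue_rV R d).

Let beta0 : 0 < beta. Proof. by case/andP: beta01. Qed.

Let c0 : 0 < c. Proof. by case: hc. Qed.

(** The solutions that define the constant are cumulants, by uniqueness, so
    their increasing limit is the hitting exponent of the unit ball. *)
Lemma scaled_exponent_cvg t x : 0 < t ->
  phi e t x @[e --> 0^'+] --> c * heat_kernel t x.
Proof.
move=> t0; case: hc => _ [f [v [vinf [_ f01 fout mv [vlim lim]]]]].
have mB : measurable (eball (0 : 'rV[R]_d) 1) by exact: measurable_eball.
have f0 y : 0 <= f y.
  have [/f01 /andP[/ltW]//|/fout ->//] := pselect (eball 0 1 y).
have f1 y : f y <= 1.
  have [/f01 /andP[]//|/fout ->//] := pselect (eball 0 1 y).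
have fB y : 0 < f y <-> eball 0 1 y.
  split=> [fy|/f01 /andP[]//]; apply: contrapT => /fout fy0.
  by move: fy; rewrite fy0 ltxx.
have mf : measurable_fun setT f.
  have := mild_measurable (mv 1 ltr01).
  by apply: eq_measurable_fun => y _; rewrite mul1r.
have vE s y : 0 < s -> vinf s y = hit s (eball 0 1) y.
  move=> s0; have h1 := @hitting_exponent_cvg _ _ _ _ _ _ _ _ _ _ _ hC s f _ y s0 mf mB f0 fB.
  have h2 : cum s (fun z => n%:R * f z) y @[n --> \oo] --> vinf s y.
    have h : v n%:R s y @[n --> \oo] --> vinf s y.
      exact: (cvg_comp _ (fun l => v l s y) (@cvgr_idn R) (vlim s y s0)).
    apply: cvg_trans h; apply: near_eq_cvg; near=> n.
    have n0 : 0 < n%:R :> R by rewrite ltr0n; near: n; exists 1%N.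
    apply: (cumulant_unique beta01 hX hC y (mv n%:R n0) _ (ltW s0)).
    by exists n%:R => z; rewrite ler_piMr// ltW.
  exact: cvg_unique h2 h1.
apply: cvg_trans (lim t x t0); apply: near_eq_cvg; near=> e.
have e0 : 0 < e by [].
by rewrite /scaled_exponent vE// mulr_gt0// invr_gt0 exprn_gt0.
Unshelve. all: by end_near. Qed.

Let L1 s e := (\int[leb]_y `|phi e s y - c * heat_kernel s y|%:E)%E.

Let mheat s : measurable_fun setT (fun y : 'rV[R]_d => c * heat_kernel s y).
Proof. by apply: measurable_funM => //; exact: measurable_heat_kernelx. Qed.

(** Dominated convergence. *)
Lemma scaled_exponent_cvg_L1 s : 0 < s -> L1 s e @[e --> 0^'+] --> 0%:E.
Proof.
move=> s0; have [C C0 hC'] := scaled_exponent_bounds beta01 hX hC.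
pose r0 : R := Num.sqrt s; have r00 : 0 < r0 by rewrite sqrtr_gt0.
(* The domination holds for e^2 <= s only, hence the cap on e. *)
have h : L1 s (Num.min e r0) @[e --> 0^'+] --> 0%:E.
  apply/cvge_at_rightP => u [u0 ucvg].
  pose u' n := Num.min (u n) r0.
  have u'0 n : 0 < u' n by rewrite lt_min u0.
  have u's n : u' n ^+ 2 <= s.
    rewrite -[leRHS](sqr_sqrtr (ltW s0)) ler_pXn2r ?nnegrE ?(ltW (u'0 n))//.
    by rewrite ge_min lexx orbT.
  have u'cvg : u' n @[n --> \oo] --> (0 : R).
    apply: (@squeeze_cvgr _ _ _ _ (fun=> 0) u); last 2 first.
    - exact: cvg_cst.
    - exact: ucvg.
    by apply: nearW => n; rewrite (ltW (u'0 n))/= ge_min lexx.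
  have [] := @dominated_convergence _ _ _ leb setT measurableT
    (fun n y => (phi (u' n) s y)%:E) (fun y => (c * heat_kernel s y)%:E)
    (fun y => (C * heat_kernel (10 * s) y)%:E).
  - move=> n; apply/measurable_EFinP.
    exact: (measurable_scaled_exponent hX hC (u'0 n) s0).
  - (apply/measurable_EFinP; exact: mheat).
  - apply: aeW => y _; apply: cvg_EFin; first exact: nearW.
    have /cvg_at_rightP := @scaled_exponent_cvg s y s0.
    by move=> /(_ u' (conj u'0 u'cvg)).
  - apply/integrableP; split.
      by apply/measurable_EFinP/measurable_funM => //; exact: measurable_heat_kernelx.
    have E : forall y : 'rV[R]_d, (`|(C * heat_kernel (10 * s) y)%:E| =
        C%:E * (heat_kernel (10 * s) (y - 0))%:E)%E.
      by move=> y; rewrite subr0 gee0_abs// lee_fin mulr_ge0 ?heat_kernel_ge0 ?ltW.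
    under eq_integral do rewrite E heat_kernelBC.
    rewrite ge0_integralZl_EFin ?(ltW C0)//; last 2 first.
    - by move=> y _; rewrite lee_fin heat_kernel_ge0.
    - by apply/measurable_EFinP; exact: measurable_heat_kernelB.
    by rewrite integral_heat_kernel ?mule1 ?ltry// mulr_gt0.
  - apply: aeW => y n _; rewrite gee0_abs.
      by rewrite lee_fin; have [] := hC' (u' n) s y (u'0 n) (u's n).
    by rewrite lee_fin (scaled_exponent_ge0 eta Q beta01).
  move=> _ + _; apply: cvg_trans; apply: near_eq_cvg; near=> n.
  by apply: eq_integral => y _; rewrite -EFinB abse_EFin.
apply: cvg_trans h; apply: near_eq_cvg; near=> e.
have er : e <= r0 by near: e; exact: nbhs_right_le.
by rewrite min_l.
Unshelve. all: by end_near. Qed.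

(* A bounded kernel turns L1 distance at time s into uniform distance at
   time t. *)
Let smoothing s t e x : 0 < s -> s < t -> 0 < e -> e ^+ 2 <= s -> forall l : R,
  (L1 s e <= l%:E)%E ->
  (heat_semigroup (t - s) (phi e s) x <= (c * heat_kernel t x +
    (2 * pi * (t - s)) `^ (- (d%:R / 2)) * l)%:E)%E /\
  ((c * heat_kernel t x)%:E <= heat_semigroup (t - s) (phi e s) x +
    ((2 * pi * (t - s)) `^ (- (d%:R / 2)) * l)%:E)%E.
Proof.
move=> s0 st e0 es l hl; have ts0 : 0 < t - s by rewrite subr_gt0.
pose w y := `|phi e s y - c * heat_kernel s y|.
have mphi : measurable_fun setT (phi e s) by exact: (measurable_scaled_exponent hX hC).
have mw : measurable_fun setT w.
  by apply: measurableT_comp => //; exact: measurable_funB.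
have w0 y : 0 <= w y by exact: normr_ge0.
have phi0 y : 0 <= phi e s y by exact: (scaled_exponent_ge0 eta Q beta01).
have ch0 y : 0 <= c * heat_kernel s y by rewrite mulr_ge0 ?heat_kernel_ge0 ?ltW.
have hw : (heatE (t - s) (fun y => (w y)%:E) x <=
    ((2 * pi * (t - s)) `^ (- (d%:R / 2)) * l)%:E)%E.
  apply: (@le_trans _ _ (\int[leb]_y (((2 * pi * (t - s)) `^ (- (d%:R / 2)))%:E * (w y)%:E))%E).
    apply: ge0_le_integral => //.
    - by move=> y _; rewrite -EFinM lee_fin mulr_ge0 ?heat_kernel_ge0.
    - by apply: measurable_heatE_integrand; exact/measurable_EFinP.
    - by apply: measurable_funeM; exact/measurable_EFinP.
    - by move=> y _; rewrite -!EFinM lee_fin ler_wpM2r// heat_kernel_le_max.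
  rewrite ge0_integralZl_EFin ?powR_ge0//; last 2 first.
  - by move=> y _; rewrite lee_fin.
  - exact/measurable_EFinP.
  by rewrite EFinM lee_wpmul2l// lee_fin powR_ge0.
have hh : heatE (t - s) (fun y => (c * heat_kernel s y)%:E) x = (c * heat_kernel t x)%:E.
  rewrite (_ : (fun _ => _) = fun y => (c%:E * (heat_kernel s y)%:E)%E)//.
  rewrite heatEZ ?(ltW c0)//.
  - by rewrite heatE_heat_kernel// subrK.
  - by apply/measurable_EFinP; exact: measurable_heat_kernelx.
  - by move=> y; rewrite lee_fin heat_kernel_ge0.
split.
- rewrite EFinD -hh heat_semigroupE; apply: le_trans (leeD2l _ hw).
  rewrite -heatED//; last 2 first.
  + (apply/measurable_EFinP; exact: mheat).
  + exact/measurable_EFinP.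
  apply: le_heatE.
  + exact/measurable_EFinP.
  + by apply: emeasurable_funD; [(apply/measurable_EFinP; exact: mheat)|exact/measurable_EFinP].
  + by move=> y; rewrite lee_fin.
  + move=> y; rewrite -EFinD lee_fin addrC -lerBlDr.
    exact: ler_norm.
- rewrite -hh heat_semigroupE; apply: le_trans (leeD2l _ hw).
  rewrite -heatED//; last 2 first.
  + exact/measurable_EFinP.
  + exact/measurable_EFinP.
  apply: le_heatE.
  + (apply/measurable_EFinP; exact: mheat).
  + by apply: emeasurable_funD; exact/measurable_EFinP.
  + by move=> y; rewrite lee_fin.
  + move=> y; rewrite -EFinD lee_fin addrC -lerBlDr /w distrC.
    exact: ler_norm.
Qed.

(* For large times both terms are O(t^(-d/2)), which beats the weight
   t^(1/beta) since d > 2/beta. *)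
Let large_time (K eps : R) : 0 < K -> 0 < eps -> exists2 T : R, 1 <= T &
  forall t, T <= t ->
    (1 + (beta * t) `^ beta^-1) * (K * (2 * pi * t) `^ (- (d%:R / 2))) <= eps.
Proof.
move=> K0 eps0; pose p := d%:R / 2 - beta^-1.
have p0 : 0 < p.
  rewrite /p subr_gt0 ltr_pdivlMr//; apply: le_lt_trans beta_d.
  by rewrite mulrC.
pose K1 := (1 + beta `^ beta^-1) * K.
have K10 : 0 < K1 by rewrite mulr_gt0// ltr_pwDl ?powR_ge0.
pose T0 := (K1 / eps) `^ p^-1.
have T00 : 0 < T0 by rewrite powR_gt0// divr_gt0.
exists (Num.max 1 T0) => [|t]; first by rewrite le_max lexx.
rewrite ge_max => /andP[t1 tT0].
have t0 : 0 < t by exact: lt_le_trans t1.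
have tb1 : 1 <= t `^ beta^-1 by rewrite -(powRr0 t) ler_powR// invr_ge0 ltW.
apply: (@le_trans _ _ (K1 * t `^ (- p))).
  have -> : t `^ (- p) = t `^ beta^-1 * t `^ (- (d%:R / 2)).
    by rewrite -powRD ?(gt_eqF t0) ?implybT// /p opprB.
  have -> : K1 * (t `^ beta^-1 * t `^ (- (d%:R / 2))) =
    ((1 + beta `^ beta^-1) * t `^ beta^-1) * (K * t `^ (- (d%:R / 2))).
    by rewrite /K1; ring.
  rewrite ler_pM ?mulr_ge0 ?powR_ge0 ?addr_ge0 ?powR_ge0 ?(ltW K0)//.
    by rewrite powRM ?(ltW beta0) ?(ltW t0)// mulrDl mul1r lerD2r.
  rewrite ler_wpM2l ?(ltW K0)// !powRN lef_pV2 ?posrE ?powR_gt0 ?pi2_gt0//.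
  rewrite ge0_ler_powR ?nnegrE ?divr_ge0 ?(ltW t0) ?(ltW (pi2_gt0 t0))//.
  rewrite ler_peMl ?(ltW t0)//.
  by have := pi_ge2 R; lra.
rewrite mulrC powRN ler_pdivrMl ?powR_gt0//.
apply: (@le_trans _ _ (T0 `^ p * eps)).
  by rewrite /T0 -powRrM mulVf ?gt_eqF// powRr1 ?divfK ?gt_eqF// divr_ge0 ?ltW.
rewrite ler_wpM2r ?(ltW eps0)// ge0_ler_powR ?nnegrE ?(ltW p0) ?(ltW t0) ?(ltW T00)//.
Qed.

(** Up to a time T the exponent at time t is compared with the heat flow of the
    exponent at time s = a / 2, through an absorption term and an L1 distance
    that both vanish with e; beyond T both functions are small. The weight is
    the one that the cluster normalization requires. *)
Lemma scaled_exponent_cvg_unif (a eps : R) : 0 < a -> 0 < eps ->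
  \forall e \near 0^'+, forall t x, a <= t ->
    (1 + (beta * t) `^ beta^-1) * `|phi e t x - c * heat_kernel t x| <= eps.
Proof.
move=> a0 eps0.
have [C C0 hC'] := scaled_exponent_bounds beta01 hX hC.
have [C1 C10 hC1] := scaled_exponent_heat beta01 hX hC.
have Cc0 : 0 < C + c by rewrite addr_gt0.
have [T T1 hT] := large_time Cc0 eps0.
have T0 : 0 < T by exact: lt_le_trans T1.
pose wT := 1 + (beta * T) `^ beta^-1.
have wT0 : 0 < wT by rewrite ltr_pwDl ?powR_ge0.
pose s := a / 2; have s0 : 0 < s by rewrite divr_gt0.
pose M : R := (2 * pi * s) `^ (- (d%:R / 2)).
have M0 : 0 < M by rewrite powR_gt0// pi2_gt0.
pose K : R := T * (C1 * M) `^ (1 + beta).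
have K0 : 0 < K by rewrite mulr_gt0// powR_gt0// mulr_gt0.
pose eps1 := eps / wT / 2; have eps10 : 0 < eps1 by rewrite !divr_gt0.
pose q := d%:R * beta - 2.
have q0 : 0 < q by move: beta_d; rewrite ltr_pdivrMr// subr_gt0.
pose l := eps1 / M; have l0 : 0 < l by rewrite divr_gt0.
pose delta := (eps1 / K) `^ q^-1.
have delta0 : 0 < delta by rewrite powR_gt0// divr_gt0.
have hL : \forall e \near 0^'+, (L1 s e <= l%:E)%E.
  have /fine_cvgP[fin cv] := scaled_exponent_cvg_L1 s0.
  have cv' := cvgr_le _ cv l l0.
  near=> e; have f1 : L1 s e \is a fin_num by near: e.
  have f2 : fine (L1 s e) <= l by near: e; apply: cv'.
  by rewrite -(fineK f1) lee_fin.
near=> e => t x at_.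
have e0 : 0 < e by [].
have e_s : e ^+ 2 <= s.
  have er : e <= Num.sqrt s.
    by near: e; apply: nbhs_right_le; rewrite sqrtr_gt0.
  by rewrite -[leRHS](sqr_sqrtr (ltW s0)) ler_pXn2r ?nnegrE ?(ltW e0).
have sa : s < a by rewrite /s ltr_pdivrMr// ltr_pMr// ltr1n.
have st : s < t by exact: lt_le_trans at_.
have t0 : 0 < t by exact: lt_trans st.
have phi0 : 0 <= phi e t x by exact: (scaled_exponent_ge0 eta Q beta01).
have ch0 : 0 <= c * heat_kernel t x by rewrite mulr_ge0 ?heat_kernel_ge0 ?ltW.
have [Tt|tT] := leP T t.
  apply: le_trans (hT t Tt).
  rewrite ler_wpM2l ?addr_ge0 ?powR_ge0//.
  have [_ h1] := hC' e t x e0 (le_trans e_s (ltW st)).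
  have h2 : c * heat_kernel t x <= c * (2 * pi * t) `^ (- (d%:R / 2)).
    by rewrite ler_wpM2l ?(ltW c0)// heat_kernel_le_max.
  rewrite mulrDl ler_norml; apply/andP; split; lra.
have w_le : 1 + (beta * t) `^ beta^-1 <= wT.
  rewrite lerD2l ge0_ler_powR ?nnegrE ?invr_ge0 ?mulr_ge0 ?(ltW beta0) ?(ltW t0) ?(ltW T0)//.
  by rewrite ler_pM2l// ltW.
have Mts : (2 * pi * (t - s)) `^ (- (d%:R / 2)) * l <= eps1.
  apply: (@le_trans _ _ (M * l)); last by rewrite /l mulrC divfK ?gt_eqF.
  rewrite ler_wpM2r ?(ltW l0)// /M !powRN.
  have ts : s <= t - s by rewrite /s; lra.
  have ts0 : 0 < t - s by exact: lt_le_trans ts.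
  rewrite lef_pV2 ?posrE ?powR_gt0 ?pi2_gt0//.
  rewrite ge0_ler_powR ?nnegrE ?divr_ge0 ?(ltW (pi2_gt0 _))//.
  by rewrite ler_pM2l ?mulr_gt0 ?pi_gt0.
have Ke : (t - s) * (C1 * M) `^ (1 + beta) * e `^ q <= eps1.
  apply: (@le_trans _ _ (K * e `^ q)).
    by rewrite ler_wpM2r ?powR_ge0// ler_wpM2r ?powR_ge0//; lra.
  have ed : e <= delta by near: e; exact: nbhs_right_le.
  apply: (@le_trans _ _ (K * delta `^ q)).
    by rewrite ler_wpM2l ?(ltW K0)// ge0_ler_powR ?nnegrE ?(ltW q0) ?(ltW e0) ?(ltW delta0).
  rewrite /delta -powRrM mulVf ?gt_eqF// powRr1; last by rewrite divr_ge0 ?ltW.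
  by rewrite mulrC divfK ?gt_eqF.
have hLe : (L1 s e <= l%:E)%E by near: e.
have [s1 s2] := smoothing x s0 st e0 e_s hLe.
have [p1 p2] := hC1 e s t x e0 e_s st.
have u1 : phi e t x <= c * heat_kernel t x + eps1.
  rewrite -lee_fin; apply: (le_trans p1); apply: (le_trans s1).
  by rewrite lee_fin lerD2l.
have u2 : c * heat_kernel t x <= phi e t x + 2 * eps1.
  rewrite -lee_fin; apply: (le_trans s2); apply: (le_trans (leeD2r _ p2)).
  rewrite -EFinD lee_fin -/M -/q; move: Ke Mts; lra.
apply: (@le_trans _ _ (wT * (2 * eps1))).
  rewrite ler_pM ?addr_ge0 ?powR_ge0// ler_norml; apply/andP; split; lra.
have -> : wT * (2 * eps1) = eps by rewrite /eps1; field; rewrite gt_eqF.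
by [].
Unshelve. all: by end_near. Qed.

End scaling_limit.

(** * Independence *)

Section independence.
Context {R : realType}.
Local Open Scope ereal_scope.
Import HBNNSimple.

(** An identity between a weighted law of Z and a multiple of the law of X
    extends from events to nonnegative functions, by monotone approximation
    with simple functions. *)
Lemma weighted_law_integral d1 (V : measurableType d1) d2 (W : measurableType d2)
    d3 (T : measurableType d3) (m : {measure set V -> \bar R})
    (p : {measure set W -> \bar R}) (Z : V -> T) (X : W -> T)
    (h : V -> \bar R) (k : \bar R) (g : T -> \bar R) :
  measurable_fun setT Z -> measurable_fun setT X -> measurable_fun setT h ->
  (forall v, 0 <= h v) -> (forall v, h v \is a fin_num) ->
  0 <= k -> k \is a fin_num ->
  (forall D, measurable D ->
    \int[m]_v (h v * (\1_D (Z v))%:E) = k * p (X @^-1` D)) ->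
  measurable_fun setT g -> (forall z, 0 <= g z) ->
  \int[m]_v (h v * g (Z v)) = k * \int[p]_w g (X w).
Proof.
move=> mZ mX mh h0 hfin k0 kfin hk mg g0.
pose f := nnsfun_approx measurableT mg.
have fg z : EFin \o f^~ z @ \oo --> g z by exact: cvg_nnsfun_approx.
have ndf z a b : (a <= b)%N -> (f a z)%:E <= (f b z)%:E.
  by move=> ab; rewrite lee_fin; exact/lefP/nd_nnsfun_approx.
have mf n : measurable_fun setT (EFin \o f n) by exact/measurable_EFinP.
have simple n : \int[m]_v (h v * (f n (Z v))%:E) = k * \int[p]_w (f n (X w))%:E.
  have mD y : measurable (f n @^-1` [set y]) by [].
  have mi y : measurable_fun setT (fun z : T => (\1_(f n @^-1` [set y]) z : R)%:E).
    by apply/measurable_EFinP; exact: measurable_indic.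
  have i0 y z : 0 <= (\1_(f n @^-1` [set y]) z : R)%:E by rewrite lee_fin.
  have fE z : (f n z)%:E =
      \sum_(y \in range (f n)) (y%:E * (\1_(f n @^-1` [set y]) z)%:E).
    by rewrite {1}(fimfunE (f n)) -fsumEFin.
  have y0 y z : 0 <= y%:E * (\1_(f n @^-1` [set y]) z : R)%:E.
    by rewrite -EFinM; exact: nnfun_muleindic_ge0.
  transitivity (\int[m]_v (\sum_(y \in range (f n))
      (h v * (y%:E * (\1_(f n @^-1` [set y]) (Z v))%:E)))).
    by apply: eq_integral => v _; rewrite fE ge0_mule_fsumr.
  rewrite ge0_integral_fsum//; last 2 first.
  - move=> y; apply: emeasurable_funM => //; apply: measurable_funeM.
    exact: (measurableT_comp (mi y)).
  - by move=> y v _; rewrite mule_ge0.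
  transitivity (k * \int[p]_w (\sum_(y \in range (f n))
      (y%:E * (\1_(f n @^-1` [set y]) (X w))%:E))); last first.
    by congr (_ * _); apply: eq_integral => w _; rewrite fE.
  rewrite ge0_integral_fsum//; last first.
    move=> y; apply: measurable_funeM.
    exact: (measurableT_comp (mi y)).
  rewrite ge0_mule_fsumr; last by move=> y; apply: integral_ge0.
  apply: eq_fsbigr => y /set_mem [z _ fz].
  have y_ge0 : (0 <= y)%R by rewrite -fz.
  rewrite [X in _ = k * X]ge0_integralZl_EFin//; last first.
    exact: (measurableT_comp (mi y)).
  rewrite integral_indic//; last first.
    by rewrite -[X in measurable X]setTI; exact: mX.
  under eq_integral do rewrite muleCA.
  rewrite ge0_integralZl_EFin//; last 2 first.
  - by move=> v _; rewrite mule_ge0.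
  - by apply: emeasurable_funM => //; exact: (measurableT_comp (mi y)).
  by rewrite hk// setIT muleCA.
have lhs : \int[m]_v (h v * (f n (Z v))%:E) @[n --> \oo] --> \int[m]_v (h v * g (Z v)).
  have E v : h v * g (Z v) = limn (fun n => h v * (f n (Z v))%:E).
    by apply/esym/cvg_lim => //; apply: cvgeZl => //; exact: fg.
  under [X in _ --> X]eq_integral do rewrite E.
  apply: cvg_monotone_convergence => //.
  - by move=> n; apply: emeasurable_funM => //; exact: (measurableT_comp (mf n)).
  - by move=> n v _; rewrite mule_ge0// lee_fin.
  - by move=> v _ a b ab; rewrite lee_wpmul2l// ndf.
have rhs : \int[p]_w (f n (X w))%:E @[n --> \oo] --> \int[p]_w g (X w).
  have E w : g (X w) = limn (fun n => (f n (X w))%:E).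
    by apply/esym/cvg_lim => //; exact: fg.
  under [X in _ --> X]eq_integral do rewrite E.
  apply: cvg_monotone_convergence => //.
  - by move=> n; exact: (measurableT_comp (mf n)).
  - by move=> n w _; rewrite lee_fin.
  - by move=> w _ a b ab; exact: ndf.
have {}rhs : \int[m]_v (h v * (f n (Z v))%:E) @[n --> \oo] --> k * \int[p]_w g (X w).
  by under eq_fun do rewrite simple; exact: cvgeZl.
exact: cvg_unique lhs rhs.
Qed.

(** The product rule for events is turned into the product rule for
    nonnegative functions one factor at a time: while the functions with index
    at least k are indicators, the k-th one can be made arbitrary. *)
Lemma product_rule_integral d1 (V : measurableType d1) d2 (W : measurableType d2)
    d3 (T : measurableType d3) (Pr : probability V R)
    (P : (probability W R)^nat) (Z : nat -> V -> T) (X : W -> T) N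
    (g : nat -> T -> \bar R) :
  (forall n, measurable_fun setT (Z n)) -> measurable_fun setT X ->
  (forall C : (set T)^nat, (forall n, measurable (C n)) ->
    Pr (\bigcap_(n in `I_N) Z n @^-1` C n) = \prod_(n < N) P n (X @^-1` C n)) ->
  (forall n, measurable_fun setT (g n)) -> (forall n z, 0 <= g n z <= 1) ->
  \int[Pr]_v \prod_(n < N) g n (Z n v) = \prod_(n < N) \int[P n]_w g n (X w).
Proof.
move=> mZ mX hP mg g01.
suff claim k : (k <= N)%N -> forall g, (forall n, measurable_fun setT (g n)) ->
    (forall n z, 0 <= g n z <= 1) ->
    (forall n, (k <= n)%N -> exists2 D, measurable D & forall z, g n z = (\1_D z : R)%:E) ->
    \int[Pr]_v \prod_(n < N) g n (Z n v) = \prod_(n < N) \int[P n]_w g n (X w).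
  pose g' n := if (n < N)%N then g n else cst 1.
  have E (F : nat -> (T -> \bar R) -> \bar R) :
      \prod_(n < N) F n (g n) = \prod_(n < N) F n (g' n).
    by apply: eq_bigr => n _; rewrite /g' ltn_ord.
  rewrite (E (fun n f => \int[P n]_w f (X w))).
  under eq_integral => v _ do rewrite (E (fun n f => f (Z n v))).
  apply: (claim N (leqnn N)).
  - by move=> n; rewrite /g'; case: ifP => // _; exact: measurable_cst.
  - by move=> n z; rewrite /g'; case: ifP => // _; rewrite lexx lee01.
  - by move=> n Nn; exists setT => // z; rewrite /g' ltnNge Nn/= indicT.
elim: k => [_|k IH kN] {mg g01}g mg g01 gI.
  have /choice[C hC] : forall n, exists D, measurable D /\ forall z, g n z = (\1_D z : R)%:E.
    by move=> n; have [D mD gD] := gI n (leq0n n); exists D.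
  have mC n : measurable (C n) by case: (hC n).
  have gE n z : g n z = (\1_(C n) z)%:E by case: (hC n).
  have mpre n : measurable (X @^-1` C n) by rewrite -[X in measurable X]setTI; exact: mX.
  transitivity (\prod_(n < N) P n (X @^-1` C n)); last first.
    apply: eq_bigr => n _; under eq_integral do rewrite gE.
    by rewrite (integral_indic _ measurableT (mpre n)) setIT.
  rewrite -hP//.
  have mI : measurable (\bigcap_(n in `I_N) Z n @^-1` C n).
    apply: fin_bigcap_measurable => // n _.
    by rewrite -[X in measurable X]setTI; exact: mZ.
  rewrite -[in RHS](setIT (\bigcap_(_ in _) _)) -(integral_indic _ measurableT mI).
  apply: eq_integral => v _; under eq_bigr do rewrite gE.
  rewrite prodEFin; congr (_%:E); rewrite indicE.
  have [h|h] := pselect ((\bigcap_(n in `I_N) Z n @^-1` C n) v).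
    rewrite mem_set// big1// => n _; rewrite indicE mem_set//; exact: (h n (ltn_ord n)).
  have [n hn] : exists n : 'I_N, ~ C n (Z n v).
    apply: contrapT => hn; apply: h => n /= nN; apply: contrapT => hc; apply: hn.
    by exists (Ordinal nN).
  by rewrite memNset// (bigD1 n)//= indicE memNset// mul0r.
pose j := Ordinal kN.
pose F g v := \prod_(n < N | n != j) (g n (Z n v) : \bar R).
have F01 f v : (forall n z, 0 <= f n z <= 1) -> 0 <= F f v <= 1.
  move=> f01; rewrite /F; elim/big_ind : _ => [|x y /andP[x0 x1] /andP[y0 y1]|n _].
  - by rewrite lee01 lexx.
  - by rewrite mule_ge0//= -[1]mule1 lee_pmul.
  - exact: f01.
pose K := \prod_(n < N | n != j) \int[P n]_w g n (X w).
have I01 n : 0 <= \int[P n]_w g n (X w) <= 1.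
  apply/andP; split.
    by apply: integral_ge0 => w _; have /andP[] := g01 n (X w).
  rewrite -(@probability_setT _ _ _ (P n)) -[leRHS]mul1e -integral_cst//.
  apply: ge0_le_integral => //.
  - by move=> w _; have /andP[] := g01 n (X w).
  - exact: (measurableT_comp (mg n)).
  - by move=> w _; have /andP[] := g01 n (X w).
have K01 : 0 <= K <= 1.
  rewrite /K; elim/big_ind : _ => [|x y /andP[x0 x1] /andP[y0 y1]|n _].
  - by rewrite lee01 lexx.
  - by rewrite mule_ge0//= -[1]mule1 lee_pmul.
  - exact: I01.
have fin01 (x : \bar R) : 0 <= x <= 1 -> x \is a fin_num.
  by move=> /andP[x0 x1]; rewrite ge0_fin_numE//; exact: le_lt_trans x1 (ltry 1).
rewrite (bigD1 j)//= muleC.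
under eq_integral => v _ do rewrite (bigD1 j)//= muleC.
apply: (@weighted_law_integral _ _ _ _ _ _ Pr (P k) (Z k) X (F g) K (g k)) => //.
- rewrite /F; elim: (index_enum _) => [|n r IHr].
    apply: (eq_measurable_fun (cst 1)) => [v _|]; last exact: measurable_cst.
    by rewrite big_nil.
  apply: (eq_measurable_fun (fun v => (if n != j then g n (Z n v) else 1) *
      \prod_(i <- r | i != j) g i (Z i v))) => [v _|].
    by rewrite big_cons; case: ifP => // _; rewrite mul1e.
  apply: emeasurable_funM => //; case: (n != j); last exact: measurable_cst.
  exact: (measurableT_comp (mg n)).
- by move=> v; have /andP[] := F01 g v g01.
- by move=> v; exact/fin01/F01.
- by case/andP: K01.
- exact: fin01.
- move=> D mD.
  pose g' n := if n == k then (fun z => (\1_D z : R)%:E) else g n.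
  have g'k : g' k = (fun z => (\1_D z : R)%:E) by rewrite /g' eqxx.
  have g'N (n : 'I_N) : n != j -> g' n = g n.
    by rewrite -val_eqE /g' /= => /negbTE ->.
  have := IH (ltnW kN) g'; rewrite (bigD1 j)//= g'k muleC.
  under eq_integral => v _ do rewrite (bigD1 j)//= g'k muleC.
  rewrite integral_indic//; last by rewrite -[X in measurable X]setTI; exact: mX.
  rewrite setIT (_ : \prod_(i < N | i != j) _ = K); last first.
    by apply: eq_bigr => n nj; rewrite g'N.
  move=> <-.
  + by apply: eq_integral => v _; congr (_ * _); apply: eq_bigr => n nj; rewrite g'N.
  + move=> n; rewrite /g'; case: ifP => // _; apply/measurable_EFinP; exact: measurable_indic.
  + move=> n z; rewrite /g'; case: ifP => // _; rewrite indicE.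
    by case: (_ \in _); rewrite !lee_fin ?lexx ?ler01.
  + move=> n; rewrite leq_eqVlt => /predU1P[<-|kn]; first by exists D => // z; rewrite g'k.
    by have [E mE gE] := gI n kn; exists E => // z; rewrite /g' gtn_eqF// gE.
- by move=> z; have /andP[] := g01 k z.
Qed.

End independence.

(** * Infinite initial measures *)

Section infinite_initial_measures.
Context {R : realType} {d : nat} (beta : R)
    {dW : measure_display} {W : measurableType dW}
    (xi : R -> W -> measures R d) (P : measures R d -> probability W R)
    {dV : measure_display} {V : measurableType dV}
    (eta : R -> V -> measures R d) (Q : R.-pker 'rV[R]_d ~> V)
    (beta01 : 0 < beta <= 1)
    (hX : superprocess xi P beta) (hC : cluster_family xi P eta Q beta).
Implicit Types (s t l : R) (x y z : 'rV[R]_d) (B : set 'rV[R]_d).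
Implicit Types (mu : measures R d).
Local Notation cum := (cumulant beta eta Q).
Local Notation hit := (hitting_exponent beta eta Q).
Local Open Scope ereal_scope.

Let beta0 : (0 < beta)%R. Proof. by case/andP: beta01. Qed.

Let lindic_ge0 l B y : (0 <= l)%R -> (0 <= l * (\1_B y : R))%R.
Proof. by move=> l0; rewrite mulr_ge0// indicE. Qed.

Let lindic_le l B y : (0 <= l)%R -> (l * (\1_B y : R) <= l)%R.
Proof. by move=> l0; rewrite ler_piMr// indicE; case: (_ \in _). Qed.

Let measurable_lindic l B : measurable B ->
  measurable_fun setT (fun y => l * (\1_B y : R))%R.
Proof. by move=> mB; apply: measurable_funM => //; exact: measurable_indic. Qed.

Let integral_lindic (m : measures R d) l B : (0 <= l)%R -> measurable B ->
  \int[m]_y (l * (\1_B y : R))%:E = l%:E * m B.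
Proof.
move=> l0 mB; under eq_integral do rewrite EFinM.
rewrite ge0_integralZl_EFin//; last first.
  by apply/measurable_EFinP; exact: measurable_indic.
by rewrite integral_indic// setIT.
Qed.

Let expeR_big (a : (\bar R)^nat) N : (forall n, 0 <= a n) ->
  \prod_(n < N) expeR (- a n) = expeR (- \sum_(n < N) a n).
Proof.
move=> a0; elim: N => [|N IH]; first by rewrite !big_ord0 oppe0 expeR0.
rewrite !big_ord_recr/= IH oppeD ?expeRD//.
by apply: ge0_adde_def; rewrite inE ?sume_ge0.
Qed.

(** The Laplace functional formula for infinite initial measures: independent
    copies make the exponentials of the summands multiply. *)
Lemma laplace_sigma_finite mu t B l : sigma_finite setT mu -> (0 < t)%R ->
  measurable B -> (0 <= l)%R ->
  \int[P mu]_w expeR (- (l%:E * xi t w B)) =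
  expeR (- \int[mu]_y (cum t (fun z => l * (\1_B z : R))%R y)%:E).
Proof.
move=> smu t0 mB l0; pose f z : R := (l * (\1_B z : R))%R.
have f0 z : (0 <= f z)%R by exact: lindic_ge0.
have fM : exists M, forall z, (f z <= M)%R by exists l => z; exact: lindic_le.
have mf : measurable_fun setT f by exact: measurable_lindic.
have [m [mfin muE [dY [Y' [Pr [Y [mY indep law]]]]]]] :=
  superprocess_sigma_finite hX smu.
(* the absolute value makes g bounded by 1 on the whole extended line *)
pose g (z : \bar R) := expeR (- (l%:E * `|z|)).
have gE (z : \bar R) : 0 <= z -> g z = expeR (- (l%:E * z)).
  by move=> z0; rewrite /g gee0_abs.
have labs0 (z : \bar R) : 0 <= l%:E * `|z| by rewrite mule_ge0// lee_fin.
have g01 (z : \bar R) : 0 <= g z <= 1 by rewrite expeR_ge0 expeRN_le1.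
have mg : measurable_fun setT g.
  apply: (measurableT_comp measurable_expeR); apply: measurableT_comp => //.
  by apply: measurable_funeM; exact: abse_measurable.
pose Z n v := Y n t v B.
have Z0 n v : 0 <= Z n v by exact: measure_ge0.
have mZ n : measurable_fun setT (Z n) by exact: (mY n t B (ltW t0) mB).
pose X w := xi t w B.
have mX : measurable_fun setT X by exact: (superprocess_measurable hX (ltW t0) mB).
pose E (C : set (\bar R)) : set (R -> measures R d) := [set p | C (p t B)].
have evE C : measurable C -> path_events (E C).
  by move=> mC; apply: sub_sigma_algebra; exists t, B, C; split => //; exact: ltW.
pose a n := \int[m n]_y (cum t f y)%:E.
have a0 n : 0 <= a n.
  by apply: integral_ge0 => y _; rewrite lee_fin (cumulant_ge0 eta Q beta01).
pose S v := mseries (fun n => Y n t v) 0 B.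
have sumS v : \sum_(n < N) Z n v @[N --> \oo] --> S v.
  rewrite /S /mseries; under eq_fun do rewrite -(big_mkord xpredT (Z ^~ v)).
  by apply: is_cvg_nneseries => n _ _; exact: Z0.
have mSN N : measurable_fun setT (fun v => \sum_(n < N) Z n v).
  by apply: emeasurable_sum => n; exact: mZ.
have mS : measurable_fun setT S.
  by apply: (emeasurable_fun_cvg (fun N v => \sum_(n < N) Z n v)) => // v _; exact: sumS.
have expZ N v : \prod_(n < N) g (Z n v) = g (\sum_(n < N) Z n v).
  rewrite gE ?sume_ge0// ge0_sume_distrr// -(@expeR_big (fun n => l%:E * Z n v)); last first.
    by move=> n; rewrite mule_ge0// lee_fin.
  by apply: eq_bigr => n _; rewrite gE.
have intX n : \int[P (m n)]_w g (X w) = expeR (- a n).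
  have [_ /(_ (m n) t (mfin n) (ltW t0)) <-] := cumulant_superprocess hX hC mf f0 fM.
  by apply: eq_integral => w _; rewrite gE ?measure_ge0// integral_lindic.
have lawS : \int[P mu]_w g (X w) = \int[Pr]_v g (S v).
  have h : \int[Pr]_v (cst 1 v * g (S v)) = 1 * \int[P mu]_w g (X w).
    apply: weighted_law_integral => //.
    - move=> D mD; under eq_integral do rewrite mul1e.
      rewrite integral_indic//; last by rewrite -[X in measurable X]setTI; exact: mS.
      by rewrite setIT mul1e; apply/esym/(law (E D)); exact: evE.
    - by move=> z; case/andP: (g01 z).
  by rewrite -[LHS]mul1e -h; apply: eq_integral => v _; rewrite mul1e.
have -> : \int[P mu]_w expeR (- (l%:E * xi t w B)) = \int[P mu]_w g (X w).
  by apply: eq_integral => w _; rewrite gE// measure_ge0.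
rewrite lawS.
have lhs : \int[Pr]_v g (\sum_(n < N) Z n v) @[N --> \oo] --> \int[Pr]_v g (S v).
  apply: bounded_cvg_integral.
  - exact: (le_lt_trans (probability_le1 Pr measurableT) (ltry 1)).
  - by move=> N; exact: (measurableT_comp mg).
  - by move=> N v; rewrite gee0_abs; case/andP: (g01 (\sum_(n < N) Z n v)).
  - move=> v; rewrite gE; last by rewrite measure_ge0.
    have E1 N : g (\sum_(n < N) Z n v) = expeR (- (l%:E * \sum_(n < N) Z n v)).
      by rewrite gE// sume_ge0.
    under eq_fun do rewrite E1.
    apply: cvg_expeRN; first by move=> N; rewrite mule_ge0 ?lee_fin ?sume_ge0.
    by apply: cvgeZl => //; exact: sumS.
have rhs : \int[Pr]_v g (\sum_(n < N) Z n v) @[N --> \oo] -->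
    expeR (- \int[mu]_y (cum t f y)%:E).
  have E1 N : \int[Pr]_v g (\sum_(n < N) Z n v) = expeR (- \sum_(n < N) a n).
    under eq_integral do rewrite -expZ.
    rewrite (@product_rule_integral _ _ _ _ _ _ _ Pr (fun n => P (m n)) Z X N (fun=> g))//.
      by rewrite -(@expeR_big a)//; apply: eq_bigr => n _; exact: intX.
    by move=> C mC; apply: (indep N (fun n => E (C n))) => n; exact: evE.
  under eq_fun do rewrite E1.
  apply: cvg_expeRN; first by move=> N; rewrite sume_ge0.
  have -> : \int[mu]_y (cum t f y)%:E = \sum_(n <oo) a n.
    rewrite (eq_measure_integral (mseries m 0)); last by move=> A mA _; exact: muE.
    rewrite ge0_integral_measure_series//.
      by move=> y _; rewrite lee_fin (cumulant_ge0 eta Q beta01).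
    apply/measurable_EFinP; exact: (measurable_cumulant hX hC (ltW t0)).
  under eq_fun do rewrite -(big_mkord xpredT a).
  by apply: is_cvg_nneseries => n _ _; exact: a0.
exact: cvg_unique lhs rhs.
Qed.

(** Let l tend to infinity in the Laplace formula. *)
Lemma hitting_probability mu t B : sigma_finite setT mu -> (0 < t)%R ->
  measurable B ->
  P mu [set w | 0 < xi t w B] = 1 - expeR (- \int[mu]_y (hit t B y)%:E).
Proof.
move=> smu t0 mB.
have mX : measurable_fun setT (fun w => xi t w B).
  exact: (superprocess_measurable hX (ltW t0) mB).
have mA : measurable [set w | 0 < xi t w B].
  by rewrite -[X in measurable X]setTI; exact: emeasurable_fun_o_infty.
pose f n z : R := (n%:R * (\1_B z : R))%R.
pose A0 := ~` [set w | 0 < xi t w B].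
have lhs : \int[P mu]_w expeR (- (n%:R%:E * xi t w B)) @[n --> \oo] --> P mu A0.
  have -> : P mu A0 = \int[P mu]_w (\1_A0 w)%:E.
    by rewrite integral_indic ?setIT//; exact: measurableC.
  have n0 n w : 0 <= n%:R%:E * xi t w B by rewrite mule_ge0.
  apply: bounded_cvg_integral.
  - exact: (le_lt_trans (probability_le1 (P mu) measurableT) (ltry 1)).
  - move=> n; apply: (measurableT_comp measurable_expeR).
    by apply: measurableT_comp => //; exact: measurable_funeM.
  - by move=> n w; rewrite gee0_abs ?expeR_ge0// expeRN_le1.
  - move=> w.
    have -> : (\1_A0 w)%:E =
        expeR (- (if 0 < xi t w B then +oo else 0)) :> \bar R.
      rewrite indicE; case: ifPn => h.
        by rewrite memNset//= => /(_ h).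
      by rewrite mem_set/= ?oppr0 ?expR0//; exact/negP.
    apply: cvg_expeRN => //; case: ifPn => h; first exact: cvg_muln_ereal.
    have -> : xi t w B = 0 by apply/eqP; rewrite eq_le measure_ge0 andbT leNgt.
    by under eq_fun do rewrite mule0; exact: cvg_cst.
have rhs : \int[P mu]_w expeR (- (n%:R%:E * xi t w B)) @[n --> \oo] -->
    expeR (- \int[mu]_y (hit t B y)%:E).
  under eq_fun do rewrite laplace_sigma_finite//.
  apply: cvg_expeRN.
    move=> n; apply: integral_ge0 => y _.
    by rewrite lee_fin (cumulant_ge0 eta Q beta01)// => z; exact: lindic_ge0.
  have E y : (hit t B y)%:E = limn (fun n => (cum t (f n) y)%:E).
    apply/esym/cvg_lim => //; apply: cvg_EFin; first exact: nearW.
    exact: (hitting_exponent_indic_cvg hC).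
  under [X in _ --> X]eq_integral do rewrite E.
  apply: cvg_monotone_convergence => //.
  - move=> n; apply/measurable_EFinP; apply: (measurable_cumulant hX hC (ltW t0)).
    + exact: measurable_lindic.
    + by move=> z; exact: lindic_ge0.
    + by exists n%:R => z; exact: lindic_le.
  - move=> n y _; rewrite lee_fin (cumulant_ge0 eta Q beta01)// => z; exact: lindic_ge0.
  - move=> y _ i j ij; rewrite lee_fin (le_cumulant beta01 hC)//.
    + exact: measurable_lindic.
    + exact: measurable_lindic.
    + by move=> z; exact: lindic_ge0.
    + by move=> z; rewrite /f ler_wpM2r ?ler_nat// indicE.
rewrite -(cvg_unique _ lhs rhs)// -probability_setC ?setCK//.
exact: measurableC.
Qed.

(** Otherwise the Laplace formula would make xi_t B infinite almost surely. *)
Lemma cumulant_integral_fin mu t B l : sigma_finite setT mu ->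
  locally_finite_under xi P mu -> (0 < t)%R -> measurable B -> bounded_set B ->
  (0 <= l)%R -> \int[mu]_y (cum t (fun z => l * (\1_B z : R))%R y)%:E < +oo.
Proof.
move=> smu lf t0 mB bB l0.
rewrite ltey; apply/negP => /eqP h.
have := laplace_sigma_finite smu t0 mB l0; rewrite h/= => int0.
have mX : measurable_fun setT (fun w => xi t w B).
  exact: (superprocess_measurable hX (ltW t0) mB).
have mE : measurable_fun setT (fun w => expeR (- (l%:E * xi t w B))).
  apply: (measurableT_comp measurable_expeR).
  by apply: measurableT_comp => //; exact: measurable_funeM.
have ae0 : ae_eq (P mu) setT (fun w => expeR (- (l%:E * xi t w B))) (cst 0).
  apply/ae_eq_integral_abs => //; rewrite -int0.
  by apply: eq_integral => w _; rewrite gee0_abs// expeR_ge0.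
have : {ae P mu, forall w, False}.
  move: ae0 (lf t t0); apply: filterS2 => w /(_ Logic.I) e0 /(_ B mB bB) fin.
  move: e0; have : xi t w B \is a fin_num by rewrite ge0_fin_numE.
  by case: (xi t w B) => [r| |]//= _ []; move/eqP; rewrite gt_eqF// expR_gt0.
move=> -[N [mN N0 /= sN]].
have := probability_setT (P mu).
suff -> : P mu setT = 0 by move/eqP; rewrite eq_sym onee_eq0.
apply/eqP; rewrite eq_le measure_ge0 andbT -N0 le_measure ?inE// => w _.
exact: sN.
Qed.

(** Local finiteness passes from the process to the heat flow of its initial
    measure: on a bounded set a small cumulant dominates half of the heat
    flow, and a heat kernel of twice the variance is bounded below by a
    multiple of the original one uniformly over bounded translations. *)
Lemma heat_convolution_fin mu t x : sigma_finite setT mu ->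
  locally_finite_under xi P mu -> (0 < t)%R -> heat_convolution mu t x < +oo.
Proof.
move=> smu lf t0; pose s : R := (2 * t)%R.
have s0 : (0 < s)%R by rewrite mulr_gt0.
(* A cube replaces the ball: its volume is positive by lebesgue_rV_box. *)
pose A (i : 'I_d) : set (measurableTypeR R) := `](x 0 i - 1)%R, (x 0 i + 1)%R[%classic.
pose B : set 'rV[R]_d := [set z | forall i, A i (z 0%R i)].
have mA i : measurable (A i) by exact: measurable_itv.
have mB : measurable B.
  rewrite [X in measurable X](_ : _ = \bigcap_(i in [set: 'I_d])
      ((fun z : 'rV[R]_d => z 0%R i) @^-1` A i)).
    apply: fin_bigcap_measurable => // i _; rewrite -[X in measurable X]setTI.
    by apply: measurable_coord_rV => //; exact: mA.
  by apply/seteqP; split => [z Az i _|z Az i]; exact: Az.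
have coordB z i : B z -> (`|(z - x) 0 i| < 1)%R.
  move=> /(_ i); rewrite /A /= in_itv/= => /andP[h1 h2].
  by rewrite !mxE ltr_norml; apply/andP; split; lra.
have bB : bounded_set B.
  exists (`|x| + 1)%R; split; first exact: num_real.
  move=> M xM z Bz.
  have : ball x 1 z.
    split => // i j; rewrite ord1 -ball_normE/= -normrN opprB.
    by have := coordB z j Bz; rewrite !mxE.
  rewrite -ball_normE /= => h; apply/ltW/(le_lt_trans _ xM).
  rewrite -(subrK x z) (le_trans (ler_normD _ _))// addrC lerD2l.
  by rewrite -normrN opprB ltW.
have volB : 0 < lebesgue_rV d B.
  rewrite (lebesgue_rV_box mA); elim/big_ind : _ => // [u v|i _].
    exact: mule_gt0.
  rewrite /A lebesgue_measure_itv/= lte_fin ltrD2l gtrN// -EFinB lte_fin.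
  lra.
pose l : R := ((2 * s)^-1 `^ beta^-1)%R.
have l0 : (0 < l)%R by rewrite powR_gt0// invr_gt0 mulr_gt0.
have lb : (s * l `^ beta = 2^-1)%R.
  rewrite /l -powRrM mulVf ?gt_eqF// powRr1; last by rewrite invr_ge0 mulr_ge0// ltW.
  by field; rewrite gt_eqF.
pose f z : R := (l * (\1_B z : R))%R.
have f0 z : (0 <= f z)%R by exact/lindic_ge0/ltW.
have fl z : (f z <= l)%R by exact/lindic_le/ltW.
have mf : measurable_fun setT f by exact: measurable_lindic.
have fin := cumulant_integral_fin smu lf s0 mB bB (ltW l0).
have mc := cumulant_mild hX hC mf f0 (ex_intro _ l fl).
pose k : R := (2 `^ (- (d%:R / 2)) * expR (- (d%:R / (2 * t))))%R.
have k0 : (0 < k)%R by rewrite mulr_gt0 ?powR_gt0 ?expR_gt0.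
have shift y z : B z -> (k * heat_kernel t (x - y) <= heat_kernel s (y - z))%R.
  move=> Bz; have := heat_kernel_shift_lb (y - x) (z - x) t0.
  have -> : (y - x - (z - x) = y - z)%R by rewrite opprB addrA subrK.
  apply: le_trans; rewrite heat_kernelBC.
  rewrite ler_wpM2r ?heat_kernel_ge0// ler_wpM2l ?powR_ge0// ler_expR lerN2.
  rewrite ler_wpM2r ?invr_ge0 ?mulr_ge0 ?(ltW t0)//.
  rewrite /enorm sqr_sqrtr; last by apply: sumr_ge0 => i _; exact: sqr_ge0.
  apply: (@le_trans _ _ (\sum_(i < d) 1)%R); last by rewrite sumr_const card_ord.
  apply: ler_sum => i _; apply: le_trans (ler_norm _) _; rewrite normrX.
  by apply: exprn_ile1 => //; apply/ltW/coordB.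
have low y : (k * heat_kernel t (x - y))%:E * (l%:E * lebesgue_rV d B) <=
    heat_semigroup s f y.
  rewrite -(integral_lindic _ (ltW l0) mB) -ge0_integralZl_EFin//; last 3 first.
  - by move=> z _; rewrite lee_fin; exact: f0.
  - by apply/measurable_EFinP; exact: mf.
  - by rewrite mulr_ge0 ?heat_kernel_ge0 ?(ltW k0).
  apply: ge0_le_integral => //.
  - move=> z _; rewrite -EFinM lee_fin; apply: mulr_ge0; last exact: f0.
    by rewrite mulr_ge0 ?heat_kernel_ge0 ?(ltW k0).
  - by apply: measurable_funeM; apply/measurable_EFinP; exact: mf.
  - apply/measurable_EFinP; apply: measurable_funM => //.
    exact: measurable_heat_kernelB.
  - move=> z _; rewrite -EFinM lee_fin /f indicE.
    have [Bz|nBz] := boolP (z \in B); last by rewrite !mulr0.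
    by rewrite ler_wpM2r ?mulr1 ?(ltW l0)//; apply: shift; exact: set_mem.
have up : \int[mu]_y heat_semigroup s f y < +oo.
  apply: (@le_lt_trans _ _ (\int[mu]_y (2%:E * (cum s f y)%:E))).
    apply: ge0_le_integral => //.
    - by move=> y _; exact: heat_semigroup_ge0.
    - exact: measurable_heat_semigroup.
    - apply: measurable_funeM; apply/measurable_EFinP.
      by apply: (measurable_cumulant hX hC (ltW s0)) => //; exists l.
    - move=> y _; have := mild_ge_heat beta01 y mc fl s0; rewrite lb.
      case: (heat_semigroup s f y) (heat_semigroup_ge0 s y f0) => [r| |]//.
        by rewrite -EFinM !lee_fin => _; lra.
      by rewrite gt0_muley ?leye_eq// lte_fin; lra.
  rewrite ge0_integralZl_EFin//; last 2 first.
  - by move=> y _; rewrite lee_fin (cumulant_ge0 eta Q beta01).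
  - apply/measurable_EFinP.
    by apply: (measurable_cumulant hX hC (ltW s0)) => //; exists l.
  by rewrite lte_mul_pinfty.
have kv0 : 0 < k%:E * (l%:E * lebesgue_rV d B).
  by rewrite !mule_gt0.
rewrite /heat_convolution ltey; apply/negP => /eqP hoo.
suff : \int[mu]_y heat_semigroup s f y = +oo by move=> h; move: up; rewrite h ltxx.
apply/eqP; rewrite -leye_eq.
apply: (@le_trans _ _ (\int[mu]_y ((k%:E * (l%:E * lebesgue_rV d B)) * (heat_kernel t (x - y))%:E))).
  rewrite ge0_integralZl//; last 3 first.
  - by apply/measurable_EFinP; exact: measurable_heat_kernelB.
  - by move=> y _; rewrite lee_fin heat_kernel_ge0.
  - exact: ltW.
  by rewrite hoo gt0_muley.
apply: ge0_le_integral => //.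
- by move=> y _; rewrite mule_ge0 ?lee_fin ?heat_kernel_ge0 ?ltW.
- apply: emeasurable_funM; first exact: measurable_cst.
  by apply/measurable_EFinP; exact: measurable_heat_kernelB.
- exact: measurable_heat_semigroup.
- by move=> y _; apply: le_trans (low y); rewrite EFinM -muleA [X in _ * X]muleC muleA.
Qed.

End infinite_initial_measures.

(** * Hitting asymptotics *)

Section hitting_asymptotics.
Context {R : realType} {d : nat} (beta c : R)
    {dW : measure_display} {W : measurableType dW}
    (xi : R -> W -> measures R d) (P : measures R d -> probability W R)
    {dV : measure_display} {V : measurableType dV}
    (eta : R -> V -> measures R d) (Q : R.-pker 'rV[R]_d ~> V)
    (beta01 : 0 < beta <= 1) (beta_d : 2 / beta < d%:R)
    (hX : superprocess xi P beta) (hC : cluster_family xi P eta Q beta)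
    (hc : hitting_constant d beta c).
Implicit Types (s t e k a M : R) (x y z : 'rV[R]_d) (mu : measures R d).
Local Notation hit := (hitting_exponent beta eta Q).
Local Notation phi := (scaled_exponent beta eta Q).
Local Open Scope ereal_scope.

Let beta0 : (0 < beta)%R. Proof. by case/andP: beta01. Qed.

Let c0 : (0 < c)%R. Proof. by case: hc. Qed.

Local Notation J mu t x e := (\int[mu]_y (hit t (eball x e) y)%:E).
Local Notation I mu t x e := (\int[mu]_y (phi e t (y - x))%:E).
Local Notation kappa e := ((e `^ (2 / beta - d%:R))%R).

Let integralZ mu k (f : 'rV[R]_d -> R) : (0 <= k)%R ->
  measurable_fun setT f -> (forall y, 0 <= f y)%R ->
  \int[mu]_y (k * f y)%:E = k%:E * \int[mu]_y (f y)%:E.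
Proof.
move=> k0 mf f0; under eq_integral do rewrite EFinM.
apply: ge0_integralZl_EFin => //; first by move=> y _; rewrite lee_fin.
exact/measurable_EFinP.
Qed.

Let heat_convolutionE mu s x :
  heat_convolution mu s x = \int[mu]_y (heat_kernel s (y - x))%:E.
Proof. by apply: eq_integral => y _; rewrite heat_kernelBC. Qed.

Let measurable_heatB s x : measurable_fun setT (fun y => heat_kernel s (y - x)).
Proof.
apply: (eq_measurable_fun (fun y => heat_kernel s (x - y))) => [y _|].
  by rewrite heat_kernelBC.
exact: measurable_heat_kernelB.
Qed.

Let measurable_phiB e t x : (0 < e)%R -> (0 < t)%R ->
  measurable_fun setT (fun y => (phi e t (y - x))%:E).
Proof.
move=> e0 t0; apply/measurable_EFinP.
apply: (measurableT_comp (measurable_scaled_exponent hX hC e0 t0)).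
apply: (eq_measurable_fun (fun y : 'rV[R]_d => - x + 1 *: y)%R) => [y _|].
  by rewrite scale1r addrC.
exact: measurable_affine_rV.
Qed.

Let measurable_hit e t x : (0 < t)%R ->
  measurable_fun setT (fun y => (hit t (eball x e) y)%:E).
Proof.
move=> t0; apply/measurable_EFinP; apply: (measurable_hitting_exponent hX hC t0).
exact: measurable_eball.
Qed.

Let phi_ge0 e t x : (0 < e)%R -> (0 < t)%R -> 0 <= (phi e t x)%:E.
Proof. by move=> e0 t0; rewrite lee_fin (scaled_exponent_ge0 eta Q beta01). Qed.

Let hit_ge0 e t x y : (0 < t)%R -> 0 <= (hit t (eball x e) y)%:E.
Proof. by move=> t0; rewrite lee_fin (hitting_exponent_ge0 eta Q beta01). Qed.

Let scaled_integral mu t x e : (0 < e)%R -> (0 < t)%R ->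
  (kappa e)%:E * J mu t x e = I mu t x e.
Proof.
move=> e0 t0; rewrite -ge0_integralZl_EFin ?powR_ge0//; last 2 first.
- by move=> y _; exact: hit_ge0.
- exact: measurable_hit.
apply: eq_integral => y _.
by rewrite -EFinM (hitting_exponent_ball beta01 hX hC x y e0 t0).
Qed.

Lemma cluster_hitE mu t x e : (0 < t)%R ->
  cluster_hit eta Q mu t x e = ((beta * t) `^ beta^-1)%:E * J mu t x e.
Proof.
move=> t0; rewrite -ge0_integralZl_EFin ?powR_ge0//; last 2 first.
- by move=> y _; exact: hit_ge0.
- exact: measurable_hit.
apply: eq_integral => y _.
have mA : measurable [set w | 0 < eta t w (eball x e)].
  by apply: (measurable_cluster_hit hC t0); exact: measurable_eball.
rewrite -EFinM /hitting_exponent /cluster_rate mulrA -powRD; last first.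
  by rewrite (gt_eqF (mulr_gt0 beta0 t0)) implybT.
by rewrite subrr powRr0 mul1r fineK// prob_kernel_fin.
Qed.

(** If z is the mean of the Poisson number of clusters that hit a set, then
    1 - exp (- z) is the probability of a hit, and z - z^2 <= 1 - exp (- z) <= z. *)
Lemma poisson_hit_bounds k (z : \bar R) : (0 < k)%R -> 0 <= z ->
  k%:E * z \is a fin_num ->
  k%:E * z - (fine (k%:E * z) ^+ 2 / k)%:E <= k%:E * (1 - expeR (- z)) <= k%:E * z.
Proof.
move=> k0; case: z => [r| |]// r0; last by rewrite gt0_muley.
move=> _; rewrite -EFinM [fine _]/= -EFinB /= -EFinB -EFinM !lee_fin; rewrite lee_fin in r0.
have e1 : (1 - r <= expR (- r))%R by have := expR_ge1Dx (- r).
have e2 : (expR (- r) <= 1 - r + r ^+ 2)%R.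
  have q0 : (0 <= 1 - r + r ^+ 2)%R by nra.
  rewrite expRN -[leLHS]mul1r ler_pdivrMr ?expR_gt0//.
  apply: (@le_trans _ _ ((1 - r + r ^+ 2) * (1 + r))%R).
    have : (0 <= r ^+ 3)%R by exact: exprn_ge0.
    by rewrite !exprS expr0; nra.
  by rewrite ler_wpM2l// expR_ge1Dx.
apply/andP; split; last by rewrite ler_pM2l//; lra.
have -> : ((k * r) ^+ 2 / k = k * r ^+ 2)%R by field; rewrite gt_eqF.
by rewrite -mulrBr ler_pM2l//; lra.
Qed.

(** Dominated convergence under mu, with the Gaussian of variance 10 t. *)
Lemma scaled_integral_cvg mu t x : (0 < t)%R ->
  (forall s, (0 < s)%R -> heat_convolution mu s x < +oo) ->
  I mu t x e @[e --> 0^'+] --> c%:E * heat_convolution mu t x.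
Proof.
move=> t0 fin; have [C C0 hC'] := scaled_exponent_bounds beta01 hX hC.
pose r0 : R := Num.sqrt t; have r00 : (0 < r0)%R by rewrite sqrtr_gt0.
have -> : c%:E * heat_convolution mu t x = \int[mu]_y (c * heat_kernel t (y - x))%:E.
  rewrite heat_convolutionE (integralZ mu (ltW c0) (measurable_heatB t x))// => y.
  exact: heat_kernel_ge0.
set L := (X in _ --> X).
have Lfin : L \is a fin_num.
  rewrite ge0_fin_numE; last by apply: integral_ge0 => y _; rewrite lee_fin mulr_ge0 ?heat_kernel_ge0 ?(ltW c0).
  rewrite /L (integralZ mu (ltW c0) (measurable_heatB t x)); last first.
    by move=> y; exact: heat_kernel_ge0.
  by rewrite -heat_convolutionE lte_mul_pinfty ?lee_fin ?(ltW c0)// fin.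
(* The domination holds for e^2 <= t only, hence the cap on e. *)
have h : I mu t x (Num.min e r0) @[e --> 0^'+] --> L.
  rewrite -(fineK Lfin).
  apply/cvge_at_rightP => u [u0 ucvg].
  pose u' n := Num.min (u n) r0.
  have u'0 n : (0 < u' n)%R by rewrite lt_min u0.
  have u's n : (u' n ^+ 2 <= t)%R.
    rewrite -[leRHS](sqr_sqrtr (ltW t0)) ler_pXn2r ?nnegrE ?(ltW (u'0 n))//.
    by rewrite ge_min lexx orbT.
  have u'cvg : u' n @[n --> \oo] --> (0 : R)%R.
    apply: (@squeeze_cvgr _ _ _ _ (fun=> 0%R) u); last 2 first.
    - exact: cvg_cst.
    - exact: ucvg.
    by apply: nearW => n; rewrite (ltW (u'0 n))/= ge_min lexx.
  have [] // := @dominated_convergence _ _ _ mu setT measurableT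
    (fun n y => (phi (u' n) t (y - x))%:E) (fun y => (c * heat_kernel t (y - x))%:E)
    (fun y => (C * heat_kernel (10 * t) (y - x))%:E).
  - by move=> n; exact: measurable_phiB.
  - by apply/measurable_EFinP; apply: measurable_funM => //; exact: measurable_heatB.
  - apply: aeW => y _; apply: cvg_EFin; first exact: nearW.
    have /cvg_at_rightP := @scaled_exponent_cvg _ _ _ _ _ _ _ _ _ _ _ _ beta01 hX hC hc t (y - x)%R t0.
    by move=> /(_ u' (conj u'0 u'cvg)).
  - apply/integrableP; split.
      by apply/measurable_EFinP/measurable_funM => //; exact: measurable_heatB.
    have E y : `|(C * heat_kernel (10 * t) (y - x))%:E| =
        (C * heat_kernel (10 * t) (y - x))%:E.
      by rewrite gee0_abs// lee_fin mulr_ge0 ?heat_kernel_ge0 ?(ltW C0).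
    under eq_integral do rewrite E.
    rewrite (integralZ mu (ltW C0) (measurable_heatB (10 * t) x)); last first.
      by move=> y; exact: heat_kernel_ge0.
    by rewrite -heat_convolutionE lte_mul_pinfty ?lee_fin ?(ltW C0)// fin// mulr_gt0.
  - apply: aeW => y n _; rewrite gee0_abs; last exact: phi_ge0.
    by rewrite lee_fin; have [] := hC' (u' n) t (y - x)%R (u'0 n) (u's n).
  by move=> _ _ cv; rewrite (fineK Lfin); exact: cv.
apply: cvg_trans h; apply: near_eq_cvg; near=> e.
have er : (e <= r0)%R by near: e; exact: nbhs_right_le.
by rewrite min_l.
Unshelve. all: by end_near. Qed.

Let kappa_gt0 e : (0 < e)%R -> (0 < kappa e)%R.
Proof. by move=> e0; rewrite powR_gt0. Qed.

Let kappaV e : (e `^ (d%:R - 2 / beta) = (kappa e)^-1)%R.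
Proof. by rewrite -powRN opprB. Qed.

Let I_ge0 mu t x e : (0 < e)%R -> (0 < t)%R -> 0 <= I mu t x e.
Proof. by move=> e0 t0; apply: integral_ge0 => y _; exact: phi_ge0. Qed.

Let p0 : (0 < d%:R - 2 / beta)%R. Proof. by rewrite subr_gt0. Qed.

(** In the scaling of the theorem the quadratic correction carries the factor
    e^(d - 2/beta), which vanishes because d > 2/beta. *)
Lemma superprocess_hit_bounds mu t x e : sigma_finite setT mu ->
  (0 < e)%R -> (0 < t)%R -> I mu t x e \is a fin_num ->
  I mu t x e - (fine (I mu t x e) ^+ 2 * e `^ (d%:R - 2 / beta))%:E <=
  (kappa e)%:E * superprocess_hit xi P mu t x e <= I mu t x e.
Proof.
move=> smu e0 t0; rewrite -scaled_integral// kappaV => fin.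
rewrite /superprocess_hit (hitting_probability beta01 hX hC smu t0); last first.
  exact: measurable_eball.
apply: poisson_hit_bounds => //; first exact: kappa_gt0.
by apply: integral_ge0 => y _; exact: hit_ge0.
Qed.

Lemma superprocess_hit_cvg mu t x : sigma_finite setT mu ->
  locally_finite_under xi P mu -> (0 < t)%R ->
  (kappa e)%:E * superprocess_hit xi P mu t x e @[e --> 0^'+] -->
  c%:E * heat_convolution mu t x.
Proof.
move=> smu lf t0.
have hfin s : (0 < s)%R -> heat_convolution mu s x < +oo.
  exact: (heat_convolution_fin beta01 hX hC x smu lf).
have h0 : 0 <= heat_convolution mu t x.
  by apply: integral_ge0 => y _; rewrite lee_fin heat_kernel_ge0.
have Lfin : c%:E * heat_convolution mu t x \is a fin_num.
  by rewrite fin_numM// ge0_fin_numE// hfin.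
have hI := scaled_integral_cvg t0 hfin.
have /fine_cvgP[Ifin Icvg] : I mu t x e @[e --> 0^'+] --> (fine (c%:E * heat_convolution mu t x))%:E.
  by rewrite fineK.
have corr : (fine (I mu t x e) ^+ 2 * e `^ (d%:R - 2 / beta))%:E @[e --> 0^'+] --> 0%:E.
  pose l := fine (c%:E * heat_convolution mu t x).
  have cv : (fine (I mu t x e) ^+ 2 * e `^ (d%:R - 2 / beta))%R @[e --> 0^'+] -->
      (l ^+ 2 * 0)%R.
    apply: cvgM; last exact: powR_cvg0.
    by rewrite expr2; under eq_fun do rewrite expr2; exact: cvgM.
  by apply: cvg_EFin; [exact: nearW|move: cv; rewrite mulr0].
apply: (squeeze_cvge _ _ hI).
- near=> e.
  have fe : I mu t x e \is a fin_num by near: e.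
  exact: superprocess_hit_bounds.
- rewrite -[X in _ --> X]sube0; apply: cvgeB => //.
  by rewrite fin_num_adde_defr.
Unshelve. all: by end_near. Qed.

Lemma cluster_hit_cvg mu t x : sigma_finite setT mu ->
  locally_finite_under xi P mu -> (0 < t)%R ->
  (kappa e)%:E * cluster_hit eta Q mu t x e @[e --> 0^'+] -->
  (c * (beta * t) `^ beta^-1)%:E * heat_convolution mu t x.
Proof.
move=> smu lf t0.
have hfin s : (0 < s)%R -> heat_convolution mu s x < +oo.
  exact: (heat_convolution_fin beta01 hX hC x smu lf).
have hI := scaled_integral_cvg t0 hfin.
have h : ((beta * t) `^ beta^-1)%:E * I mu t x e @[e --> 0^'+] -->
    ((beta * t) `^ beta^-1)%:E * (c%:E * heat_convolution mu t x).
  exact: cvgeZl.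
rewrite [(c * _)%R]mulrC EFinM -muleA; apply: cvg_trans h.
apply: near_eq_cvg; near=> e; have e0 : (0 < e)%R by [].
by rewrite cluster_hitE// muleCA scaled_integral.
Unshelve. all: by end_near. Qed.

(** Uniform limit of the rescaled expected number of hitting clusters. The
    weight is the one under which both normalizations are covered. *)
Lemma scaled_integral_unif M a : (0 < M)%R -> (0 < a)%R -> exists D : R,
  forall r, (0 < r)%R -> \forall e \near 0^'+, forall mu t x,
    mu setT <= M%:E -> (a <= t)%R ->
    exists i h : R, [/\ I mu t x e = i%:E, heat_convolution mu t x = h%:E,
      (0 <= i <= D)%R &
      ((1 + (beta * t) `^ beta^-1) * `|i - c * h| <= r)%R].
Proof.
move=> M0 a0; have [C C0 hC'] := scaled_exponent_bounds beta01 hX hC.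
pose K : R := (C * (2 * pi * a) `^ (- (d%:R / 2)))%R.
have K0 : (0 <= K)%R by rewrite mulr_ge0 ?powR_ge0 ?(ltW C0).
exists (K * M)%R => r r0.
have rM0 : (0 < r / M)%R by rewrite divr_gt0.
have unif := scaled_exponent_cvg_unif beta01 beta_d hX hC hc a0 rM0.
near=> e => mu t x muM at_.
have e0 : (0 < e)%R by [].
have t0 : (0 < t)%R by exact: lt_le_trans at_.
have e_t : (e ^+ 2 <= t)%R.
  have er : (e <= Num.sqrt a)%R by near: e; apply: nbhs_right_le; rewrite sqrtr_gt0.
  apply: le_trans at_.
  by rewrite -[leRHS](sqr_sqrtr (ltW a0)) ler_pXn2r ?nnegrE ?(ltW e0).
have ue : forall x, ((1 + (beta * t) `^ beta^-1) *
    `|phi e t x - c * heat_kernel t x| <= r / M)%R.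
  by move=> z; move: t z at_ {t0 e_t}; near: e.
pose w : R := (1 + (beta * t) `^ beta^-1)%R.
have w0 : (0 < w)%R by rewrite ltr_pwDl ?powR_ge0.
have mufin : mu setT \is a fin_num.
  by rewrite ge0_fin_numE//; exact: le_lt_trans muM (ltry M).
pose m := fine (mu setT); have mE : mu setT = m%:E by rewrite fineK.
have m0 : (0 <= m)%R by exact: fine_ge0.
have mM : (m <= M)%R by rewrite -lee_fin -mE.
pose del : R := (r / M / w)%R.
have del0 : (0 < del)%R by rewrite divr_gt0.
have near_le y : (`|phi e t (y - x) - c * heat_kernel t (y - x)| <= del)%R.
  by rewrite /del ler_pdivlMr// mulrC; exact: ue.
have phi0 y : (0 <= phi e t (y - x))%R by rewrite -lee_fin; exact: phi_ge0.
have ch0 y : (0 <= c * heat_kernel t (y - x))%R.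
  by rewrite mulr_ge0 ?heat_kernel_ge0 ?(ltW c0).
have mch : measurable_fun setT (fun y => (c * heat_kernel t (y - x))%:E).
  by apply/measurable_EFinP; apply: measurable_funM => //; exact: measurable_heatB.
have mphi := measurable_phiB x e0 t0.
pose H := \int[mu]_y (c * heat_kernel t (y - x))%:E.
have HE : H = c%:E * heat_convolution mu t x.
  rewrite /H (integralZ mu (ltW c0) (measurable_heatB t x)) -?heat_convolutionE// => y.
  exact: heat_kernel_ge0.
have intcst k : (0 <= k)%R -> \int[mu]_y k%:E = (k * m)%:E.
  by move=> k0; rewrite integral_cst// mE.
have IK : I mu t x e <= (K * m)%:E.
  rewrite -intcst//; apply: ge0_le_integral => //.
  - by move=> y _; rewrite lee_fin.
  - move=> y _; rewrite lee_fin; have [_ h] := hC' e t (y - x)%R e0 e_t.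
    apply: (le_trans h); rewrite ler_wpM2l ?(ltW C0)// !powRN.
    rewrite lef_pV2 ?posrE ?powR_gt0 ?pi2_gt0//.
    rewrite ge0_ler_powR ?nnegrE ?divr_ge0 ?(ltW (pi2_gt0 _))//.
    by rewrite ler_pM2l ?mulr_gt0 ?pi_gt0.
have add f g : measurable_fun setT (fun y => (f y : R)%:E) ->
    (forall y, 0 <= f y)%R -> measurable_fun setT (fun y => (g y : R)%:E) ->
    (forall y, 0 <= g y)%R -> (forall y, f y <= g y + del)%R ->
    \int[mu]_y (f y)%:E <= \int[mu]_y (g y)%:E + (del * m)%:E.
  move=> mf f0 mg g0 fg; rewrite -(intcst _ (ltW del0)) -ge0_integralD//; last 2 first.
  - by move=> y _; rewrite lee_fin.
  - by move=> y _; rewrite lee_fin ltW.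
  apply: ge0_le_integral => //.
  - by move=> y _; rewrite lee_fin.
  - by apply: emeasurable_funD => //; exact: measurable_cst.
  - by move=> y _; rewrite -EFinD lee_fin.
have le1 : I mu t x e <= H + (del * m)%:E.
  apply: add => // y; have := near_le y; rewrite ler_norml => /andP[_]; lra.
have le2 : H <= I mu t x e + (del * m)%:E.
  apply: add => // y; have := near_le y; rewrite ler_norml => /andP[]; lra.
have Ifin : I mu t x e \is a fin_num.
  by rewrite ge0_fin_numE ?I_ge0//; exact: le_lt_trans IK (ltry _).
pose i := fine (I mu t x e); have iE : I mu t x e = i%:E by rewrite fineK.
have hfin : heat_convolution mu t x \is a fin_num.
  rewrite ge0_fin_numE; last by apply: integral_ge0 => y _; rewrite lee_fin heat_kernel_ge0.
  have : c%:E * heat_convolution mu t x < +oo.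
    by rewrite -HE; apply: (le_lt_trans le2); rewrite iE -EFinD ltry.
  by case: (heat_convolution mu t x) => // [?|]; rewrite ?ltry// gt0_muley ?lte_fin.
pose h := fine (heat_convolution mu t x).
have hE : heat_convolution mu t x = h%:E := esym (fineK hfin).
exists i, h; split; [exact: iE|exact: hE| |].
- apply/andP; split; first by rewrite -lee_fin -iE I_ge0.
  rewrite -lee_fin -iE; apply: (le_trans IK); rewrite lee_fin ler_wpM2l//.
- have wd : (w * (del * m) <= r)%R.
    have -> : (w * (del * m) = r * (m / M))%R.
      by rewrite /del; field; rewrite !gt_eqF.
    by rewrite ler_piMr ?(ltW r0)// ler_pdivrMr// mul1r.
  apply: le_trans wd; rewrite ler_pM2l// ler_norml.
  move: le1 le2; rewrite HE hE iE -!EFinM -!EFinD !lee_fin => le1 le2.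
  by apply/andP; split; lra.
Unshelve. all: by end_near. Qed.

Let finite_sigma_finite mu M : mu setT <= M%:E -> sigma_finite setT mu.
Proof.
move=> muM; exists (fun=> setT) => [|n]; first by rewrite bigcup_const.
by split => //; exact: le_lt_trans muM (ltry M).
Qed.

Lemma superprocess_hit_unif M a r : (0 < M)%R -> (0 < a)%R -> (0 < r)%R ->
  \forall e \near 0^'+, forall mu t x, mu setT <= M%:E -> (a <= t)%R ->
    `|(kappa e)%:E * superprocess_hit xi P mu t x e -
      c%:E * heat_convolution mu t x| < r%:E.
Proof.
move=> M0 a0 r0; have [D unif] := scaled_integral_unif M0 a0.
have r30 : (0 < r / 3)%R by rewrite divr_gt0.
have small : \forall e \near 0^'+, (D ^+ 2 * e `^ (d%:R - 2 / beta) <= r / 3)%R.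
  have cv : (D ^+ 2 * e `^ (d%:R - 2 / beta))%R @[e --> 0^'+] --> (D ^+ 2 * 0)%R.
    by apply: cvgM; [exact: cvg_cst|exact: powR_cvg0].
  by move: cv; rewrite mulr0 => cv; exact: (cvgr_le _ cv _ r30).
near=> e => mu t x muM at_.
have e0 : (0 < e)%R by [].
have t0 : (0 < t)%R by exact: lt_le_trans at_.
have sm : (D ^+ 2 * e `^ (d%:R - 2 / beta) <= r / 3)%R by near: e.
have [i [h [iE hE /andP[i0 iD] ih]]] : exists i h : R,
    [/\ I mu t x e = i%:E, heat_convolution mu t x = h%:E,
      (0 <= i <= D)%R &
      ((1 + (beta * t) `^ beta^-1) * `|i - c * h| <= r / 3)%R].
  by move: mu t x muM at_ {t0}; near: e; exact: unif.
have Ifin : I mu t x e \is a fin_num by rewrite iE.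
have := superprocess_hit_bounds (finite_sigma_finite muM) e0 t0 Ifin.
have ih' : (`|i - c * h| <= r / 3)%R.
  by apply: le_trans ih; rewrite ler_peMl// lerDl powR_ge0.
have corr : (i ^+ 2 * e `^ (d%:R - 2 / beta) <= r / 3)%R.
  apply: le_trans sm; rewrite ler_wpM2r ?powR_ge0// ler_pXn2r ?nnegrE//.
  exact: le_trans iD.
rewrite iE hE -EFinM -EFinB; case: (_ * superprocess_hit _ _ _ _ _ _) => [q| |]//; last first.
  by move=> /andP[_]; rewrite leye_eq.
rewrite -EFinB abse_EFin !lee_fin lte_fin => /andP[q1 q2].
move: ih'; rewrite ler_norml => /andP[h1 h2]; rewrite ltr_norml.
by apply/andP; split; move: corr q1 => /=; set v := (_ * _ `^ _)%R; lra.
Unshelve. all: by end_near. Qed.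

Lemma cluster_hit_unif M a r : (0 < M)%R -> (0 < a)%R -> (0 < r)%R ->
  \forall e \near 0^'+, forall mu t x, mu setT <= M%:E -> (a <= t)%R ->
    `|(kappa e)%:E * cluster_hit eta Q mu t x e -
      (c * (beta * t) `^ beta^-1)%:E * heat_convolution mu t x| < r%:E.
Proof.
move=> M0 a0 r0; have [D unif] := scaled_integral_unif M0 a0.
have r20 : (0 < r / 2)%R by rewrite divr_gt0.
near=> e => mu t x muM at_.
have e0 : (0 < e)%R by [].
have t0 : (0 < t)%R by exact: lt_le_trans at_.
have [i [h [iE hE _ ih]]] : exists i h : R,
    [/\ I mu t x e = i%:E, heat_convolution mu t x = h%:E,
      (0 <= i <= D)%R &
      ((1 + (beta * t) `^ beta^-1) * `|i - c * h| <= r / 2)%R].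
  by move: mu t x muM at_ {t0}; near: e; exact: unif.
rewrite cluster_hitE// muleCA scaled_integral// iE hE -!EFinM -EFinB abse_EFin lte_fin.
set w := ((beta * t) `^ beta^-1)%R; rewrite -/w in ih.
have -> : (w * i - c * w * h = w * (i - c * h))%R by ring.
rewrite normrM (ger0_norm (powR_ge0 _ _)).
apply: (@le_lt_trans _ _ (r / 2)%R); last by rewrite ltr_pdivrMr// ltr_pMr// ltr1n.
by apply: le_trans ih; rewrite ler_wpM2r// lerDr.
Unshelve. all: by end_near. Qed.

End hitting_asymptotics.

Theorem theorem4p3 (R : realType) (d : nat) (beta : R)
    (dW : measure_display) (W : measurableType dW)
    (xi : R -> W -> measures R d) (P : measures R d -> probability W R)
    (dV : measure_display) (V : measurableType dV)
    (eta : R -> V -> measures R d) (Q : R.-pker 'rV[R]_d ~> V) (c : R) :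
  0 < beta < 1 -> 2 / beta < d%:R ->
  superprocess xi P beta -> cluster_family xi P eta Q beta ->
  hitting_constant d beta c ->
  [/\ forall (mu : measures R d) (t : R) (x : 'rV[R]_d),
        sigma_finite setT mu -> locally_finite_under xi P mu -> 0 < t ->
        ((eps `^ (2 / beta - d%:R))%:E * superprocess_hit xi P mu t x eps)%E
          @[eps --> 0^'+] --> (c%:E * heat_convolution mu t x)%E,
      forall M a e : R, 0 < M -> 0 < a -> 0 < e ->
        \forall eps \near 0^'+,
          forall (mu : measures R d) (t : R) (x : 'rV[R]_d),
            (mu setT <= M%:E)%E -> a <= t ->
            (`| (eps `^ (2 / beta - d%:R))%:E * superprocess_hit xi P mu t x eps
                - c%:E * heat_convolution mu t x | < e%:E)%E,
      forall (mu : measures R d) (t : R) (x : 'rV[R]_d),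
        sigma_finite setT mu -> locally_finite_under xi P mu -> 0 < t ->
        ((eps `^ (2 / beta - d%:R))%:E * cluster_hit eta Q mu t x eps)%E
          @[eps --> 0^'+]
          --> ((c * (beta * t) `^ beta^-1)%:E * heat_convolution mu t x)%E &
      forall M a e : R, 0 < M -> 0 < a -> 0 < e ->
        \forall eps \near 0^'+,
          forall (mu : measures R d) (t : R) (x : 'rV[R]_d),
            (mu setT <= M%:E)%E -> a <= t ->
            (`| (eps `^ (2 / beta - d%:R))%:E * cluster_hit eta Q mu t x eps
                - (c * (beta * t) `^ beta^-1)%:E * heat_convolution mu t x |
             < e%:E)%E].
Proof.
move=> beta01 beta_d hX hC hc.
have beta01' : 0 < beta <= 1.
  by case/andP: beta01 => b0 b1; rewrite b0 (ltW b1).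
split.
- by move=> mu t x; exact: (superprocess_hit_cvg beta01' beta_d hX hC hc).
- move=> M a e; exact: (superprocess_hit_unif beta01' beta_d hX hC hc).
- by move=> mu t x; exact: (cluster_hit_cvg beta01' hX hC hc).
- move=> M a e; exact: (cluster_hit_unif beta01' beta_d hX hC hc).
Qed.
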